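(* Let $M$ be an oriented 3-manifold. With the boundary operator $\partial=\sum_{i=1}^n(-1)^{i+1}\mathrm{d}_i$, the square of maps $$p_b:C_n(X^{b,0})\to C_n(X^b),\quad p_0:C_n(X^{b,0})\to C_n(X^0),\quad p_\omega\circ i:C_n(X^b)\to C_n(X^\omega),\quad p_\omega:C_n(X^0)\to C_n(X^\omega)$$ ($n\ge 0$) is a commutative diagram of chain complexes and chain maps; that is, $\partial$ is well defined on each of $C_*(X^{b,0}),C_*(X^b),C_*(X^0),C_*(X^\omega)$ and satisfies $\partial^2=0$, the four maps are chain maps, and $(p_\omega\circ i)\circ p_b=p_\omega\circ p_0$. Moreover, with the same boundary operator, in each of the four cases one can form the relative chain complex $C_n(X,D)=C_n(X)/C_n(D)$, where $C_n(D)$ is the subgroup generated by degenerate $n$-singular knots and $C_0(D)=0$.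
   Context: An $n$-singular knot in $M$ is an immersion $S^1\to M$ (with a chosen direction of $S^1$) which is an embedding except for $n$ transverse double points; $X_n$ is the set of these up to direction-preserving rigid-vertex isotopy. Each double point has a canonical positive and a canonical negative resolution, determined by the orientation of $M$. All groups are over $\mathbf{Q}$: (1) $X_n^b$: equivalence classes of $n$-singular knots with a base point $b$ apart from the double points, up to direction-preserving rigid-vertex isotopy carrying base point to base point and keeping it apart from the double points throughout. The double points of such a knot are ordered $1,\dots,n$ in the order they are first met travelling along the knot from $b$; the knot with this natural ordering is written $(K_{1\ldots n},b)$. $C_n(X^b)$ is the $\mathbf Q$-vector space with basis $X_n^b$. (2) $X_n^{b,0}$: elements $(K_{\sigma(1\ldots n)},b)$ obtained from elements of $X_n^b$ by permuting the natural ordering of the double points by an arbitrary $\sigma\in S_n$ (so $X_n^{b,0}\cong X_n^b\times S_n$, $X_0^{b,0}=X_0^b$). $C_n(X^{b,0})$ has basis $X_n^{b,0}$. (3) $X_n^0$: $n$-singular knots with double points ordered from $1$ to $n$, up to direction-preserving rigid-vertex isotopy mapping each double point to the one with the same label (no base point; $X_0^0=X_0$). $C_n(X^0)$ has basis $X_n^0$. (4) $C_n(X^\omega)$ is the quotient of $C_n(X^0)$ by the relations $K_{1\ldots n}\sim_\omega \mathrm{sign}(\sigma)K_{\sigma(1\ldots n)}$, $\sigma\in S_n$, where $K_{\sigma(1\ldots n)}$ is $K_{1\ldots n}$ with the ordering permuted by $\sigma$. Maps: $p_0$ forgets the base point and keeps the ordering; $p_b(K_{\sigma(1\ldots n)},b)=\mathrm{sign}(\sigma)(K_{1\ldots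 n},b)$; $i:C_n(X^b)\to C_n(X^0)$ is $i(K_{1\ldots n},b)=p_0(K_{1\ldots n},b)$; $p_\omega$ is the quotient map. For an $n$-singular knot $K$ with ordered double points, $\mathrm{d}_iK=K_{\times\ldots\underset{i}{+}\ldots\times}-K_{\times\ldots\underset{i}{-}\ldots\times}$, the difference of the positive and negative resolution at the $i$-th double point, each with the ordering (and base point) induced from $K$. The boundary operator is $\partial K=\sum_{i=1}^n(-1)^{i+1}\mathrm{d}_iK$, defined first on $C_n(X^{b,0})$ and then on the other groups by the same formula. For $n\ge1$ an $n$-singular knot $K$ is degenerate if, for any ordering of its double points, there is $i$, $1\le i\le n$, with $\mathrm{d}_iK=0$ (as an identity among singular knots carrying the structure under consideration). $C_n(D)$ is the respective subgroup of $C_n(X)$ generated by degenerate $n$-singular knots, with $C_0(D)=0$. *)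

(* Defs.v *)
From HB Require Import structures.
From mathcomp Require Import all_boot all_order all_algebra perm generic_quotient.
From mathcomp Require Import all_classical all_reals all_analysis.
From mathcomp.multinomials Require Import freeg.

Set Implicit Arguments.
Unset Strict Implicit.
Unset Printing Implicit Defensive.

Import Order.TTheory GRing.Theory Num.Theory.
Import numFieldNormedType.Exports.

Local Open Scope classical_set_scope.
Local Open Scope ring_scope.
Local Open Scope quotient_scope.

Section ModuleQuotient.
Context {F : nzRingType} {V : lmodType F}.

Definition submodule_pred (W : set V) : Prop :=
  W 0 /\ forall (a : F) (x y : V), W x -> W y -> W (a *: x + y).

Definition mspan (S : set V) : set V := smallest submodule_pred S.

Lemma mspan_submodule (S : set V) : submodule_pred (mspan S).
Proof.
split=> [W [[W0 _] _] //|a x y Sx Sy W WP].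
by case: (WP) => -[_ WD] _; apply: WD; [apply: Sx|apply: Sy].
Qed.

Lemma mspan0 S : mspan S 0.
Proof. by case: (mspan_submodule S). Qed.

Lemma mspanD S x y : mspan S x -> mspan S y -> mspan S (x + y).
Proof. by case: (mspan_submodule S) => _ SD Sx Sy; rewrite -[x]scale1r; apply: SD. Qed.

Lemma mspanZ S a x : mspan S x -> mspan S (a *: x).
Proof.
by case: (mspan_submodule S) => S0 SD Sx; rewrite -[a *: x]addr0; apply: SD.
Qed.

Lemma mspanN S x : mspan S x -> mspan S (- x).
Proof. by move=> Sx; rewrite -scaleN1r; apply: mspanZ. Qed.

Definition meqv (S : set V) (x y : V) : bool := `[< mspan S (x - y) >].

Lemma meqv_refl S : reflexive (meqv S).
Proof. by move=> x; apply/asboolP; rewrite subrr; apply: mspan0. Qed.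

Lemma meqv_sym S : symmetric (meqv S).
Proof.
by move=> x y; apply/asboolP/asboolP => /mspanN; rewrite opprB.
Qed.

Lemma meqv_trans S : transitive (meqv S).
Proof.
move=> y x z /asboolP xy /asboolP yz; apply/asboolP.
by rewrite -(subrKA y); apply: mspanD.
Qed.

Canonical meqv_equiv S :=
  EquivRel (meqv S) (@meqv_refl S) (@meqv_sym S) (@meqv_trans S).

Definition mquot (S : set V) : Type := {eq_quot meqv_equiv S}.

HB.instance Definition _ S := Choice.on (mquot S).
HB.instance Definition _ S := EqQuotient.on (mquot S).

Definition mproj (S : set V) (x : V) : mquot S := \pi_(mquot S) x.

Lemma mprojP S x y : mspan S (x - y) <-> mproj S x = mproj S y.
Proof.
split=> [h|/eqmodP /asboolP //].
by apply/eqmodP/asboolP.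
Qed.

Lemma mreprK S (x : mquot S) : mproj S (repr x) = x.
Proof. exact: reprK. Qed.

Lemma mrepr_proj S x : mspan S (repr (mproj S x) - x).
Proof. by apply/mprojP; rewrite mreprK. Qed.

Definition mq_zero S : mquot S := mproj S 0.
Definition mq_opp S (x : mquot S) : mquot S := mproj S (- repr x).
Definition mq_add S (x y : mquot S) : mquot S := mproj S (repr x + repr y).
Definition mq_scale S (a : F) (x : mquot S) : mquot S := mproj S (a *: repr x).

Lemma mq_addE S x y : mq_add (mproj S x) (mproj S y) = mproj S (x + y).
Proof. by apply/mprojP; rewrite opprD addrACA; apply: mspanD; exact: mrepr_proj. Qed.

Lemma mq_oppE S x : mq_opp (mproj S x) = mproj S (- x).
Proof. by apply/mprojP; rewrite -opprD; apply: mspanN; exact: mrepr_proj. Qed.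

Lemma mq_scaleE S a x : mq_scale a (mproj S x) = mproj S (a *: x).
Proof. by apply/mprojP; rewrite -scalerBr; apply: mspanZ; exact: mrepr_proj. Qed.

Lemma mq_addA S : associative (@mq_add S).
Proof.
move=> x y z; rewrite -(mreprK x) -(mreprK y) -(mreprK z).
by rewrite !mq_addE addrA.
Qed.

Lemma mq_addC S : commutative (@mq_add S).
Proof. by move=> x y; rewrite /mq_add addrC. Qed.

Lemma mq_add0 S : left_id (mq_zero S) (@mq_add S).
Proof. by move=> x; rewrite -(mreprK x) mq_addE add0r. Qed.

Lemma mq_addN S : left_inverse (mq_zero S) (@mq_opp S) (@mq_add S).
Proof. by move=> x; rewrite -(mreprK x) mq_oppE mq_addE addNr. Qed.

HB.instance Definition _ S := GRing.isZmodule.Build (mquot S)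
  (@mq_addA S) (@mq_addC S) (@mq_add0 S) (@mq_addN S).

Lemma mq_scaleA S a b (x : mquot S) :
  mq_scale a (mq_scale b x) = mq_scale (a * b) x.
Proof. by rewrite -(mreprK x) !mq_scaleE scalerA. Qed.

Lemma mq_scale1 S : left_id 1 (@mq_scale S).
Proof. by move=> x; rewrite -(mreprK x) mq_scaleE scale1r. Qed.

Lemma mq_scaleDr S : right_distributive (@mq_scale S) +%R.
Proof.
move=> a x y; rewrite -(mreprK x) -(mreprK y).
by rewrite [X in mq_scale a X]mq_addE !mq_scaleE [RHS]mq_addE scalerDr.
Qed.

Lemma mq_scaleDl S (x : mquot S) :
  {morph (@mq_scale S)^~ x : a b / a + b}.
Proof. by move=> a b; rewrite -(mreprK x) !mq_scaleE [RHS]mq_addE scalerDl. Qed.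

HB.instance Definition _ S := GRing.Zmodule_isLmodule.Build F (mquot S)
  (@mq_scaleA S) (@mq_scale1 S) (@mq_scaleDr S) (@mq_scaleDl S).

Lemma mproj_linear (S : set V) : linear (@mproj S).
Proof.
move=> a x y; rewrite -[RHS]/(mq_add (mq_scale a (mproj S x)) (mproj S y)).
by rewrite mq_scaleE mq_addE.
Qed.

End ModuleQuotient.

(* Meaningful only when f maps mspan S into mspan T. *)
Definition mquot_map (F : nzRingType) (V W : lmodType F) (S : set V) (T : set W)
  (f : V -> W) (x : mquot S) : mquot T := mproj T (f (repr x)).

Record chart (R : realType) (M : topologicalType) := Chart {
  cdom : set M;
  cmap : M -> 'rV[R]_3;
  cinv : 'rV[R]_3 -> M;
  cdom_open : open cdom;
  cimage_open : open (cmap @` cdom);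
  cmapK : forall m, cdom m -> cinv (cmap m) = m;
  cmap_continuous : forall m, cdom m -> {for m, continuous cmap};
  cinv_continuous : forall m, cdom m -> {for cmap m, continuous cinv}
}.

(* Without boundary, in the class C^1, the least one for which immersions     *)
(* make sense.                                                                *)
Record oriented_3manifold (R : realType) := Oriented3Manifold {
  mcarrier :> topologicalType;
  mhausdorff : hausdorff_space mcarrier;
  msecond_countable : @second_countable mcarrier;
  atlas : set (chart R mcarrier);
  atlas_cover : forall m : mcarrier, exists2 phi, atlas phi & cdom phi m;
  atlas_oriented : forall phi psi m, atlas phi -> atlas psi ->
    cdom phi m -> cdom psi m ->
    let tau := cmap psi \o cinv phi in
    [/\ \forall y \near cmap phi m, differentiable tau y,
        {for cmap phi m, continuous (jacobian tau)} &
        0 < \det ('J tau (cmap phi m))]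
}.

Section SingularKnots.
Context {R : realType} {M : oriented_3manifold R}.
Implicit Types (phi : chart R M) (n : nat).

Definition velocity phi (g : R -> M) (x : R) : 'rV[R]_3 :=
  derive1 (cmap phi \o g) x.

(* The circle is R / Z: g has period 1, and v lists its double points. *)
Record is_singular_knot n (g : R -> M) (v : 'I_n -> M) : Prop := IsSingularKnot {
  loop_periodic : forall x, g (x + 1) = g x;
  loop_continuous : continuous g;
  loop_C1 : forall phi x, atlas phi -> cdom phi (g x) ->
    derivable (cmap phi \o g) x 1 /\ {for x, continuous (velocity phi g)};
  loop_immersion : forall phi x, atlas phi -> cdom phi (g x) ->
    velocity phi g x != 0;
  loop_transverse : forall phi x y, atlas phi -> cdom phi (g x) ->
    0 <= x < y -> y < 1 -> g x = g y ->
    row_free (col_mx (velocity phi g x) (velocity phi g y));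
  vertex_injective : injective v;
  vertex_all : forall x y, 0 <= x < y -> y < 1 -> g x = g y ->
    exists i, v i = g x;
  vertex_double : forall i, exists x y,
    [/\ 0 <= x < y, y < 1, g x = v i, g y = v i &
        forall z, 0 <= z < 1 -> g z = v i -> z = x \/ z = y]
}.

Record sknot n := SKnot {
  loop : R -> M;
  vertex : 'I_n -> M;
  sknotP : is_singular_knot loop vertex
}.

Lemma reorder_subproof n (s : 'S_n) (K : sknot n) :
  is_singular_knot (loop K) (vertex K \o s).
Proof.
case: K => g v [? ? ? ? ? vinj vall vdbl] /=; split=> //.
- by move=> i j /= /vinj /perm_inj.
- move=> x y xy y1 gxy; have [i vi] := vall x y xy y1 gxy.
  by exists ((s^-1)%g i) => /=; rewrite permKV.
- by move=> i; apply: vdbl.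
Qed.

(* K with its ordering permuted by s *)
Definition reorder n (s : 'S_n) (K : sknot n) : sknot n :=
  SKnot (reorder_subproof s K).

(* Continuous families of singular knots, for the C^1 topology on loops. *)
Record knot_path n (p : R -> sknot n) : Prop := KnotPath {
  path_continuous : continuous (fun z : R * R => loop (p z.1) z.2);
  path_C1 : forall phi (z : R * R), atlas phi -> cdom phi (loop (p z.1) z.2) ->
    {for z, continuous (fun w : R * R => velocity phi (loop (p w.1)) w.2)};
  path_vertex : forall i, continuous (fun t => vertex (p t) i)
}.

(* A structure imposed on ordered singular knots. *)
Definition structure := forall n, sknot n -> Prop.

Definition plain : structure := fun n K => True.

(* The base point is the image of 0, i.e. the circle is pointed. *)
Definition based : structure := fun n K => forall i, vertex K i <> loop K 0.

(* Double points are listed in the order they are first met from 0. *)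
Definition naturally_based : structure := fun n K =>
  based K /\
  forall i j : 'I_n, (i < j)%N ->
    exists2 x, 0 <= x < 1 /\ loop K x = vertex K i &
      forall y, 0 <= y < 1 -> loop K y = vertex K j -> x < y.

Record knot (P : structure) n := Knot {
  underlying :> sknot n;
  knotP : P n underlying
}.

HB.instance Definition _ P n := gen_eqMixin (knot P n).
HB.instance Definition _ P n := gen_choiceMixin (knot P n).

(* Rigid-vertex isotopy: the double points stay transverse, keep their        *)
(* labels, and the structure P persists all along. Only the restriction of    *)
(* the path to [0, 1] matters.                                                *)
Definition isotopic P n (K L : knot P n) : Prop :=
  exists p : R -> knot P n,
    [/\ knot_path (fun t => underlying (p t)), p 0 = K & p 1 = L].

Lemma isotopic_refl P n (K : knot P n) : isotopic K K.
Proof.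
exists (fun=> K); split=> //; case: K => -[g v gP] PK /=; split=> /=.
- move=> z; apply: (@continuous_comp _ _ _ snd g); first exact: cvg_snd.
  exact: loop_continuous gP _.
- move=> phi z aphi dz.
  apply: (@continuous_comp _ _ _ snd (velocity phi g)); first exact: cvg_snd.
  exact: (loop_C1 gP aphi dz).2.
- by move=> i t; apply: cvg_cst.
Qed.

Lemma knot_path_reparam n (p : R -> sknot n) (th : R -> R) :
  continuous th -> knot_path p -> knot_path (p \o th).
Proof.
move=> cth [pc pC1 pv].
pose Th (z : R * R) := (th z.1, z.2).
have cTh z : {for z, continuous Th}.
  apply: (@cvg_pair _ _ _ _ (nbhs (th z.1)) (nbhs z.2)).
    by apply: (@continuous_comp _ _ _ fst th); [exact: cvg_fst|exact: cth].
  exact: cvg_snd.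
split=> [z|phi z aphi dz|i t].
- exact: (@continuous_comp _ _ _ Th (fun z => loop (p z.1) z.2) z (cTh z) (pc _)).
- exact: (@continuous_comp _ _ _ Th
           (fun w => velocity phi (loop (p w.1)) w.2) z (cTh z) (pC1 phi (Th z) aphi dz)).
- exact: (@continuous_comp _ _ _ th (fun t => vertex (p t) i) t (cth t) (pv i _)).
Qed.

Lemma isotopic_sym P n (K L : knot P n) : isotopic K L -> isotopic L K.
Proof.
move=> [p [pc p0 p1]]; exists (fun t => p (1 - t)).
rewrite subr0 subrr; split=> //.
apply: (@knot_path_reparam _ (fun t => underlying (p t)) (fun t => 1 - t)) => //.
by move=> t; apply: cvgB; [exact: cvg_cst|exact: cvg_id].
Qed.

Lemma near_eq_continuous (T U : topologicalType) (f g : T -> U) (x : T) :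
  (\forall y \near x, f y = g y) ->
  {for x, continuous g} -> {for x, continuous f}.
Proof.
move=> fg gx; rewrite /prop_for /continuous_at (nbhs_singleton fg).
apply: cvg_trans gx; apply: near_eq_cvg.
by apply: filterS fg => y ->.
Qed.

Lemma knot_path_local n (q : R -> sknot n) :
  (forall t0 : R, exists2 p, knot_path p & \forall t \near t0, q t = p t) ->
  knot_path q.
Proof.
move=> ql.
have qnear (z : R * R) p : (\forall t \near z.1, q t = p t) ->
    \forall w \near z, q w.1 = p w.1.
  move=> qp; have zfst : (fst : R * R -> R) @ z --> z.1 by exact: cvg_fst.
  exact: (zfst _ qp).
split=> [z|phi z aphi dz|i t0].
- have [p [pc _ _] /qnear qp] := ql z.1.
  apply: (near_eq_continuous _ (pc z)).
  by apply: filterS qp => w ->.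
- have [p [_ pC1 _] /qnear qp] := ql z.1.
  move: dz; rewrite (nbhs_singleton qp) => dz.
  apply: (near_eq_continuous _ (pC1 phi z aphi dz)).
  by apply: filterS qp => w ->.
- have [p [_ _ pv] qp] := ql t0.
  apply: (near_eq_continuous _ (pv i t0)).
  by apply: filterS qp => t ->.
Qed.

Lemma isotopic_trans P n (K L N : knot P n) :
  isotopic K L -> isotopic L N -> isotopic K N.
Proof.
move=> [p [pc p0 p1]] [q [qc q0 q1]].
pose th (t : R) : R := Num.min (3 * t) 1.
pose ta (t : R) : R := Num.max (3 * t - 2) 0.
have c3 : continuous (fun t : R => 3 * t : R).
  by move=> t; apply: cvgM; [exact: cvg_cst|exact: cvg_id].
have cth : continuous th.
  by move=> t; apply: (@continuous_min R R^o (fun t => 3 * t) (fun=> 1)); [exact: c3|exact: cvg_cst].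
have cta : continuous ta.
  move=> t; apply: (@continuous_max R R^o (fun t => 3 * t - 2) (fun=> 0)); last exact: cvg_cst.
  by apply: cvgB; [exact: c3|exact: cvg_cst].
exists (fun t => if t < 2^-1 then p (th t) else q (ta t)).
split.
- apply: knot_path_local => t0; have [t0h|t0h] := ltP t0 (2 / 3).
  + exists (fun t => underlying (p (th t))).
      exact: (knot_path_reparam (p := fun t => underlying (p t)) cth pc).
    near=> t; case: ltP => // ht.
    have t23 : t < 2 / 3 by near: t; exact: lt_nbhsl.
    have -> : th t = 1 by apply/min_idPr; rewrite -ler_pdivrMl// mulr1 (le_trans _ ht)// lef_pV2 ?posrE// ler_nat.
    have -> : ta t = 0; last by rewrite p1 q0.
    by apply/max_idPr; rewrite subr_le0 mulrC -ler_pdivlMr// ltW.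
  + exists (fun t => underlying (q (ta t))).
      exact: (knot_path_reparam (p := fun t => underlying (q t)) cta qc).
    near=> t; case: ltP => // ht; exfalso; move: ht; apply/negP; rewrite -leNgt ltW//.
    near: t; apply: lt_nbhsr; apply: lt_le_trans t0h.
    by rewrite ltr_pdivlMr// mulrC ltr_pdivrMr// -natrM ltr_nat.
- rewrite invr_gt0 ltr0n /th mulr0.
  by rewrite (min_idPl _)// ler01.
- rewrite ltNge invf_le1 ?ltr0n// ler1n /= /ta mulr1 -natrB//.
  by rewrite (max_idPl _)// ler01.
Unshelve. all: by end_near.
Qed.

Definition isotopicb P n (K L : knot P n) : bool := `[< isotopic K L >].

Lemma isotopicb_refl P n : reflexive (@isotopicb P n).
Proof. by move=> K; apply/asboolP; apply: isotopic_refl. Qed.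

Lemma isotopicb_sym P n : symmetric (@isotopicb P n).
Proof. by move=> K L; apply/asboolP/asboolP; apply: isotopic_sym. Qed.

Lemma isotopicb_trans P n : transitive (@isotopicb P n).
Proof.
by move=> L K N /asboolP KL /asboolP LN; apply/asboolP; apply: isotopic_trans KL LN.
Qed.

Canonical isotopicb_equiv P n := EquivRel (@isotopicb P n)
  (@isotopicb_refl P n) (@isotopicb_sym P n) (@isotopicb_trans P n).

(* X_n^0, X_n^{b,0} and X_n^b for P = plain, based and naturally_based *)
Definition X P n := {eq_quot isotopicb_equiv P n}.

(* In the chart push_chart, the strand of the i-th double point passing at    *)
(* time push_x is pushed off the other one, passing at time push_y, in the    *)
(* direction push_dir. Only times in [push_a, push_c] are affected, where no  *)
(* other double point lies, and nothing is crossed during the push.           *)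
(* The crossing between an over-strand with velocity u, an under-strand with  *)
(* velocity w and a vector d from the latter to the former is positive when   *)
(* det (u, w, d) > 0; this is invariant under (u, w, d) -> (w, u, -d), so     *)
(* either strand may be pushed.                                               *)
Record push (positive : bool) n (i : 'I_n.+1) (K : sknot n.+1) := Push {
  push_chart : chart R M;
  push_x : R;
  push_y : R;
  push_a : R;
  push_c : R;
  push_height : R -> R;
  push_dir : 'rV[R]_3;
  pushed : R -> R -> M;
  push_atlas : atlas push_chart;
  push_xP : loop K push_x = vertex K i;
  push_yP : loop K push_y = vertex K i;
  push_xy : forall k : int, push_y <> push_x + k%:~R;
  push_arc : push_a < push_x < push_c;
  push_arc_short : push_c < push_a + 1;
  push_arc_dom : forall z, push_a <= z <= push_c -> cdom push_chart (loop K z);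
  push_arc_vertex : forall z j, push_a <= z <= push_c ->
    loop K z = vertex K j -> z = push_x;
  push_height_gt0 : 0 < push_height push_x;
  push_sign :
    let d := \det (col_mx (velocity push_chart (loop K) push_x)
                  (col_mx (velocity push_chart (loop K) push_y) push_dir)
                   : 'M[R]_3) in
    if positive then 0 < d else d < 0;
  pushed_arc : forall t z, 0 < t <= 1 -> push_a <= z <= push_c ->
    cdom push_chart (pushed t z) /\
    cmap push_chart (pushed t z) =
      cmap push_chart (loop K z) + (t * push_height z) *: push_dir;
  pushed_off_arc : forall t z, 0 < t <= 1 -> push_c <= z <= push_a + 1 ->
    pushed t z = loop K z;
  pushed_knot : forall t, 0 < t <= 1 ->
    is_singular_knot (pushed t) (vertex K \o fintype.lift i)
}.

(* K' is K with its i-th double point resolved, positively or negatively; the *)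
(* remaining double points keep their relative order.                         *)
Definition resolves positive n (i : 'I_n.+1) (K : sknot n.+1) (K' : sknot n) :=
  exists D : push positive i K,
    loop K' =1 pushed D 1 /\ vertex K' =1 vertex K \o fintype.lift i.

Definition resolution_well_defined (P : structure) : Prop :=
  forall positive n (i : 'I_n.+1) (K L : knot P n.+1), isotopic K L ->
    (exists K' : knot P n, resolves positive i K K') /\
    (forall K' L' : knot P n,
       resolves positive i K K' -> resolves positive i L L' -> isotopic K' L').

Definition chains P n : lmodType rat := {freeg (X P n) / rat}.

Definition gen P n (K : knot P n) : chains P n := << \pi_(X P n) K >>.

(* xget picks the class of a resolution of a representative; its default      *)
(* value 0 is never used, by resolution_well_defined.                         *)
Definition resolution P positive n (i : 'I_n.+1) (A : X P n.+1) : chains P n :=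
  xget 0 [set c | exists2 K' : knot P n, resolves positive i (repr A) K'
                                       & c = gen K'].

Definition dd P n (i : 'I_n.+1) (A : X P n.+1) : chains P n :=
  resolution true i A - resolution false i A.

(* Double points are numbered from 0, so (-1)^(i+1) becomes (-1)^i. *)
Definition boundary P n : chains P n.+1 -> chains P n :=
  fglift (fun A => \sum_(i < n.+1) (-1) ^+ i *: dd i A).

(* A reading of the boundary formula that does not depend on xget: K may be   *)
(* any representative and its resolutions may be chosen at will.              *)
Definition boundary_well_defined (P : structure) : Prop :=
  resolution_well_defined P /\
  forall n (K : knot P n.+1) (Kp Km : 'I_n.+1 -> knot P n),
    (forall i, resolves true i K (Kp i)) ->
    (forall i, resolves false i K (Km i)) ->
    boundary (gen K) = \sum_(i < n.+1) (-1) ^+ i *: (gen (Kp i) - gen (Km i)).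

(* Ordering the double points by s makes the (s i)-th one the i-th one. *)
Definition degenerate P n (A : X P n.+1) : Prop :=
  forall s : 'S_n.+1, exists i, dd (s i) A = 0.

Definition degenerate_gens P n : set (chains P n) :=
  match n return set (chains P n) with
  | 0 => set0
  | m.+1 => [set c | exists2 A : X P m.+1, degenerate A & c = << A >>]
  end.

Definition forget P n (K : knot P n) : knot plain n :=
  @Knot plain n (underlying K) I.

Definition forget_chains P n : chains P n -> chains plain n :=
  fglift (fun A : X P n => gen (forget (repr A))).

Definition p_0 n : chains based n -> chains plain n := @forget_chains based n.

Definition i_b n : chains naturally_based n -> chains plain n :=
  @forget_chains naturally_based n.

(* K_{s(1...n)} |-> sign(s) K_{1...n}, where K_{1...n} is naturally ordered *)
Definition p_b n : chains based n -> chains naturally_based n :=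
  fglift (fun A : X based n => xget 0 [set c |
    exists (s : 'S_n) (N : knot naturally_based n),
      underlying (repr A) = reorder s N /\ c = (-1) ^+ s *: gen N]).

Definition forget_chains_well_defined (P : structure) : Prop :=
  forall n (K : knot P n), forget_chains (gen K) = gen (forget K).

Definition p_b_well_defined : Prop :=
  forall n (K : knot based n),
    (exists (s : 'S_n) (N : knot naturally_based n),
       underlying K = reorder s N) /\
    (forall (s : 'S_n) (N : knot naturally_based n),
       underlying K = reorder s N -> p_b (gen K) = (-1) ^+ s *: gen N).

Definition reorder_plain n (s : 'S_n) (K : knot plain n) : knot plain n :=
  @Knot plain n (reorder s K) I.

Definition omega_relations n : set (chains plain n) :=
  [set c | exists (K : knot plain n) (s : 'S_n),
     c = gen K - (-1) ^+ s *: gen (reorder_plain s K)].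

Definition chains_omega n : lmodType rat := mquot (@omega_relations n).

Definition p_omega n : chains plain n -> chains_omega n :=
  @mproj _ _ (@omega_relations n).

Definition boundary_omega n : chains_omega n.+1 -> chains_omega n :=
  mquot_map (@omega_relations n) (@boundary plain n).

Definition boundary_omega_well_defined : Prop :=
  forall n (c : chains plain n.+1),
    boundary_omega (p_omega c) = p_omega (boundary c).

(* The degenerate knots carrying the structure of X^omega are those of X^0:   *)
(* d_i K = 0 is an identity among singular knots, not in the quotient group   *)
(* (where an isotopy permuting the double points would be allowed).           *)
Definition degenerate_gens_omega n : set (chains_omega n) :=
  @p_omega n @` @degenerate_gens plain n.

End SingularKnots.

(* The boundary operator vanishes in degree 0. *)
Definition chain_complex (C : nat -> lmodType rat)
    (d : forall n, C n.+1 -> C n) : Prop :=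
  (forall n, linear (d n)) /\ (forall n c, d n (d n.+1 c) = 0).

Definition chain_map (C C' : nat -> lmodType rat)
    (d : forall n, C n.+1 -> C n) (d' : forall n, C' n.+1 -> C' n)
    (f : forall n, C n -> C' n) : Prop :=
  (forall n, linear (f n)) /\ (forall n c, f n (d n c) = d' n (f n.+1 c)).

Definition induced_boundary (C : nat -> lmodType rat)
    (d : forall n, C n.+1 -> C n) (D : forall n, set (C n)) (n : nat) :
  mquot (D n.+1) -> mquot (D n) := mquot_map (D n) (d n).

(* d descends to a boundary operator on the quotients C n / <D n>. *)
Definition relative_chain_complex (C : nat -> lmodType rat)
    (d : forall n, C n.+1 -> C n) (D : forall n, set (C n)) : Prop :=
  (forall n c, @induced_boundary C d D n (mproj (D n.+1) c)
               = mproj (D n) (d n c)) /\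
  @chain_complex (fun n => mquot (D n)) (@induced_boundary C d D).

(* Main.v *)
Require Import Defs.
From HB Require Import structures.
From mathcomp Require Import all_boot all_order all_algebra perm generic_quotient.
From mathcomp Require Import all_classical all_reals all_analysis ring lra zify.
From mathcomp.multinomials Require Import freeg.

Set Implicit Arguments.
Unset Strict Implicit.
Unset Printing Implicit Defensive.

Import Order.TTheory GRing.Theory Num.Theory.
Import numFieldNormedType.Exports.

Local Open Scope classical_set_scope.
Local Open Scope ring_scope.
Local Open Scope quotient_scope.

(* The geometric input is that resolutions depend only on isotopy classes, and *)
(* that resolving two double points in either order gives the same knot.       *)
(* - Two resolutions D, D' of K are compared near K: scaling the displacement  *)
(*   of a push by e > 0 does not change the isotopy class, and for small e the *)
(*   two families are joined by linear interpolation in one chart. To first    *)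
(*   order the gap between the two strands at times z, z' of the crossing is   *)
(*   (z - x) u - (z' - y) w + e d, with u, w mean velocities; it vanishes for  *)
(*   no z, z' because det (u, w, d) keeps a constant sign. As every push is    *)
(*   compared with a standard bump, charts, arcs and strands may vary.         *)
(* - Along an isotopy the times at the double points are tracked by            *)
(*   compactness of the circle, and one bump resolves all nearby knots; the    *)
(*   class of the resolution is locally constant, hence constant on [0, 1].    *)
(* - Bumps with disjoint supports commute, so the resolutions of two double    *)
(*   points commute, and d d = 0 as for precubical sets. If d_i K = 0 then     *)
(*   d_i also kills the resolutions of K at the other double points, so the    *)
(*   degenerate knots span a subcomplex.                                       *)
(* - The natural ordering of a based knot is locally constant along based      *)
(*   isotopies. The signs in p_b and in the relations defining X^omega match   *)
(*   those of the boundary by the sign rule for lift_perm.                     *)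

(** * Calculus of curves *)

(** A resolution is given only through the existence of a [push], so pushes have to be turned into
    operations on isotopy classes. The mechanism is stability: a C^1-small change of a singular
    knot, supported on a closed set of times that avoids the double points to be kept, is again a
    singular knot with exactly those double points, provided that the two strands at a removed
    double point come apart ([near_resolved_knot]). That they come apart follows from the sign of a
    determinant ([sided], [sided_separated]). This condition is convex in the displacement, survives
    orientation-preserving changes of chart ([sided_pert]), and is symmetric in the two strands
    ([sided_sym]). Hence small resolutions of the same sign are joined by interpolation
    ([interpolate], [resolves_unique]), and one bump resolves all knots of a short piece of an
    isotopy ([local_resolutions]). Together these give [resolution_well_definedP]. A structure on
    knots enters the boundary operator only through [hereditary], which holds for plain, based and
    naturally based knots.

    Resolving thus becomes a map [res] on isotopy classes. Two bumps with disjoint supports commute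
    ([double_resolution]), which gives the precubical identity [res_res]; the terms of the squared
    boundary then cancel in pairs ([boundary_boundary]). The same identity shows that an operator
    d_i killing a knot also kills its resolutions at the other double points, so the boundary
    preserves the span of degenerate knots ([boundary_degenerate]).

    The order in which double points are first met is constant along a based isotopy
    ([natural_isotopic]), so [p_b] is well defined. The sign of a permutation with one point removed
    ([perm_lift_sign]) makes [p_b] a chain map and makes the boundary respect the relations defining
    the omega complex. *)

Section Matrices.
Context {R : realType}.

Lemma cvg_mx (T : Type) (F : set_system T) (FF : Filter F) m n
    (f : T -> 'M[R]_(m, n)) (l : 'M[R]_(m, n)) :
  (forall i j, (fun t => f t i j) @ F --> l i j) -> f @ F --> l.
Proof.
move=> fl A [P MP sPA]; rewrite /nbhs/=.
have : \forall t \near F, forall ij : 'I_m * 'I_n, P ij.1 ij.2 (f t ij.1 ij.2).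
  by apply: filter_forall => -[i j]; exact: fl (MP i j).
by apply: filterS => t Pt; apply: sPA => i j; exact: (Pt (i, j)).
Qed.

Lemma cvg_coord (T : Type) (F : set_system T) (FF : Filter F) m n
    (f : T -> 'M[R]_(m, n)) (l : 'M[R]_(m, n)) i j :
  f @ F --> l -> (fun t => f t i j) @ F --> l i j.
Proof.
move=> fl; apply: (@cvg_comp _ _ _ f (fun M : 'M[R]_(m, n) => M i j) _ _ _ fl).
exact: coord_continuous.
Qed.

Lemma cvg_bigsum (T I : Type) (F : set_system T) (FF : Filter F) (s : seq I)
    (f : I -> T -> R) (l : I -> R) :
  (forall i, f i @ F --> l i) ->
  (fun t => \sum_(i <- s) f i t) @ F --> \sum_(i <- s) l i.
Proof.
move=> fl; elim: s => [|i s IH].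
  rewrite big_nil (_ : (fun t => _) = (fun=> 0)); first exact: cvg_cst.
  by apply/funext => t; rewrite big_nil.
rewrite big_cons (_ : (fun t => _) = (fun t => f i t + \sum_(i <- s) f i t)).
  exact: cvgD.
by apply/funext => t; rewrite big_cons.
Qed.

Lemma cvg_mulmx (T : Type) (F : set_system T) (FF : Filter F) m n p
    (f : T -> 'M[R]_(m, n)) (g : T -> 'M[R]_(n, p)) (A : 'M[R]_(m, n)) (B : 'M[R]_(n, p)) :
  f @ F --> A -> g @ F --> B -> (fun t => f t *m g t) @ F --> A *m B.
Proof.
move=> fA gB; apply: cvg_mx => i j; rewrite !mxE.
under eq_fun do rewrite mxE.
by apply: cvg_bigsum => k; apply: cvgM; exact: cvg_coord.
Qed.

(** The determinant of [push_sign]: for independent u and w its sign tells on which side of their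
    plane d lies. *)
Definition det3 (u w d : 'rV[R]_3) : R :=
  \det (col_mx u (col_mx w d) : 'M[R]_3).

Let i0 : 'I_3 := @Ordinal 3 0 isT.
Let i1 : 'I_3 := @Ordinal 3 1 isT.
Let i2 : 'I_3 := @Ordinal 3 2 isT.

Lemma det3E u w d : det3 u w d =
  u ord0 i0 * (w ord0 i1 * d ord0 i2 - w ord0 i2 * d ord0 i1) -
  u ord0 i1 * (w ord0 i0 * d ord0 i2 - w ord0 i2 * d ord0 i0) +
  u ord0 i2 * (w ord0 i0 * d ord0 i1 - w ord0 i1 * d ord0 i0).
Proof.
pose A : 'M[R]_3 := (col_mx u (col_mx w d) : 'M[R]_(1 + (1 + 1), 3)).
rewrite -[det3 u w d]/(\det A).
have A0 j : A i0 j = u ord0 j.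
  by rewrite /A mxE; case: splitP => // k _; rewrite (ord1 k).
have A1 j : A i1 j = w ord0 j.
  rewrite /A mxE; case: splitP => [[[]//]|k /= kE].
  by rewrite mxE; case: splitP => [l _|[l ?] /= lE]; [rewrite (ord1 l)|rewrite lE in kE].
have A2 j : A i2 j = d ord0 j.
  rewrite /A mxE; case: splitP => [[[]//]|k /= kE].
  by rewrite mxE; case: splitP => [[[|//] ?] /= lE|l _]; [rewrite lE in kE|rewrite (ord1 l)].
have cE (B : 'M[R]_2) : \det B = B ord0 ord0 * B ord_max ord_max - B ord0 ord_max * B ord_max ord0.
  rewrite (expand_det_row _ ord0) !big_ord_recl big_ord0 /cofactor !det_mx11 !mxE /=.
  rewrite addr0 expr0 mul1r expr1 mulN1r mulrN.
  by congr (_ * B _ _ - B _ _ * B _ _); apply/val_inj.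
move: A A0 A1 A2 => A A0 A1 A2; rewrite (expand_det_row _ i0) !big_ord_recl big_ord0 /cofactor !cE !mxE /=.
have l7 : fintype.lift (ord0 : 'I_3) (ord0 : 'I_2) = i1 by apply/val_inj.
have l8 : fintype.lift (ord0 : 'I_3) (fintype.lift (ord0 : 'I_2) (ord0 : 'I_1)) = i2 by apply/val_inj.
have l1 : fintype.lift i0 (ord0 : 'I_2) = i1 by apply/val_inj.
have l2 : fintype.lift i0 (ord_max : 'I_2) = i2 by apply/val_inj.
have l3 : fintype.lift i1 (ord0 : 'I_2) = i0 by apply/val_inj.
have l4 : fintype.lift i1 (ord_max : 'I_2) = i2 by apply/val_inj.
have l5 : fintype.lift i2 (ord0 : 'I_2) = i0 by apply/val_inj.
have l6 : fintype.lift i2 (ord_max : 'I_2) = i1 by apply/val_inj.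
have o0 : (ord0 : 'I_3) = i0 by apply/val_inj.
rewrite ?(l7, l8) ?o0 !(l1, l2, l3, l4, l5, l6) !(A0, A1, A2) /bump /=.
by rewrite !exprS !expr0; ring.
Qed.

Lemma det3N u w d : det3 u w (- d) = - det3 u w d.
Proof. by rewrite !det3E !mxE; ring. Qed.

Lemma det3D u w d e : det3 u w (d + e) = det3 u w d + det3 u w e.
Proof. by rewrite !det3E !mxE; ring. Qed.

Lemma det3Z u w a d : det3 u w (a *: d) = a * det3 u w d.
Proof. by rewrite !det3E !mxE; ring. Qed.

Lemma det3C u w d : det3 w u d = - det3 u w d.
Proof. by rewrite !det3E; ring. Qed.

Lemma det3_span u w a b : det3 u w (a *: u + b *: w) = 0.
Proof. by rewrite !det3E !mxE; ring. Qed.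

Lemma det3_mulmx u w d A : det3 (u *m A) (w *m A) (d *m A) = det3 u w d * \det A.
Proof. by rewrite /det3 -!mul_col_mx det_mulmx. Qed.

Lemma cvg_det3 (T : Type) (F : set_system T) (FF : Filter F)
    (f g h : T -> 'rV[R]_3) (u w d : 'rV[R]_3) :
  f @ F --> u -> g @ F --> w -> h @ F --> d ->
  (fun t => det3 (f t) (g t) (h t)) @ F --> det3 u w d.
Proof.
move=> fu gw hd; under eq_fun do rewrite det3E; rewrite det3E.
by apply: cvgD; [apply: cvgB|]; apply: cvgM; try apply: cvgB; try apply: cvgM; exact: cvg_coord.
Qed.

(** A right inverse of the two rows is formed by the first two columns of the inverse of the full
    matrix. *)
Lemma det3_row_free u w d : det3 u w d != 0 -> row_free (col_mx u w).
Proof.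
move=> D0; apply/row_freeP.
have Au : (col_mx u (col_mx w d) : 'M[R]_3) \in unitmx by rewrite unitmxE unitfE.
set B := invmx (col_mx u (col_mx w d) : 'M[R]_3).
have := mulmxV Au; rewrite -/B => AB.
exists (@lsubmx R 3 2 1 B).
apply/matrixP => i j; have /matrixP/(_ (@widen_ord 2 3 isT i) (@widen_ord 2 3 isT j)) := AB.
rewrite !mxE => eq1; transitivity ((widen_ord (n:=2) (m:=3) isT i == widen_ord (n:=2) (m:=3) isT j)%:R : R) => //.
rewrite -eq1; apply: eq_bigr => k _; congr (_ * _); last first.
  by rewrite mxE; congr (B _ _); apply/val_inj.
rewrite !mxE; case: i {eq1} => -[|[|//]] ilt /=.
- case: splitP => [a _|[a ?] /= ] //; case: splitP => [b _|b /=] //; first by rewrite (ord1 a) (ord1 b).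
- case: splitP => [[[]//]|a /= aE]; case: splitP => [[[]//]|b /= bE].
  rewrite mxE; case: splitP => [c _|[c ?] /= cE]; first by rewrite (ord1 c) (ord1 a).
  by rewrite cE in bE.
Qed.

(** If [det3 u w] vanished on the three basis vectors, all 2 by 2 minors of u and w would vanish.
    Then [w_k u - u_k w = 0] for every k, so independence forces u = 0, which contradicts
    independence. *)
Lemma row_free_det3 u w : row_free (col_mx u w) -> exists d, 0 < det3 u w d.
Proof.
move=> rf; suff [d d0] : exists d, det3 u w d != 0.
  by have [/lt_total/orP[dn|dp]] := d0; [exists (- d); rewrite det3N oppr_gt0|exists d].
apply: contrapT => /forallNP D0.
have {}D0 d : det3 u w d = 0 by apply/eqP; have /negP := D0 d; rewrite negbK.
pose e (k : 'I_3) : 'rV[R]_3 := delta_mx ord0 k.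
have := (D0 (e i0), D0 (e i1), D0 (e i2)); rewrite !det3E !mxE /= => -[[]].
rewrite ?(mulr0, mulr1, subr0, sub0r, add0r, addr0) => h0 h1 h2.
have ord3 (P : 'I_3 -> Prop) : P i0 -> P i1 -> P i2 -> forall i, P i.
  move=> P0 P1 P2 [[|[|[|//]]] ilt].
  - by have -> : Ordinal ilt = i0 by apply/val_inj.
  - by have -> : Ordinal ilt = i1 by apply/val_inj.
  - by have -> : Ordinal ilt = i2 by apply/val_inj.
have uw (k l : 'I_3) : w ord0 k * u ord0 l - u ord0 k * w ord0 l = 0.
  by move: k l; do 2 apply: (ord3); lra.
have indep a b : a *: u + b *: w = 0 -> a = 0 /\ b = 0.
  move=> ab0; have : row_mx a%:M b%:M *m col_mx u w = 0.
    by rewrite mul_row_col !mul_scalar_mx.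
  move/eqP; rewrite mulmx_free_eq0// => /eqP/rowP r0.
  have := (r0 (lshift 1 ord0), r0 (rshift 1 ord0)).
  by rewrite row_mxEl row_mxEr !mxE eqxx !mulr1n => -[].
have u0 : u = 0.
  apply/rowP => k; rewrite mxE.
  have /indep[_ /eqP] : w ord0 k *: u + (- u ord0 k) *: w = 0.
    by apply/rowP => l; rewrite !mxE mulNr uw.
  by rewrite oppr_eq0 => /eqP.
have /indep[/eqP] : (1 : R) *: u + 0 *: w = 0 by rewrite u0 scaler0 scale0r addr0.
by rewrite oner_eq0.
Qed.
End Matrices.

(** * Mean value estimates uniform in a parameter *)

Section UniformMeanValue.
Context {R : realType}.

(** The mean value theorem is applied coordinate by coordinate, each with its own intermediate
    point; this is why the derivative is constrained by a product of conditions [Q j]. *)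
Lemma row_mean_value n (f : R -> 'rV[R]_n) (a b : R) (Q : 'I_n -> set R) : a <= b ->
  (forall c, a <= c <= b -> derivable f c 1 /\ forall j, Q j (derive1 f c ord0 j)) ->
  exists2 U : 'rV[R]_n, (forall j, Q j (U ord0 j)) & f b - f a = (b - a) *: U.
Proof.
move=> ab fQ.
have /choice[c cP] j : exists c, Q j (derive1 f c ord0 j) /\
    (f b - f a) ord0 j = derive1 f c ord0 j * (b - a).
  have dj x : a <= x <= b -> is_derive x 1 (fun t => f t ord0 j) (derive1 f x ord0 j).
    move=> xab; have [fx _] := fQ x xab.
    have fxj := (derivable_mxP f x 1).1 fx ord0 j.
    by apply: DeriveDef => //; rewrite derive1E derive_mx// mxE.
  have fcont : {within `[a, b], continuous (fun t => f t ord0 j)}.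
    apply: derivable_within_continuous => x; rewrite in_itv/= => xab.
    by have [] := dj x xab.
  have dj' x : x \in `]a, b[ -> is_derive x 1 (fun t => f t ord0 j) (derive1 f x ord0 j).
    by rewrite in_itv/= => /andP[ax xb]; apply: dj; rewrite !ltW.
  have [c cab E] := MVT_segment ab dj' fcont.
  rewrite in_itv/= in cab; exists c; split; first exact: (fQ c cab).2.
  by rewrite !mxE -E.
exists (\row_j derive1 f (c j) ord0 j) => [j|]; first by rewrite mxE; have [] := cP j.
by apply/rowP => j; have [_ ->] := cP j; rewrite !mxE mulrC.
Qed.

Lemma near_mean_value (L : topologicalType) n (f : L -> R -> 'rV[R]_n) (w : L * R)
    (N : set 'rV[R]_n) :
  (\forall v \near w, derivable (f v.1) v.2 1) ->
  {for w, continuous (fun v => derive1 (f v.1) v.2)} ->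
  nbhs (derive1 (f w.1) w.2) N ->
  \forall v \near (w.1, (w.2, w.2)), exists2 U, N U &
    f v.1 v.2.2 - f v.1 v.2.1 = (v.2.2 - v.2.1) *: U.
Proof.
move=> fd fc [P NP PN].
have : \forall v \near w, derivable (f v.1) v.2 1 /\ forall j, P ord0 j (derive1 (f v.1) v.2 ord0 j).
  apply: filterI fd _; apply: (fc [set U | forall j, P ord0 j (U ord0 j)]).
  by exists P => // U PU j; exact: PU.
case=> -[A B] [/= nA nB] AB; have /nbhs_ballP[r r0 rB] := nB.
exists (A, (ball w.2 r `*` ball w.2 r)).
  by split=> //=; exists (ball w.2 r, ball w.2 r) => //; split; exact: nbhsx_ballx.
move=> -[l [a b]] [/= Al [/= ra rb]].
have H x y : ball w.2 r x -> ball w.2 r y -> x <= y ->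
    exists2 U, N U & f l y - f l x = (y - x) *: U.
  move=> rx ry xy.
  have [|U PU UE] := @row_mean_value n (f l) x y (P ord0) xy.
    move=> c cxy; apply: (AB (l, c)); split=> //; apply: rB.
    move: rx ry cxy; rewrite -!ball_normE/= !ltr_distl; lra.
  by exists U => //; apply: PN => i j; rewrite (ord1 i); exact: PU.
have [ab|/ltW ba] := leP a b; first exact: H.
have [U NU UE] := H _ _ rb ra ba; exists U => //.
by rewrite -[LHS]opprB UE -scaleNr opprB.
Qed.

(** A C^1 map is strictly differentiable. On the segment from q to q' each coordinate of tau has its
    own intermediate point, so the columns of A come from different jacobians; they may be mixed
    because N contains a box of entrywise conditions. *)
Lemma strict_differentiability n m (tau : 'rV[R]_n -> 'rV[R]_m) (q0 : 'rV[R]_n)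
    (N : set 'M[R]_(n, m)) :
  (\forall q \near q0, differentiable tau q) ->
  {for q0, continuous (jacobian tau)} -> nbhs (jacobian tau q0) N ->
  \forall v \near (q0, q0), exists2 A, N A &
    tau v.2 - tau v.1 = (v.2 - v.1) *m A.
Proof.
move=> td tc [P NP PN].
have : \forall q \near q0, differentiable tau q /\
    forall i j, P i j (jacobian tau q i j).
  apply: filterI td _; apply: (tc [set A | forall i j, P i j (A i j)]).
  by exists P.
move=> /nbhs_ballP[r r0 rP].
exists (ball q0 r, ball q0 r) => /=; first by split; exact: nbhsx_ballx.
move=> -[q q'] [/= rq rq'].
pose p (t : R) : 'rV[R]_n := q + t *: (q' - q).
have pr t : 0 <= t <= 1 -> ball q0 r (p t).
  move=> t01; move: rq rq'; rewrite -ball_normE /= => rq rq'.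
  have -> : q0 - p t = (1 - t) *: (q0 - q) + t *: (q0 - q').
    by rewrite /p; apply/rowP => i; rewrite !mxE; ring.
  have [->|tn0] := eqVneq t 0; first by rewrite subr0 scale1r scale0r addr0.
  have tp : 0 < t by rewrite lt_neqAle eq_sym tn0; case/andP: t01.
  apply: (le_lt_trans (ler_normD _ _)); rewrite !normrZ.
  rewrite (ger0_norm (x := t)) ?ltW// (ger0_norm (x := 1 - t)); last by rewrite subr_ge0; case/andP: t01.
  have -> : r = (1 - t) * r + t * r by ring.
  apply: ler_ltD; last by rewrite ltr_pM2l.
  by apply: ler_wpM2l; [rewrite subr_ge0; case/andP: t01|exact: ltW].
have dp t : is_diff t p (fun h => h *: (q' - q)).
  have -> : p = cst q + ( *:%R^~ (q' - q)) by apply/funext => x.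
  have := is_diffD (is_diff_cst q t) (is_diff_scalel t (q' - q)).
  by rewrite add0r.
pose Q (j : 'I_m) : set R := [set y | exists2 A : 'M[R]_(n, m),
  (forall i k, P i k (A i k)) & y = ((q' - q) *m A) ord0 j].
have [//||U UQ UE] := @row_mean_value m (tau \o p) 0 1 Q.
  move=> t t01; have [dt Pt] := rP _ (pr t t01).
  have dpt : differentiable p t by [].
  have dtp : differentiable (tau \o p) t by exact: differentiable_comp.
  split=> [|j]; first exact/derivable1_diffP.
  exists (jacobian tau (p t)) => //.
  by rewrite derive1E'// diff_comp//= diff_val scale1r -deriveE// deriveEjacobian.
have /choice[A AP] : forall j, exists A : 'M[R]_(n, m), (forall i k, P i k (A i k)) /\
    U ord0 j = ((q' - q) *m A) ord0 j.
  by move=> j; have [A PA UA] := UQ j; exists A.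
exists (\matrix_(i, j) A j i j).
  by apply: PN => i j; rewrite mxE; have [] := AP j.
move: UE; rewrite /p/= scale1r scale0r addr0 subrKC subr0 scale1r => ->.
apply/rowP => j; have [_ ->] := AP j; rewrite !mxE.
by apply: eq_bigr => i _; congr (_ * _); rewrite [RHS]mxE.
Qed.
End UniformMeanValue.

(** * Integer shifts of time *)

Section Integers.
Context {R : realType}.
Implicit Types x y k : R.

Lemma periodic_int T (f : R -> T) : (forall x, f (x + 1) = f x) ->
  forall k x, k \is a Num.int -> f (x + k) = f x.
Proof.
move=> f1 k x /intrP[m ->] {k}.
have fn n y : f (y + n%:R) = f y.
  elim: n y => [|n IH] y; first by rewrite addr0.
  by rewrite -addn1 natrD addrA f1 IH.
case: m => n; first exact: fn.
by rewrite NegzE rmorphN/= -(fn n.+1 (x - _)) subrK.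
Qed.

Lemma int_lt1 k : k \is a Num.int -> `|k| < 1 -> k = 0.
Proof.
move=> ki k1; apply/eqP; apply: contraTT k1 => k0.
by rewrite -leNgt norm_intr_ge1.
Qed.

Lemma int_shift_unit x : exists2 k, k \is a Num.int & 0 <= x + k < 1.
Proof.
exists (- (Num.floor x)%:~R); first by rewrite rpredN intr_int.
by have := floor_itv x; rewrite intrD; lra.
Qed.

Lemma int_shift_half x : exists2 k, k \is a Num.int & `|x + k| <= 2^-1.
Proof.
have [k ki xk] := int_shift_unit x.
have [h|h] := leP (x + k) 2^-1; first by exists k => //; rewrite ger0_norm//; lra.
exists (k - 1); first by rewrite rpredB// rpred1.
by rewrite ler_norml; lra.
Qed.

Lemma unit_int_eq x y : 0 <= x < 1 -> 0 <= y < 1 -> y - x \is a Num.int -> x = y.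
Proof.
move=> x01 y01 /int_lt1 yx; apply/esym/eqP; rewrite -subr_eq0; apply/eqP/yx.
by rewrite ltr_norml; lra.
Qed.

End Integers.

(** * C^1 families of curves in coordinate space *)

Section C1Families.
Context {R : realType} {L : topologicalType}.
Implicit Types (w : L * R).

Lemma near_slice (P : L -> R -> Prop) w : (\forall v \near w, P v.1 v.2) ->
  \forall v \near w, \forall z \near v.2, P v.1 z.
Proof.
move=> /near_join; apply: filterS => -[l z] [[A B] [/= nA nB] AB].
by apply: filterS nB => y By; apply: (AB (l, y)); split=> //=; exact: nbhs_singleton.
Qed.

(* Regularity at w of a family of curves l |-> E l, for the C^1 topology. *)
Definition C1v n (E : L -> R -> 'rV[R]_n) (w : L * R) : Prop :=
  [/\ {for w, continuous (fun v => E v.1 v.2)},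
      \forall v \near w, derivable (E v.1) v.2 1 &
      {for w, continuous (fun v => derive1 (E v.1) v.2)}].

Lemma C1v_near_eq n (E E' : L -> R -> 'rV[R]_n) w :
  (\forall v \near w, E' v.1 v.2 = E v.1 v.2) -> C1v E w -> C1v E' w.
Proof.
move=> EE' [Ec Ed Ec1]; have sl := @near_slice (fun l z => E' l z = E l z) w EE'; split.
- exact: near_eq_continuous Ec.
- near=> v; apply: (@near_eq_derivable _ _ _ (E v.1)); last by near: v.
  by near: v; apply: filterS sl => v; apply: filterS => z ->.
- apply: near_eq_continuous Ec1; near=> v; rewrite !derive1E.
  by apply: near_eq_derive; near: v.
Unshelve. all: by end_near. Qed.

Lemma derive1D n (f g : R -> 'rV[R]_n) z : derivable f z 1 -> derivable g z 1 ->
  derive1 (fun x => f x + g x) z = derive1 f z + derive1 g z.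
Proof. by move=> df dg; rewrite !derive1E; exact: (deriveD df dg). Qed.

Lemma derive1Z n (f : R -> 'rV[R]_n) a z : derivable f z 1 ->
  derive1 (fun x => a *: f x) z = a *: derive1 f z.
Proof. by move=> df; rewrite !derive1E; exact: (deriveZ a df). Qed.

Lemma C1vD n (E E' : L -> R -> 'rV[R]_n) w :
  C1v E w -> C1v E' w -> C1v (fun l z => E l z + E' l z) w.
Proof.
move=> [c d c1] [c' d' c1']; split.
- exact: cvgD c c'.
- by apply: filterS2 d d' => v dv dv'; exact: (@derivableD _ _ _ (E v.1) (E' v.1)).
- have c2 : {for w, continuous (fun v => derive1 (E v.1) v.2 + derive1 (E' v.1) v.2)}.
    exact: (cvgD c1 c1').
  by apply: (near_eq_continuous _ c2); apply: filterS2 d d' => v; exact: derive1D.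
Qed.

Lemma C1vZ n (E : L -> R -> 'rV[R]_n) (a : L -> R) w :
  {for w.1, continuous a} -> C1v E w -> C1v (fun l z => a l *: E l z) w.
Proof.
move=> ac [c d c1].
have ac' : {for w, continuous (fun v : L * R => a v.1)}.
  by apply: (@continuous_comp _ _ _ fst a) => //; exact: cvg_fst.
split.
- exact: cvgZ ac' c.
- by apply: filterS d => v dv; exact: (@derivableZ _ _ _ (E v.1)).
- have c2 : {for w, continuous (fun v => a v.1 *: derive1 (E v.1) v.2)}.
    exact: cvgZ ac' c1.
  by apply: (near_eq_continuous _ c2); apply: filterS d => v; exact: derive1Z.
Qed.

Lemma C1vB n (E E' : L -> R -> 'rV[R]_n) w :
  C1v E w -> C1v E' w -> C1v (fun l z => E l z - E' l z) w.
Proof.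
move=> c c'; have c1 : {for w.1, continuous ((fun=> -1) : L -> R)} by exact: cvg_cst.
apply: C1v_near_eq (C1vD c (C1vZ c1 c')).
by near=> v; rewrite scaleN1r.
Unshelve. all: by end_near. Qed.

Lemma C1v_mean_value n (E : L -> R -> 'rV[R]_n) w N : C1v E w ->
  nbhs (derive1 (E w.1) w.2) N ->
  \forall v \near (w.1, (w.2, w.2)), exists2 U, N U &
    E v.1 v.2.2 - E v.1 v.2.1 = (v.2.2 - v.2.1) *: U.
Proof. by case=> _ d c; exact: near_mean_value. Qed.

Lemma derive1_jacobian n m (tau : 'rV[R]_n -> 'rV[R]_m) (f : R -> 'rV[R]_n) z :
  derivable f z 1 -> differentiable tau (f z) ->
  derivable (tau \o f) z 1 /\ derive1 (tau \o f) z = derive1 f z *m jacobian tau (f z).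
Proof.
move=> /derivable1_diffP df dt.
have dtf : differentiable (tau \o f) z by exact: differentiable_comp.
split; first exact/derivable1_diffP.
by rewrite !derive1E'// diff_comp//= -deriveE// deriveEjacobian.
Qed.

Lemma C1v_comp n m (tau : 'rV[R]_n -> 'rV[R]_m) (E : L -> R -> 'rV[R]_n) w :
  (\forall q \near E w.1 w.2, differentiable tau q) ->
  {for E w.1 w.2, continuous (jacobian tau)} -> C1v E w ->
  C1v (fun l z => tau (E l z)) w.
Proof.
move=> td tc [c d c1].
have tdE : \forall v \near w, differentiable tau (E v.1 v.2) by exact: (c _ td).
split.
- apply: (@continuous_comp _ _ _ (fun v => E v.1 v.2) tau) => //.
  exact/differentiable_continuous/(nbhs_singleton td).
- by apply: filterS2 d tdE => v dv /(derive1_jacobian dv)[].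
- have tc' : {for w, continuous (fun v => jacobian tau (E v.1 v.2))}.
    exact: (@continuous_comp _ _ _ (fun v => E v.1 v.2) (jacobian tau)).
  have c2 : {for w, continuous (fun v => derive1 (E v.1) v.2 *m jacobian tau (E v.1 v.2))}.
    exact: cvg_mulmx c1 tc'.
  apply: (near_eq_continuous _ c2).
  by apply: filterS2 d tdE => v dv /(derive1_jacobian dv)[].
Qed.

End C1Families.

Lemma C1v_pull (R : realType) (L L' : topologicalType) n (E : L -> R -> 'rV[R]_n)
    (th : L' -> L) w :
  {for w.1, continuous th} -> C1v E (th w.1, w.2) -> C1v (fun l z => E (th l) z) w.
Proof.
move=> thc [c d c1].
have Th : {for w, continuous (fun v : L' * R => (th v.1, v.2))}.
  apply: (@cvg_pair _ _ _ _ (nbhs (th w.1)) (nbhs w.2)); last exact: cvg_snd.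
  by apply: (@continuous_comp _ _ _ fst th) => //; exact: cvg_fst.
split.
- exact: (@continuous_comp _ _ _ _ (fun v => E v.1 v.2) w Th c).
- exact: (Th _ d).
- exact: (@continuous_comp _ _ _ _ (fun v => derive1 (E v.1) v.2) w Th c1).
Qed.

(** * C^1 families of curves in the manifold *)

Section C1Curves.
Context {R : realType} {M : oriented_3manifold R}.
Implicit Types (phi psi : chart R M).

Definition transition phi psi : 'rV[R]_3 -> 'rV[R]_3 := cmap psi \o cinv phi.

Lemma near_cdom phi m : cdom phi m -> \forall y \near m, cdom phi y.
Proof. by move=> dm; apply: open_nbhs_nbhs; split=> //; exact: cdom_open. Qed.

Lemma cmap_image phi m : cdom phi m -> (cmap phi @` cdom phi) (cmap phi m).
Proof. by move=> dm; exists m. Qed.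

Lemma near_cimage phi y : (cmap phi @` cdom phi) y ->
  \forall y' \near y, (cmap phi @` cdom phi) y'.
Proof. by move=> dm; apply: open_nbhs_nbhs; split=> //; exact: cimage_open. Qed.

Lemma cinv_image phi y : (cmap phi @` cdom phi) y ->
  cdom phi (cinv phi y) /\ cmap phi (cinv phi y) = y.
Proof. by move=> [m dm <-]; rewrite cmapK. Qed.

Lemma transition_cmap phi psi m : cdom phi m ->
  transition phi psi (cmap phi m) = cmap psi m.
Proof. by move=> dm; rewrite /transition /= cmapK. Qed.

Lemma transitionP phi psi m : atlas phi -> atlas psi -> cdom phi m -> cdom psi m ->
  [/\ \forall y \near cmap phi m, differentiable (transition phi psi) y,
      {for cmap phi m, continuous (jacobian (transition phi psi))} &
      0 < \det (jacobian (transition phi psi) (cmap phi m))].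
Proof. exact: atlas_oriented. Qed.

(** The conditions of [knot_path] on loops, localised at one parameter and one time, with any
    parameter space in place of the isotopy time. *)
Definition C1at (L : topologicalType) (F : L -> R -> M) (w : L * R) : Prop :=
  {for w, continuous (fun v => F v.1 v.2)} /\
  forall phi, atlas phi -> cdom phi (F w.1 w.2) -> C1v (fun l z => cmap phi (F l z)) w.

Lemma near_C1_cdom (L : topologicalType) (F : L -> R -> M) w phi :
  {for w, continuous (fun v => F v.1 v.2)} -> cdom phi (F w.1 w.2) ->
  \forall v \near w, cdom phi (F v.1 v.2).
Proof. by move=> Fc /near_cdom dw; exact: (Fc _ dw). Qed.

(** One chart suffices: transition maps are C^1, and the chain rule [C1v_comp] carries regularity to
    the other charts. *)
Lemma C1at_chart (L : topologicalType) (F : L -> R -> M) w phi : atlas phi ->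
  {for w, continuous (fun v => F v.1 v.2)} -> cdom phi (F w.1 w.2) ->
  C1v (fun l z => cmap phi (F l z)) w -> C1at F w.
Proof.
move=> aphi Fc dw E; split; first exact: Fc.
move=> psi apsi dpsi.
have [td tc _] := transitionP aphi apsi dw dpsi.
apply: C1v_near_eq (C1v_comp td tc E).
have := near_C1_cdom Fc dw; apply: filterS => v dv.
by rewrite transition_cmap.
Qed.

Lemma C1at_near_eq (L : topologicalType) (F G : L -> R -> M) w :
  (\forall v \near w, G v.1 v.2 = F v.1 v.2) -> C1at F w -> C1at G w.
Proof.
move=> FG [Fc FC1]; split; first exact: near_eq_continuous Fc.
move=> phi aphi; rewrite (nbhs_singleton FG) => dw.
by apply: C1v_near_eq (FC1 phi aphi dw); apply: filterS FG => v ->.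
Qed.

Lemma C1at_pull (L L' : topologicalType) (F : L -> R -> M) (th : L' -> L) w :
  {for w.1, continuous th} -> C1at F (th w.1, w.2) -> C1at (fun l z => F (th l) z) w.
Proof.
move=> thc [Fc FC1]; split.
  have Th : {for w, continuous (fun v : L' * R => (th v.1, v.2))}.
    apply: (@cvg_pair _ _ _ _ (nbhs (th w.1)) (nbhs w.2)); last exact: cvg_snd.
    by apply: (@continuous_comp _ _ _ fst th) => //; exact: cvg_fst.
  exact: (@continuous_comp _ _ _ _ (fun v => F v.1 v.2) w Th Fc).
by move=> phi aphi dw; exact: (C1v_pull (E := fun l z => cmap phi (F l z)) thc (FC1 _ aphi dw)).
Qed.

Lemma C1at_path n (p : R -> sknot n) w : knot_path p ->
  C1at (fun t => loop (p t)) w.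
Proof.
move=> [pc pC1 _]; split; first exact: pc.
move=> phi aphi dw; split.
- apply: (@continuous_comp _ _ _ (fun v => loop (p v.1) v.2)); first exact: pc.
  exact: cmap_continuous.
- have := near_C1_cdom (F := fun t => loop (p t)) (pc w) dw.
  by apply: filterS => v dv; exact: (loop_C1 (sknotP (p v.1)) aphi dv).1.
- exact: pC1.
Qed.

Lemma knot_path_cst n (K : @sknot R M n) : knot_path ((fun=> K) : R -> sknot n).
Proof.
case: K => g v gP; split=> /=.
- move=> z; apply: (@continuous_comp _ _ _ snd g); first exact: cvg_snd.
  exact: loop_continuous gP _.
- move=> phi z aphi dz.
  apply: (@continuous_comp _ _ _ snd (velocity phi g)); first exact: cvg_snd.
  exact: (loop_C1 gP aphi dz).2.
- by move=> i t; apply: cvg_cst.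
Qed.

Lemma C1at_knot (L : topologicalType) n (K : sknot n) (w : L * R) :
  C1at (fun=> loop K) w.
Proof.
have c0 : {for w.1, continuous ((fun=> 0) : L -> R)} by exact: cvg_cst.
exact: (C1at_pull c0 (C1at_path (0, w.2) (knot_path_cst K))).
Qed.

Lemma C1at_loop (L : topologicalType) (F : L -> R -> M) l x : C1at F (l, x) ->
  {for x, continuous (F l)} /\ forall phi, atlas phi -> cdom phi (F l x) ->
    derivable (cmap phi \o F l) x 1 /\ {for x, continuous (velocity phi (F l))}.
Proof.
move=> [Fc FC1].
have lx : {for x, continuous (fun y : R => (l, y))}.
  apply: (@cvg_pair _ _ _ _ (nbhs l) (nbhs x)); first exact: cvg_cst.
  exact: cvg_id.
split; first exact: (@continuous_comp _ _ _ _ (fun v => F v.1 v.2) x lx Fc).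
move=> phi aphi dx; have [_ d c] := FC1 _ aphi dx; split.
  exact: (nbhs_singleton d).
exact: (@continuous_comp _ _ _ _ (fun v => derive1 (cmap phi \o F v.1) v.2) x lx c).
Qed.

Lemma C1at_cinv (L : topologicalType) (F : L -> R -> M) (E : L -> R -> 'rV[R]_3) phi w :
  atlas phi -> (\forall v \near w, F v.1 v.2 = cinv phi (E v.1 v.2)) ->
  (cmap phi @` cdom phi) (E w.1 w.2) -> C1v E w -> C1at F w.
Proof.
move=> aphi FE iE EC; have [Ec _ _] := EC.
have FEw := nbhs_singleton FE.
have [dF dE] := cinv_image iE.
apply: (C1at_chart aphi).
- apply: near_eq_continuous FE _.
  apply: (@continuous_comp _ _ _ (fun v => E v.1 v.2) (cinv phi)) => //.
  by rewrite -dE; exact: cinv_continuous.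
- by rewrite FEw.
- apply: C1v_near_eq EC; have := Ec _ (near_cimage iE).
  by apply: filterS2 FE => v -> /cinv_image[].
Qed.

(* g displaced by eta in the chart phi; testing eta z first makes it total, as *)
(* g may leave the domain of phi where eta vanishes.                           *)
Definition pert phi (eta : R -> 'rV[R]_3) (g : R -> M) (z : R) : M :=
  if eta z == 0 then g z else cinv phi (cmap phi (g z) + eta z).

Lemma pert_cinv phi eta g z : cdom phi (g z) ->
  pert phi eta g z = cinv phi (cmap phi (g z) + eta z).
Proof. by move=> dz; rewrite /pert; case: eqP => // ->; rewrite addr0 cmapK. Qed.

Lemma pert0 phi eta g z : eta z = 0 -> pert phi eta g z = g z.
Proof. by rewrite /pert => ->; rewrite eqxx. Qed.

Lemma pertP phi eta g z : cdom phi (g z) ->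
  (cmap phi @` cdom phi) (cmap phi (g z) + eta z) ->
  cdom phi (pert phi eta g z) /\ cmap phi (pert phi eta g z) = cmap phi (g z) + eta z.
Proof. by move=> dz iz; rewrite pert_cinv//; exact: cinv_image. Qed.

Lemma C1at_pert (L : topologicalType) (K : L -> R -> M) (eta : L -> R -> 'rV[R]_3) phi w :
  atlas phi -> C1at K w -> C1v eta w -> cdom phi (K w.1 w.2) ->
  (cmap phi @` cdom phi) (cmap phi (K w.1 w.2) + eta w.1 w.2) ->
  C1at (fun l => pert phi (eta l) (K l)) w.
Proof.
move=> aphi [Kc KC] etaC dw iw.
apply: (C1at_cinv aphi _ iw (C1vD (KC _ aphi dw) etaC)).
by have := near_C1_cdom Kc dw; apply: filterS => v; exact: pert_cinv.
Qed.

Lemma C1at_pert0 (L : topologicalType) (K : L -> R -> M) (eta : L -> R -> 'rV[R]_3) phi w :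
  (\forall v \near w, eta v.1 v.2 = 0) -> C1at K w ->
  C1at (fun l => pert phi (eta l) (K l)) w.
Proof.
by move=> eta0; apply: C1at_near_eq; apply: filterS eta0 => v; exact: pert0.
Qed.

Lemma velocity_transition phi psi (g : R -> M) x : atlas phi -> atlas psi ->
  (\forall y \near x, cdom phi (g y)) -> derivable (cmap phi \o g) x 1 ->
  cdom psi (g x) ->
  velocity psi g x = velocity phi g x *m jacobian (transition phi psi) (cmap phi (g x)).
Proof.
move=> aphi apsi dn gd dpsi; have dphi := nbhs_singleton dn.
have [td _ _] := transitionP aphi apsi dphi dpsi.
have [_ <-] := derive1_jacobian gd (nbhs_singleton td).
rewrite /velocity !derive1E; apply: near_eq_derive.
apply: filterS dn => y dy /=.
by rewrite transition_cmap.
Qed.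

Lemma velocity_near_eq phi (g h : R -> M) x : (\forall y \near x, g y = h y) ->
  velocity phi g x = velocity phi h x.
Proof.
by move=> gh; rewrite /velocity !derive1E; apply: near_eq_derive; apply: filterS gh => y /= ->.
Qed.

Lemma velocity_periodic phi (g : R -> M) x k : (forall x, g (x + 1) = g x) ->
  k \is a Num.int -> velocity phi g (x + k) = velocity phi g x.
Proof.
move=> gper ki; have g1 := periodic_int gper; rewrite /velocity /derive1.
suff -> : (fun h => h^-1 *: ((cmap phi \o g) (h + (x + k)) - (cmap phi \o g) (x + k))) =
          (fun h => h^-1 *: ((cmap phi \o g) (h + x) - (cmap phi \o g) x)) by [].
by apply/funext => h; rewrite /= addrA (g1 _ x ki) (g1 _ (h + x) ki).
Qed.

End C1Curves.

(** * Singular knots modulo 1 *)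

Section Periodicity.
Context {R : realType} {M : oriented_3manifold R}.
Implicit Types (phi psi : chart R M).

Lemma row_free_sym (u w : 'rV[R]_3) : row_free (col_mx u w) -> row_free (col_mx w u).
Proof.
by move=> /row_free_det3[d d0]; apply: (@det3_row_free _ _ _ d); rewrite det3C oppr_eq0 gt_eqF.
Qed.

Lemma mulmx_det_neq0 (u : 'rV[R]_3) (J : 'M[R]_3) : 0 < \det J -> u != 0 -> u *m J != 0.
Proof.
move=> J0; apply: contra_neq => uJ.
have Ju : J \in unitmx by rewrite unitmxE unitfE gt_eqF.
by rewrite -(mulmxK Ju u) uJ mul0mx.
Qed.

(* is_singular_knot with pairs of times compared modulo 1 instead of taken in  *)
(* [0, 1): this form is invariant under shifts and swapping of times.          *)
Record periodic_knot n (g : R -> M) (v : 'I_n -> M) : Prop := PeriodicKnot {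
  pk_per : forall x, g (x + 1) = g x;
  pk_cont : continuous g;
  pk_C1 : forall phi x, atlas phi -> cdom phi (g x) ->
    derivable (cmap phi \o g) x 1 /\ {for x, continuous (velocity phi g)};
  pk_imm : forall phi x, atlas phi -> cdom phi (g x) -> velocity phi g x != 0;
  pk_trans : forall phi x y, atlas phi -> cdom phi (g x) ->
    y - x \isn't a Num.int -> g x = g y ->
    row_free (col_mx (velocity phi g x) (velocity phi g y));
  pk_inj : injective v;
  pk_all : forall x y, y - x \isn't a Num.int -> g x = g y -> exists i, v i = g x;
  pk_dbl : forall i, exists x y, [/\ y - x \isn't a Num.int, g x = v i, g y = v i &
    forall z, g z = v i -> z - x \is a Num.int \/ z - y \is a Num.int]
}.

Lemma not_int_unit (x y : R) : 0 <= x < y -> y < 1 -> y - x \isn't a Num.int.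
Proof.
move=> xy y1; apply/negP => /unit_int_eq yx.
have xy' : x = y by apply: yx; lra.
by lra.
Qed.

Lemma unit_pair (x y : R) : y - x \isn't a Num.int -> exists j k,
  [/\ j \is a Num.int, k \is a Num.int, 0 <= x + j < 1, 0 <= y + k < 1 & x + j != y + k].
Proof.
move=> yx; have [j ji xj] := int_shift_unit x; have [k ki yk] := int_shift_unit y.
exists j, k; split=> //; apply: contra yx => /eqP e.
by have -> : y - x = j - k; [lra|rewrite rpredB].
Qed.

(** Two times that differ modulo 1 can be shifted by integers to distinct times in [0, 1), where one
    precedes the other; neither g nor its velocities notice the shift. *)
Lemma periodic_knotP n (g : R -> M) (v : 'I_n -> M) :
  is_singular_knot g v <-> periodic_knot g v.
Proof.
split=> [[per cont C1 imm trans inj all dbl]|[per cont C1 imm trans inj all dbl]].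
- have g1 := periodic_int per.
  split=> //.
  + move=> phi x y aphi dx /unit_pair[j [k [ji ki xj yk xy]]] gxy.
    have gE : g (x + j) = g (y + k) by rewrite !g1.
    rewrite -(velocity_periodic phi x per ji) -(velocity_periodic phi y per ki).
    have [/lt_total/orP[lxy|lyx]] := xy.
    * by apply: trans; rewrite ?g1//; lra.
    * apply: row_free_sym; apply: trans => //; rewrite ?g1 -?gxy//; lra.
  + move=> x y /unit_pair[j [k [ji ki xj yk xy]]] gxy.
    have [/lt_total/orP[lxy|lyx]] := xy.
    * have xy1 : 0 <= x + j < y + k by lra.
      have y1 : y + k < 1 by lra.
      have [|i vi] := all _ _ xy1 y1; first by rewrite !g1.
      by exists i; rewrite vi g1.
    * have xy1 : 0 <= y + k < x + j by lra.
      have y1 : x + j < 1 by lra.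
      have [|i vi] := all _ _ xy1 y1; first by rewrite !g1.
      by exists i; rewrite vi g1.
  + move=> i; have [x [y [xy y1 gx gy xyz]]] := dbl i.
    exists x, y; split=> //; first exact: not_int_unit.
    move=> z; have [k ki zk] := int_shift_unit z.
    rewrite -(g1 k)// => /(xyz _ zk)[] <-; [left|right];
      by rewrite opprD addrA subrr add0r rpredN.
- have g1 := periodic_int per.
  split=> //.
  + by move=> phi x y aphi dx xy y1; apply: trans => //; exact: not_int_unit.
  + by move=> x y xy y1; apply: all; exact: not_int_unit.
  + move=> i; have [x [y [xy gx gy xyz]]] := dbl i.
    have [j [k [ji ki xj yk ne]]] := unit_pair xy.
    have H z : 0 <= z < 1 -> g z = v i -> z = x + j \/ z = y + k.
      move=> z01 /xyz[zi|zi]; [left|right]; apply: unit_int_eq => //.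
      * by have -> : x + j - z = j - (z - x); [lra|rewrite rpredB].
      * by have -> : y + k - z = k - (z - y); [lra|rewrite rpredB].
    have [/lt_total/orP[lxy|lyx]] := ne.
    * exists (x + j), (y + k); rewrite !g1//; split=> //; lra.
    * exists (y + k), (x + j); rewrite !g1//; split=> //; [lra|lra|].
      by move=> z z01 /(H z z01)[]; [right|left].
Qed.

Lemma int_of_shift (x y j k : R) : j \is a Num.int -> k \is a Num.int ->
  ((y + k) - (x + j) \is a Num.int) = (y - x \is a Num.int).
Proof.
move=> ji ki; have -> : y + k - (x + j) = (y - x) + (k - j) by ring.
by rewrite rpredDr// rpredB.
Qed.

End Periodicity.

(** * Compactness of the circle *)

Section Compactness.
Context {R : realType} {L : topologicalType}.

(** The tube lemma on the circle: one period [0, 1] is compact, and the shifts carry the conclusion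
    to the whole line. *)
Lemma near_all_periodic (P : L -> R -> Prop) (l0 : L) :
  (\forall l \near l0, forall z (k : R), k \is a Num.int -> P l z -> P l (z + k)) ->
  (forall z : R, \forall v \near (l0, z), P v.1 v.2) ->
  \forall l \near l0, forall z, P l z.
Proof.
move=> Pper Pn.
have cpt : compact `[0 : R, 1]%classic by exact: segment_compact.
have H : \forall l \near l0, `[0 : R, 1]%classic `<=` P l.
  apply: ((compact_near_coveringP _).1 cpt L (nbhs l0) P) => z _.
  have [[A B] [/= nA nB] AB] := Pn z.
  exists (B, A); first by split.
  by move=> [z' l] [/= Bz Al]; exact: (AB (l, z')).
apply: filterS2 Pper H => l Pl Hl z.
have [k ki zk] := int_shift_unit z.
rewrite -(addrK k z); apply: Pl; first by rewrite rpredN.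
by apply: Hl; rewrite /= in_itv/=; lra.
Qed.

(** The tube lemma on the torus. Pairs modulo integer shifts are represented by x in [0, 1] and y -
    x in [-1/2, 1/2]. There an integer difference must be 0, so the only diagonal pairs to be tested
    have x = y. *)
Lemma near_pairs_periodic (P : L -> R -> R -> Prop) (l0 : L) :
  (\forall l \near l0, forall x y (j k : R), j \is a Num.int -> k \is a Num.int ->
    P l x y -> P l (x + j) (y + k)) ->
  (forall x y : R, (y - x \is a Num.int -> x = y) -> \forall v \near (l0, (x, y)), P v.1 v.2.1 v.2.2) ->
  \forall l \near l0, forall x y, P l x y.
Proof.
move=> Pper Pn.
have cpt : compact (`[0 : R, 1]%classic `*` `[- 2^-1 : R, 2^-1]%classic).
  by apply: compact_setX; exact: segment_compact.
pose Q (l : L) (xd : R * R) := P l xd.1 (xd.1 + xd.2).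
have H : \forall l \near l0, `[0 : R, 1]%classic `*` `[- 2^-1 : R, 2^-1]%classic `<=` Q l.
  apply: ((compact_near_coveringP _).1 cpt L (nbhs l0) Q) => -[x d] [/=].
  rewrite !in_itv/= => x01 d2.
  have [|[A B] [/= nA [[B1 B2] [/= nB1 nB2] B12]] AB] := Pn x (x + d).
    have -> : x + d - x = d by ring.
    by move=> /int_lt1 d0; rewrite d0 ?addr0// ltr_norml; lra.
  have cadd : {for (x, d), continuous (fun xd : R * R => xd.1 + xd.2)}.
    by apply: cvgD; [exact: cvg_fst|exact: cvg_snd].
  have [[C1 C2] [/= nC1 nC2] C12] := cadd _ nB2.
  exists (((B1 `&` C1) `*` C2), A).
    split=> //=; exists (B1 `&` C1, C2) => //=; split=> //; exact: filterI.
  move=> [[x' d'] l] [[/= [B1x C1x] C2d] Al]; apply: (AB (l, (x', x' + d'))).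
  by split=> //=; apply: (B12 (_, _)); split=> //=; exact: (C12 (_, _)).
apply: filterS2 Pper H => l Pl Hl x y.
have [k ki xk] := int_shift_unit x.
have [j ji yj] := int_shift_half (y - (x + k)).
have xyE : x + k + (y - (x + k) + j) = y + j by ring.
have : Q l (x + k, y - (x + k) + j).
  by apply: Hl; rewrite /= !in_itv/=; move: yj; rewrite ler_norml; split; lra.
by rewrite /Q/= xyE => /(Pl _ _ (- k) (- j)); rewrite !rpredN !addrK; apply.
Qed.

End Compactness.

Lemma near_neq (T X : topologicalType) (f g : T -> X) t : hausdorff_space X ->
  {for t, continuous f} -> {for t, continuous g} -> f t <> g t ->
  \forall t' \near t, f t' <> g t'.
Proof.
rewrite open_hausdorff => hX fc gc /eqP fg.
have [[A B] [/= fA gB] [oA oB /eqP/disjoints_subset AB]] := hX _ _ fg.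
have nA : nbhs (f t) A by apply: open_nbhs_nbhs; split=> //; rewrite inE in fA.
have nB : nbhs (g t) B by apply: open_nbhs_nbhs; split=> //; rewrite inE in gB.
have ftA : \forall t' \near t, A (f t') := fc _ nA.
have gtB : \forall t' \near t, B (g t') := gc _ nB.
by apply: filterS2 ftA gtB => t' At Bt e; apply: (AB _ At); rewrite e.
Qed.

Lemma near_forall (T : topologicalType) (I : finType) (f : I -> T -> Prop) (t : T) :
  (forall i, \forall u \near t, f i u) -> \forall u \near t, forall i, f i u.
Proof. exact: filter_forall. Qed.

(** * Neighbourhood properties pulled back along projections *)

Section PullBack.
Context {T U V : topologicalType}.

Lemma near_pull1 (P : T -> U -> Prop) (t : T) (u : U) (v : V) :
  (\forall w \near (t, u), P w.1 w.2) -> \forall w \near (t, (u, v)), P w.1 w.2.1.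
Proof.
move=> [[A B] [/= nA nB] AB]; exists (A, B `*` setT).
  by split=> //=; exists (B, setT) => //=; split=> //; exact: filterT.
by move=> [t' [u' v']] [/= At [Bu _]]; exact: (AB (t', u')).
Qed.

Lemma near_pull2 (P : T -> V -> Prop) (t : T) (u : U) (v : V) :
  (\forall w \near (t, v), P w.1 w.2) -> \forall w \near (t, (u, v)), P w.1 w.2.2.
Proof.
move=> [[A B] [/= nA nB] AB]; exists (A, setT `*` B).
  by split=> //=; exists (setT, B) => //=; split=> //; exact: filterT.
by move=> [t' [u' v']] [/= At [_ Bu]]; exact: (AB (t', v')).
Qed.

Lemma near_pull0 (P : T -> Prop) (t : T) (u : U) :
  (\forall w \near t, P w) -> \forall w \near (t, u), P w.1.
Proof.
move=> nA; exists (P, setT); first by split=> //; exact: filterT.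
by move=> [t' u'] [].
Qed.

Lemma near_pullr (P : U -> Prop) (t : T) (u : U) :
  (\forall w \near u, P w) -> \forall w \near (t, u), P w.2.
Proof.
move=> nA; exists (setT, P); first by split=> //; exact: filterT.
by move=> [t' u'] [].
Qed.

End PullBack.

Lemma continuous_pull1 (T U V X : topologicalType) (f : T -> U -> X) t u (v : V) :
  {for (t, u), continuous (fun w => f w.1 w.2)} ->
  {for (t, (u, v)), continuous (fun w => f w.1 w.2.1)}.
Proof.
move=> fc A nA; have fA : \forall w \near (t, u), A (f w.1 w.2) := fc A nA.
exact: (@near_pull1 _ _ _ (fun t u => A (f t u)) t u v fA).
Qed.

Lemma continuous_pull2 (T U V X : topologicalType) (f : T -> V -> X) t (u : U) v :
  {for (t, v), continuous (fun w => f w.1 w.2)} ->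
  {for (t, (u, v)), continuous (fun w => f w.1 w.2.2)}.
Proof.
move=> fc A nA; have fA : \forall w \near (t, v), A (f w.1 w.2) := fc A nA.
exact: (@near_pull2 _ _ _ (fun t u => A (f t u)) t u v fA).
Qed.

Lemma continuous_pull0 (T U X : topologicalType) (f : T -> X) t (u : U) :
  {for t, continuous f} -> {for (t, u), continuous (fun w => f w.1)}.
Proof. by move=> fc A nA; exact: (@near_pull0 _ _ (fun t => A (f t)) t u (fc A nA)). Qed.

(** * Stability of immersions and of double points *)

Section DoublePoints.
Context {R : realType} {M : oriented_3manifold R} {L : topologicalType}.
Implicit Types (phi psi : chart R M) (F G : L -> R -> M).

Definition immersed (g : R -> M) (z : R) : Prop :=
  forall phi, atlas phi -> cdom phi (g z) -> velocity phi g z != 0.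

Lemma near_immersed F (w : L * R) : C1at F w -> immersed (F w.1) w.2 ->
  \forall v \near w, immersed (F v.1) v.2.
Proof.
move=> [Fc FC] Fi; have [phi aphi dw] := atlas_cover (F w.1 w.2).
have [_ d c] := FC _ aphi dw.
have dn := near_C1_cdom Fc dw.
have dns := @near_slice R L (fun l z => cdom phi (F l z)) w dn.
have c0 : {for w, continuous (fun _ : L * R => (0 : 'rV[R]_3))} by exact: cvg_cst.
have n0 := near_neq (@norm_hausdorff _ _) c c0 (elimN eqP (Fi _ aphi dw)).
near=> v => psi apsi dv.
have dv1 : \forall z \near v.2, cdom phi (F v.1 z) by near: v.
have gd : derivable (cmap phi \o F v.1) v.2 1 by near: v.
have vn : velocity phi (F v.1) v.2 != 0 by apply/eqP; near: v.
rewrite (velocity_transition aphi apsi dv1 gd dv).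
by have [_ _ J0] := transitionP aphi apsi (nbhs_singleton dv1) dv; exact: mulmx_det_neq0.
Unshelve. all: by end_near. Qed.

(** Equal values at distinct times would make a mean velocity vanish, while mean velocities near [w]
    are close to the non-zero velocity at [w]. *)
Lemma near_injective F (w : L * R) : C1at F w -> immersed (F w.1) w.2 ->
  \forall v \near (w.1, (w.2, w.2)), F v.1 v.2.1 = F v.1 v.2.2 -> v.2.1 = v.2.2.
Proof.
move=> [Fc FC] Fi; have [phi aphi dw] := atlas_cover (F w.1 w.2).
have c0 : {for derive1 (cmap phi \o F w.1) w.2, continuous (fun _ : 'rV[R]_3 => (0 : 'rV[R]_3))}.
  exact: cst_continuous.
have cid' : {for derive1 (cmap phi \o F w.1) w.2, continuous (fun u : 'rV[R]_3 => u)}.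
  exact: cvg_id.
have n0 := near_neq (@norm_hausdorff _ _) cid' c0 (elimN eqP (Fi _ aphi dw)).
have := C1v_mean_value (FC _ aphi dw) n0; apply: filterS => -[l [z z']] /= [U U0 e] Fz.
move: e; rewrite Fz subrr => /esym/eqP; rewrite scaler_eq0 subr_eq0.
by case/orP => [/eqP->//|/eqP]; move=> /U0.
Qed.

(** Where [F l0] takes different values, the Hausdorff property excludes nearby double pairs; near
    the diagonal, [near_injective] does. What remains is a neighbourhood of the double pairs of
    [F l0]. *)
Lemma near_double_pairs F (l0 : L) (P : L -> R -> R -> Prop) :
  (forall z, C1at F (l0, z)) -> (forall z, immersed (F l0) z) ->
  (\forall l \near l0, forall x, F l (x + 1) = F l x) ->
  (\forall l \near l0, forall x y (j k : R), j \is a Num.int -> k \is a Num.int ->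
     P l x y -> P l (x + j) (y + k)) ->
  (forall x y : R, y - x \isn't a Num.int -> F l0 x = F l0 y ->
     \forall v \near (l0, (x, y)), P v.1 v.2.1 v.2.2) ->
  \forall l \near l0, forall x y, y - x \isn't a Num.int -> F l x = F l y -> P l x y.
Proof.
move=> FC Fi Fper Pper Pn.
apply: near_pairs_periodic.
  apply: filterS2 Fper Pper => l F1 Pl x y j k ji ki H.
  rewrite (int_of_shift x y ji ki) !(periodic_int F1)// => yx Fxy.
  by apply: Pl => //; exact: H.
move=> x y xy.
have pc1 := continuous_pull1 (v := y) (FC x).1.
have pc2 := continuous_pull2 (u := x) (FC y).1.
have [Fxy|Fxy] := pselect (F l0 x = F l0 y); last first.
  have := near_neq (mhausdorff (o := M)) pc1 pc2 Fxy.
  by apply: filterS => v Fv _ /Fv.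
have [yxi|yx] := boolP (y - x \is a Num.int); last by apply: filterS (Pn _ _ yx Fxy) => v.
rewrite -(xy yxi); have := near_injective (FC x) (Fi x); apply: filterS => v inj yxn Fv.
by move: yxn; rewrite (inj Fv) subrr rpred0.
Qed.

End DoublePoints.

(** * Stability of resolved knots *)

Section Resolution.
Context {R : realType} {M : oriented_3manifold R} {L : topologicalType}.
(** G is K modified at times in C, and equals K at [l0]. The map iota lists the double points to be
    kept, whose times avoid C. Q is the region of parameters, such as positive heights, in which the
    other double points are resolved. *)
Variables (l0 : L) (n m : nat) (iota : 'I_m -> 'I_n).
Variables (K : L -> @sknot R M n) (G : L -> R -> M) (C : set R) (Q : L -> Prop).
Hypothesis iota_inj : injective iota.
Hypothesis KC1 : forall z, C1at (fun l => loop (K l)) (l0, z).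
Hypothesis Kv : forall i, {for l0, continuous (fun l => vertex (K l) i)}.
Hypothesis GC1 : \forall l \near l0, forall z, C1at G (l, z).
Hypothesis Gper : \forall l \near l0, forall x, G l (x + 1) = G l x.
Hypothesis G0 : forall z, G l0 z = loop (K l0) z.
Hypothesis Cclosed : closed C.
Hypothesis Cper : forall x k, k \is a Num.int -> C (x + k) -> C x.
Hypothesis GK : \forall l \near l0, forall z, ~ C z -> G l z = loop (K l) z.
Hypothesis retained : forall j z, loop (K l0) z = vertex (K l0) (iota j) -> ~ C z.
Hypothesis separated : forall k, (forall j, iota j <> k) ->
  forall x y : R, y - x \isn't a Num.int ->
  loop (K l0) x = vertex (K l0) k -> loop (K l0) y = vertex (K l0) k ->
  \forall v \near (l0, (x, y)), Q v.1 -> G v.1 v.2.1 <> G v.1 v.2.2.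

Lemma near_resolved_immersed : \forall l \near l0, forall z, immersed (G l) z.
Proof.
have Gi z : immersed (G l0) z.
  have -> : G l0 = loop (K l0) by apply/funext.
  move=> phi aphi dz.
  exact: pk_imm ((periodic_knotP _ _).1 (sknotP (K l0))) _ _ aphi dz.
apply: near_all_periodic.
  apply: filterS Gper => l Gl z k ki iz phi aphi; rewrite (periodic_int Gl)// => dz.
  by rewrite velocity_periodic//; exact: iz.
by move=> z; apply: near_immersed; [exact: nbhs_singleton GC1 z|exact: Gi].
Qed.

Let Pair (l : L) (x y : R) := Q l -> y - x \isn't a Num.int -> G l x = G l y ->
  (forall phi, atlas phi -> cdom phi (G l x) ->
     row_free (col_mx (velocity phi (G l) x) (velocity phi (G l) y))) /\
  exists j, [/\ vertex (K l) (iota j) = G l x, G l x = loop (K l) x &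
                G l y = loop (K l) y].

(** Near the times of a kept double point G coincides with K, so transversality is inherited. A
    double point of a nearby knot found there bears the label [iota j], because by continuity the
    strand stays away from all other vertices. *)
Lemma near_retained_pair j x y : loop (K l0) x = vertex (K l0) (iota j) ->
  loop (K l0) y = vertex (K l0) (iota j) ->
  \forall v \near (l0, (x, y)), Pair v.1 v.2.1 v.2.2.
Proof.
move=> vx vy.
have nC z : ~ C z -> \forall z' \near z, ~ C z'.
  by move=> Cz; apply: open_nbhs_nbhs; split=> //; exact: closed_openC.
have nx := nC _ (retained vx); have ny := nC _ (retained vy).
have n1 : \forall w \near (l0, (x, y)), \forall z \near w.2.1, ~ C z.
  apply: (@near_pullr _ _ (fun u : R * R => \forall z \near u.1, ~ C z) l0 (x, y)).
  exact: (@near_pull0 _ _ (fun u : R => \forall z \near u, ~ C z) x y (near_join nx)).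
have n2 : \forall w \near (l0, (x, y)), \forall z \near w.2.2, ~ C z.
  apply: (@near_pullr _ _ (fun u : R * R => \forall z \near u.2, ~ C z) l0 (x, y)).
  exact: (@near_pullr _ _ (fun u : R => \forall z \near u, ~ C z) x y (near_join ny)).
have n3 : \forall w \near (l0, (x, y)), forall z, ~ C z -> G w.1 z = loop (K w.1) z.
  exact: (@near_pull0 _ _ (fun l => forall z, ~ C z -> G l z = loop (K l) z) l0 (x, y) GK).
have n4 : \forall w \near (l0, (x, y)), forall k, k <> iota j ->
    loop (K w.1) w.2.1 <> vertex (K w.1) k.
  apply: near_forall => k; have [->|/eqP kj] := eqVneq k (iota j).
    by apply: (@nearW _ (nbhs (l0, (x, y)))) => w.
 
  have c1 := continuous_pull1 (v := y) (KC1 x).1.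
  have c2 := continuous_pull0 (u := (x, y)) (@Kv k).
  have ne : loop (K l0) x <> vertex (K l0) k.
    by rewrite vx => /(vertex_injective (sknotP (K l0)))/esym.
  by have := near_neq (mhausdorff (o := M)) c1 c2 ne; apply: filterS => w + _.
near=> w => Qw yx Gxy.
have Cx : \forall z \near w.2.1, ~ C z by near: w.
have Cy : \forall z \near w.2.2, ~ C z by near: w.
have GKw : forall z, ~ C z -> G w.1 z = loop (K w.1) z by near: w.
have Kw : forall k, k <> iota j -> loop (K w.1) w.2.1 <> vertex (K w.1) k by near: w.
have Gx := GKw _ (nbhs_singleton Cx); have Gy := GKw _ (nbhs_singleton Cy).
have pK := (periodic_knotP _ _).1 (sknotP (K w.1)).
have Kxy : loop (K w.1) w.2.1 = loop (K w.1) w.2.2 by rewrite -Gx -Gy.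
split=> [phi aphi|].
  rewrite Gx => dx.
  rewrite (@velocity_near_eq _ _ _ (G w.1) (loop (K w.1)) w.2.1); last exact: filterS GKw Cx.
  rewrite (@velocity_near_eq _ _ _ (G w.1) (loop (K w.1)) w.2.2); last exact: filterS GKw Cy.
  exact: pk_trans pK _ _ _ aphi dx yx Kxy.
have [k vk] := pk_all pK yx Kxy.
exists j; split=> //; have [<-//|kj] := pselect (k = iota j); first by rewrite vk Gx.
by case: (Kw _ kj).
Unshelve. all: by end_near. Qed.

Lemma near_resolved_pairs : \forall l \near l0, forall x y,
  y - x \isn't a Num.int -> G l x = G l y -> Pair l x y.
Proof.
apply: near_double_pairs.
- exact: nbhs_singleton GC1.
- exact: nbhs_singleton near_resolved_immersed.
- exact: Gper.
- apply: filterS Gper => l Gl x y j k ji ki H Ql.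
  rewrite (int_of_shift x y ji ki) !(periodic_int Gl)// => yx Gxy.
  have [Ht [i [vi Gx Gy]]] := H Ql yx Gxy; split.
    by move=> phi aphi dx; rewrite !velocity_periodic//; exact: Ht.
  have Kl := pk_per ((periodic_knotP _ _).1 (sknotP (K l))).
  by exists i; rewrite !(periodic_int Kl).
- move=> x y yx; rewrite !G0 => Kxy.
  have [k vk] := pk_all ((periodic_knotP _ _).1 (sknotP (K l0))) yx Kxy.
  have [[j jk]|nj] := pselect (exists j, iota j = k).
    by apply: (@near_retained_pair j); rewrite jk vk.
  have nj' j : iota j <> k by move=> jk; apply: nj; exists j.
  have := separated nj' yx (esym vk) (etrans (esym Kxy) (esym vk)).
  by apply: filterS => w sw Qw _ /(sw Qw).
Qed.

Lemma near_vertex_times : \forall l \near l0, forall z j,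
  loop (K l) z = vertex (K l) (iota j) -> ~ C z.
Proof.
apply: near_all_periodic.
  apply: nearW => l z k ki H j.
  have Kl := pk_per ((periodic_knotP _ _).1 (sknotP (K l))).
  by rewrite (periodic_int Kl)// => /H Cz /(Cper ki).
move=> z.
apply: near_forall => j.
have [e|ne] := pselect (loop (K l0) z = vertex (K l0) (iota j)).
  have Cz := retained e.
  have nC : \forall z' \near z, ~ C z'.
    by apply: open_nbhs_nbhs; split=> //; exact: closed_openC.
  by have := @near_pullr _ _ (fun z => ~ C z) l0 z nC; apply: filterS => w + _.
have c2 := continuous_pull0 (u := z) (@Kv (iota j)).
by have := near_neq (mhausdorff (o := M)) (KC1 z).1 c2 ne; apply: filterS => w + /[swap] _ e.
Qed.

(* Compactness of the circle confines the double points of G l to neighbourhoods *)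
(* of those of K l0.                                                            *)
Lemma near_resolved_knot : \forall l \near l0, Q l ->
  is_singular_knot (G l) (vertex (K l) \o iota).
Proof.
near=> l => Ql; apply/periodic_knotP.
have Gl : forall x, G l (x + 1) = G l x by near: l.
have Gi : forall z, immersed (G l) z by near: l; exact: near_resolved_immersed.
have Gp : forall x y, y - x \isn't a Num.int -> G l x = G l y -> Pair l x y.
  by near: l; exact: near_resolved_pairs.
have GCl : forall z, C1at G (l, z) by near: l.
have GKl : forall z, ~ C z -> G l z = loop (K l) z by near: l.
have Kt : forall z j, loop (K l) z = vertex (K l) (iota j) -> ~ C z.
  by near: l; exact: near_vertex_times.
have pK := (periodic_knotP _ _).1 (sknotP (K l)).
split.
- exact: Gl.
- by move=> x; exact: (C1at_loop (GCl x)).1.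
- by move=> phi x aphi dx; exact: (C1at_loop (GCl x)).2.
- by move=> phi x aphi dx; exact: Gi.
- by move=> phi x y aphi dx yx Gxy; exact: (Gp _ _ yx Gxy Ql yx Gxy).1.
- by move=> i j /(pk_inj pK)/iota_inj.
- by move=> x y yx Gxy; have [_ [j [vj _ _]]] := Gp _ _ yx Gxy Ql yx Gxy; exists j.
- move=> j; have [x [y [yx Kx Ky Kz]]] := pk_dbl pK (iota j).
  have Gx : G l x = vertex (K l) (iota j) by rewrite GKl//; exact: Kt Kx.
  have Gy : G l y = vertex (K l) (iota j) by rewrite GKl//; exact: Kt Ky.
  exists x, y; split=> // z Gz.
  (* A time z that differs from x modulo 1 forms a double pair of [G l] with x. Hence [G l] and
     [K l] agree at z, and z is one of the two times known for [K l]. *)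
  have [zx|zx] := boolP (z - x \is a Num.int); first by left.
  have xz : x - z \isn't a Num.int by rewrite -opprB rpredN.
  have [_ [i [_ Kz' _]]] := Gp _ _ xz (etrans Gz (esym Gx)) Ql xz (etrans Gz (esym Gx)).
  by have := Kz z (etrans (esym Kz') Gz); rewrite (negbTE zx).
Unshelve. all: by end_near. Qed.

End Resolution.

(** * Crossings and bumps *)

Section Signs.
Context {R : realType}.

Definition signed (b : bool) (a : R) : Prop := if b then 0 < a else a < 0.

Lemma signedZ b c a : 0 < c -> signed b a -> signed b (c * a).
Proof. by rewrite /signed; case: b => c0 a0; [rewrite mulr_gt0|rewrite pmulr_rlt0]. Qed.

Lemma signed_convex b (s a a' : R) : 0 <= s <= 1 -> signed b a -> signed b a' ->
  signed b ((1 - s) * a + s * a').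
Proof.
have pos (c c' : R) : 0 <= s <= 1 -> 0 < c -> 0 < c' -> 0 < (1 - s) * c + s * c'.
  move=> /andP[s0 s1] c0 c'0; have [->|sn0] := eqVneq s 0; first by lra.
  by rewrite ltr_wpDl ?mulr_ge0 ?mulr_gt0 ?subr_ge0 ?(ltW c0)// lt_neqAle eq_sym sn0.
rewrite /signed; case: b => s01 a0 a'0; first exact: pos.
have := pos (- a) (- a') s01; rewrite !oppr_gt0 => /(_ a0 a'0); lra.
Qed.

Lemma signed_neq0 b a : signed b a -> a != 0.
Proof. by case: b => /= a0; [rewrite gt_eqF|rewrite lt_eqF]. Qed.

Lemma near_signed (T : topologicalType) (f : T -> R) t b :
  {for t, continuous f} -> signed b (f t) -> \forall t' \near t, signed b (f t').
Proof.
move=> fc ft; have fts : nbhs (f t) (signed b).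
  by case: b ft => /= ft; [exact: lt_nbhsr|exact: lt_nbhsl].
exact: fc _ fts.
Qed.

End Signs.

(** * Separation of the two strands at a crossing *)

Section Crossings.
Context {R : realType} {M : oriented_3manifold R} {L : topologicalType}.
Implicit Types (phi psi : chart R M) (K G : L -> R -> M).

(** The displacement from K to G at time z relative to that at time z', seen in the chart. *)
Definition gap phi K G (l : L) (z z' : R) : 'rV[R]_3 :=
  (cmap phi (G l z) - cmap phi (K l z)) - (cmap phi (G l z') - cmap phi (K l z')).

(* The strands of G near x and y lie on the side b of each other: by the mean  *)
(* value theorem, G l z = G l z' would make the gap a combination of vectors   *)
(* v.2.1 and v.2.2 close to the two velocities, against the sign condition.    *)
Definition sided b phi K G (Q : L -> Prop) l0 (x y : R) : Prop :=
  \forall v \near ((l0, (x, y)),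
      (velocity phi (K l0) x, velocity phi (K l0) y)), Q v.1.1 ->
    signed b (det3 v.2.1 v.2.2 (gap phi K G v.1.1 v.1.2.1 v.1.2.2)).

(** Exchanging the strands exchanges the velocities and reverses the gap; the two sign changes
    cancel. *)
Lemma sided_sym b phi K G Q l0 x y :
  sided b phi K G Q l0 x y -> sided b phi K G Q l0 y x.
Proof.
move=> [[/= A1 A2] [[[/= A11 A12] [/= nA11 [[B1 B2] [/= nB1 nB2] B12]] A112]
  [[/= U W] [/= nU nW] UW]] A12'].
exists (A11 `*` (B2 `*` B1), W `*` U); first split=> /=.
- exists (A11, B2 `*` B1) => //=; split=> //=.
  by exists (B2, B1).
- by exists (W, U).
move=> [[l [z z']] [u w]] [/= [Al [Bz Bz']] [Wu Uw]] Ql.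
have := A12' ((l, (z', z)), (w, u)); rewrite /gap /=.
move=> /(_ _ Ql); rewrite det3C -det3N opprB; apply.
split=> /=; last exact: (UW (w, u)).
by apply: (A112 (l, (z', z))); split=> //; exact: (B12 (z', z)).
Qed.

(** The hypothesis on A and B supplies a crossing of [K l] at times close to x and y. The mean
    values are taken from these times, since the crossing may move with l. *)
Lemma sided_separated b phi K G Q l0 x y : atlas phi ->
  C1at K (l0, x) -> C1at K (l0, y) -> cdom phi (K l0 x) -> K l0 x = K l0 y ->
  (forall A B, nbhs x A -> nbhs y B -> \forall l \near l0,
     exists x' y', [/\ A x', B y' & K l x' = K l y']) ->
  sided b phi K G Q l0 x y ->
  \forall v \near (l0, (x, y)), Q v.1 -> G v.1 v.2.1 <> G v.1 v.2.2.
Proof.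
move=> aphi Cx Cy dx Kxy cross.
have dy : cdom phi (K l0 y) by rewrite -Kxy.
move=> [[/= A1 A2] [[[/= A11 A12] [/= nA11 [[B1 B2] [/= nB1 nB2] B12]] A112]
  [[/= U W] [/= nU nW] UW]] SA].
have [[/= D1 D2] [/= nD1 [[/= X1 X2] [nX1 nX2] X12]] DX] :=
  C1v_mean_value (Cx.2 _ aphi dx) nU.
have [[/= E1 E2] [/= nE1 [[/= Y1 Y2] [nY1 nY2] Y12]] EY] :=
  C1v_mean_value (Cy.2 _ aphi dy) nW.
have cr := cross _ _ nX1 nY1.
exists (A11 `&` D1 `&` E1 `&` [set l | exists x' y', [/\ X1 x', Y1 y' & K l x' = K l y']],
        (B1 `&` X2) `*` (B2 `&` Y2)).
  split=> /=; first by do 3! apply: filterI => //.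
  by exists (B1 `&` X2, B2 `&` Y2) => //=; split; exact: filterI.
move=> [l [z z']] [/= [[[Al Dl] El] [x' [y' [X1x Y1y Kxy']]]] [[B1z X2z] [B2z Y2z]]] Ql Gzz'.
have [U0 UU0 e1] := DX (l, (x', z)) (conj Dl (X12 (_, _) (conj X1x X2z))).
have [W0 WW0 e2] := EY (l, (y', z')) (conj El (Y12 (_, _) (conj Y1y Y2z))).
have := SA ((l, (z, z')), (U0, W0)); rewrite /gap /= => /(_ _ Ql).
(* As [G l z = G l z'] and [K l x' = K l y'], the gap telescopes to a combination of the two mean
   velocities, on which the determinant vanishes. *)
have -> : cmap phi (G l z) - cmap phi (K l z) - (cmap phi (G l z') - cmap phi (K l z')) =
    - (z - x') *: U0 + (z' - y') *: W0.
  by move: e1 e2; rewrite /= Gzz' Kxy' scaleNr => <- <-; apply/rowP => i; rewrite !mxE; ring.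
rewrite det3_span => H; suff /signed_neq0 : signed b (0 : R) by rewrite eqxx.
apply: H; split=> /=; last exact: (UW (_, _)).
by apply: (A112 (l, (z, z'))); split=> //; exact: (B12 (_, _)).
Qed.

(** The displacement is made in [psi] but measured in [phi]. By strict differentiability of the
    transition it is seen as [e *: eta z *m A] with A close to the jacobian J. Velocities are
    transformed by J, so the determinant is multiplied by a number close to [det J], which is
    positive because M is oriented. *)
Lemma sided_pert b phi psi K (e : L -> R) (eta : R -> 'rV[R]_3) l0 x y :
  atlas phi -> atlas psi -> C1at K (l0, x) -> C1at K (l0, y) -> K l0 x = K l0 y ->
  cdom phi (K l0 x) -> cdom psi (K l0 x) ->
  {for l0, continuous e} -> e l0 = 0 -> {for x, continuous eta} ->
  (\forall z \near y, eta z = 0) ->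
  signed b (det3 (velocity psi (K l0) x) (velocity psi (K l0) y) (eta x)) ->
  sided b phi K (fun l => pert psi (fun z => e l *: eta z) (K l)) (fun l => 0 < e l) l0 x y.
Proof.
move=> aphi apsi Cx Cy Kxy dphi dpsi ec e0 etac eta0 sg.
pose J := jacobian (transition psi phi) (cmap psi (K l0 x)).
have [td tc J0] := transitionP apsi aphi dpsi dphi.
set u := velocity phi (K l0) x; set w := velocity phi (K l0) y.
have vel z : K l0 x = K l0 z -> C1at K (l0, z) ->
    velocity phi (K l0) z = velocity psi (K l0) z *m J.
  move=> Kz Cz; have [Kc Kd] := C1at_loop Cz.
  have dz : cdom psi (K l0 z) by rewrite -Kz.
  rewrite /J Kz (velocity_transition apsi aphi)//.
  - exact: Kc _ (near_cdom dz).
  - exact: (Kd _ apsi dz).1.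
  - by rewrite -Kz.
have sJ : signed b (det3 u w (eta x *m J)).
  rewrite /u /w (vel x)// (vel y)// det3_mulmx mulrC; exact: signedZ.
(* Jointly continuous in the two vectors, the time and the matrix, so its sign persists for mean
   velocities and for matrices close to J. *)
pose f (v : ('rV[R]_3 * 'rV[R]_3) * (R * 'M[R]_3)) : R :=
  det3 v.1.1 v.1.2 (eta v.2.1 *m v.2.2).
have fc : {for ((u, w), (x, J)), continuous f}.
  apply: cvg_det3.
  - by apply: (@continuous_comp _ _ _ fst fst); exact: cvg_fst.
  - by apply: (@continuous_comp _ _ _ fst snd); [exact: cvg_fst|exact: cvg_snd].
  - apply: cvg_mulmx; last by apply: (@continuous_comp _ _ _ snd snd); exact: cvg_snd.
    apply: (@continuous_comp _ _ _ (fun v : ('rV[R]_3 * 'rV[R]_3) * (R * 'M[R]_3) => v.2.1) eta); last exact: etac.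
    by apply: (@continuous_comp _ _ _ snd fst); [exact: cvg_snd|exact: cvg_fst].
have [[/= S1 S2] [/= [[/= U W] [/= nU nW] UW] [[X N] [/= nX nN] XN]] SS] := near_signed fc sJ.
have strict := strict_differentiability td tc nN.
pose q (v : L * R) := cmap psi (K v.1 v.2).
have qc : {for (l0, x), continuous q} by have [] := Cx.2 _ apsi dpsi.
have etac' : {for (l0, x), continuous (fun v : L * R => e v.1 *: eta v.2)}.
  apply: cvgZ; first exact: continuous_pull0.
  by apply: (@continuous_comp _ _ _ snd eta); [exact: cvg_snd|].
have q0 : q (l0, x) + e l0 *: eta x = q (l0, x) by rewrite e0 scale0r addr0.
have n1 : \forall v \near (l0, x), exists2 A, N A &
    transition psi phi (q v + e v.1 *: eta v.2) - transition psi phi (q v) = (e v.1 *: eta v.2) *m A.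
  have cc : {for (l0, x), continuous (fun v => (q v, q v + e v.1 *: eta v.2))}.
    apply: (@cvg_pair _ _ _ _ (nbhs (q (l0, x))) (nbhs (q (l0, x) + e l0 *: eta x))).
      exact: qc.
    exact: cvgD qc etac'.
  have H : \forall p \near (q (l0, x), q (l0, x) + e l0 *: eta x), exists2 A, N A &
      transition psi phi p.2 - transition psi phi p.1 = (p.2 - p.1) *m A.
    by rewrite q0.
  have H' : \forall v \near (l0, x), exists2 A, N A &
      transition psi phi (q v + e v.1 *: eta v.2) - transition psi phi (q v) =
      (q v + e v.1 *: eta v.2 - q v) *m A := cc _ H.
  apply: filterS H' => v [A NA eA]; exists A => //.
  by rewrite eA /= addrAC subrr add0r.
have n2 := near_C1_cdom Cx.1 dpsi.
have m1 := @near_pull1 _ _ _ (fun l z => exists2 A, N A &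
    transition psi phi (q (l, z) + e l *: eta z) - transition psi phi (q (l, z)) = (e l *: eta z) *m A)
    l0 x y n1.
have m2 := @near_pull1 _ _ _ (fun l z => cdom psi (K l z)) l0 x y n2.
have m3 : \forall v \near (l0, (x, y)), eta v.2.2 = 0.
  by have := @near_pull2 _ _ _ (fun _ z => eta z = 0) l0 x y (@near_pullr _ _ (fun z => eta z = 0) l0 y eta0).
have m4 : \forall v \near (l0, (x, y)), X v.2.1.
  by have := @near_pull1 _ _ _ (fun _ z => X z) l0 x y (@near_pullr _ _ X l0 x nX).
have M1 : \forall v \near ((l0, (x, y)), (u, w)), [/\ (exists2 A, N A &
    transition psi phi (q (v.1.1, v.1.2.1) + e v.1.1 *: eta v.1.2.1) -
      transition psi phi (q (v.1.1, v.1.2.1)) = (e v.1.1 *: eta v.1.2.1) *m A),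
    cdom psi (K v.1.1 v.1.2.1), eta v.1.2.2 = 0 & X v.1.2.1].
  apply: (@near_pull0 _ _ (fun v : L * (R * R) => [/\ (exists2 A, N A &
    transition psi phi (q (v.1, v.2.1) + e v.1 *: eta v.2.1) -
      transition psi phi (q (v.1, v.2.1)) = (e v.1 *: eta v.2.1) *m A),
    cdom psi (K v.1 v.2.1), eta v.2.2 = 0 & X v.2.1]) (l0, (x, y)) (u, w)).
  by near=> v; split; near: v.
have M2 : \forall v \near ((l0, (x, y)), (u, w)), U v.2.1 /\ W v.2.2.
  apply: (@near_pullr _ _ (fun v => U v.1 /\ W v.2) (l0, (x, y)) (u, w)).
  by exists (U, W).
rewrite /sided -/u -/w; apply: filterS2 M1 M2 => -[[l [z z']] [u' w']] /=.
move=> [[A NA eA] dz e'0 Xz] [Uu Ww] el.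
rewrite /gap pert_cinv// (@pert0 _ _ psi (fun z => e l *: eta z) (K l) z'); last by rewrite e'0 scaler0.
rewrite subrr subr0 -(transition_cmap phi dz) -/(q (l, z)).
rewrite -[cmap phi (cinv psi _)]/(transition psi phi (q (l, z) + e l *: eta z)) eA -scalemxAl det3Z.
apply: signedZ => //; apply: (SS ((u', w'), (z, A))).
by split; [exact: (UW (_, _))|exact: (XN (_, _))].
Unshelve. all: by end_near. Qed.

End Crossings.

(** * A periodic bump function of class C^1 *)

Section Bump.
Context {R : realType}.
Implicit Types (x r z : R).

(* Its composition with a cosine is a 1-periodic bump of class C^1. *)
Definition pos_sqr (t : R) : R := Num.max 0 t ^+ 2.

Lemma is_derive_pos_sqr (t : R) : is_derive t 1 pos_sqr (2 * Num.max 0 t).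
Proof.
have [t0|t0|->] := ltgtP t 0.
- rewrite mulr0.
  apply: (@near_eq_is_derive R R^o R^o (cst 0)).
  near=> s; rewrite /pos_sqr (max_idPl _) ?expr0n// ltW//.
  by near: s; exact: lt_nbhsl.
- apply: (@near_eq_is_derive R R^o R^o (fun s : R => s ^+ 2 : R^o)).
    near=> s; rewrite /pos_sqr (max_idPr _)// ltW//.
    by near: s; exact: lt_nbhsr.
  apply: DeriveDef; first exact: exprn_derivable.
  by rewrite exp_derive expr1; exact: (mulr1 (2 * t)).
- rewrite ?maxxx mulr0.
  (* At 0 the difference quotient is bounded by [|h|]. *)
  have H : h^-1 *: (pos_sqr (h *: 1 + 0) - pos_sqr 0) @[h --> (0 : R)^'] --> (0 : R).
    apply/cvgrPdist_le => /= e e0; near=> h.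
    have h0 : h != 0 by near: h; exact: nbhs_dnbhs_neq.
    have he : `|h| < e by near: h; exact: dnbhs0_lt.
    rewrite sub0r normrN /pos_sqr maxxx expr0n/= subr0 addr0 [h *: 1]mulr1 normrM normfV.
    rewrite mulrC ler_pdivrMr ?normr_gt0// normrX expr2.
    have mh : `|Num.max 0 h| <= `|h|.
      by case: (leP 0 h) => hh; rewrite ?normr0.
    apply: ler_pM => //; exact: le_trans mh (ltW he).
  by apply: DeriveDef; [apply/cvg_ex; exists 0|exact: cvg_lim].
Unshelve. all: by end_near. Qed.

Definition angle x z : R := 2 * pi * (z - x).
Definition bump x r z : R := pos_sqr (cos (angle x z) - cos (2 * pi * r)).
(** For 0 < r < 1/2, the closed arc of radius r about x modulo 1 ([bump_supportP],
    [bump_support_mem]), written as a preimage under a continuous periodic function so that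
    closedness and periodicity are immediate. *)
Definition bump_support x r : set R := [set z | cos (2 * pi * r) <= cos (angle x z)].

Lemma cos_angle_int x z k : k \is a Num.int -> cos (angle x (z + k)) = cos (angle x z).
Proof.
move=> ki; apply: (periodic_int (f := fun z => cos (angle x z))) => // y.
have -> : angle x (y + 1) = angle x y + pi *+ 2 by rewrite /angle mulr2n; ring.
exact: cosD2pi.
Qed.

Lemma bump_supportP x r z : 0 < r < 2^-1 -> bump_support x r z ->
  exists2 k, k \is a Num.int & `|z - x - k| <= r.
Proof.
move=> r0 Cz; have [k ki zk] := int_shift_half (z - x).
exists (- k); first by rewrite rpredN.
rewrite opprK; move: Cz; rewrite /bump_support/= -(cos_angle_int x z ki).
have -> : angle x (z + k) = 2 * pi * (z - x + k) by rewrite /angle; ring.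
rewrite -[cos (2 * pi * (z - x + k))]cos_norm -[cos (2 * pi * r)]cos_norm.
have pi0 := pi_gt0 R.
rewrite !normrM !(ger0_norm (x := 2)) ?(ger0_norm (x := pi)) ?(ger0_norm (x := r))//; try lra.
rewrite leNgt => /negP Cz; rewrite leNgt; apply/negP => zr; apply: Cz.
rewrite ltr_cos ?in_itv/=.
- by rewrite ltr_pM2l// mulr_gt0.
- by nra.
- by nra.
Qed.

Lemma bump_support_int x r z k : k \is a Num.int ->
  bump_support x r (z + k) -> bump_support x r z.
Proof. by move=> ki; rewrite /bump_support/= cos_angle_int. Qed.

Lemma continuous_cos_angle x : continuous (fun z => cos (angle x z)).
Proof.
move=> z; apply: (@continuous_comp _ _ _ (angle x) cos); last exact: continuous_cos.
by apply: cvgM; [exact: cvg_cst|apply: cvgB; [exact: cvg_id|exact: cvg_cst]].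
Qed.

Lemma closed_bump_support x r : closed (bump_support x r).
Proof.
apply: (@preimage_closed _ _ (fun z => cos (angle x z)) [set t | cos (2 * pi * r) <= t]).
  by move=> z _; exact: continuous_cos_angle.
exact: closed_ge.
Qed.

Lemma bump_periodic x r z k : k \is a Num.int -> bump x r (z + k) = bump x r z.
Proof. by move=> ki; rewrite /bump cos_angle_int. Qed.

Lemma bump_neq0 x r z : bump x r z != 0 -> bump_support x r z.
Proof.
apply: contra_neqP; rewrite /bump_support/= => /negP; rewrite -ltNge => h.
by rewrite /bump /pos_sqr (max_idPl _) ?expr0n//; lra.
Qed.

Lemma bump_gt0 x r : 0 < r < 2^-1 -> 0 < bump x r x.
Proof.
move=> r0; rewrite /bump /angle subrr mulr0 cos0 exprn_gt0//.
have pi0 := pi_gt0 R.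
have c : cos (2 * pi * r) < 1.
  by rewrite -[ltRHS](@cos0 R) ltr_cos ?in_itv/= ?lexx ?(ltW pi0)//; nra.
by rewrite lt_max; apply/orP; right; lra.
Qed.

Lemma is_derive_bump x r z : is_derive z 1 (bump x r)
  (2 * Num.max 0 (cos (angle x z) - cos (2 * pi * r)) * (- sin (angle x z) * (2 * pi))).
Proof.
pose g z := cos (angle x z) - cos (2 * pi * r).
have da : is_derive z 1 (angle x) (2 * pi).
  rewrite /angle (_ : (fun z => _) = (2 * pi) *: (id - cst x)); last by apply/funext.
  by apply: is_derive_eq; rewrite subr0 [_ *: _]mulr1.
have dc : is_derive z 1 (cos \o angle x) (- sin (angle x z) * (2 * pi)).
  exact: is_derive1_comp.
have dg : is_derive z 1 g (- sin (angle x z) * (2 * pi)).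
  rewrite (_ : g = (cos \o angle x) - cst (cos (2 * pi * r))); last by apply/funext.
  by apply: is_derive_eq; rewrite subr0.
exact: (@is_derive1_comp R pos_sqr g z _ _ (is_derive_pos_sqr _) dg).
Qed.

Lemma C1v_bump (L : topologicalType) x r (d : 'rV[R]_3) (w : L * R) :
  C1v (fun _ z => bump x r z *: d) w.
Proof.
have db z := is_derive_bump x r z.
have cmax : continuous (fun t : R => Num.max 0 t : R).
  by move=> t; apply: (@continuous_max R R^o (fun=> 0) (fun t => t)); [exact: cvg_cst|exact: cvg_id].
have dbd z : derivable (fun z => bump x r z *: d) z 1 /\
    derive1 (fun z => bump x r z *: d) z =
    (2 * Num.max 0 (cos (angle x z) - cos (2 * pi * r)) * (- sin (angle x z) * (2 * pi))) *: d.
  have bd : differentiable (bump x r) z by apply/derivable1_diffP; have [] := db z.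
  split; first by apply/derivable1_diffP; exact: differentiableZl.
  by rewrite derive1E' ?diffZl -?derive1E'//; [rewrite derive1E derive_val|exact: differentiableZl].
have c2 f : continuous f -> {for w, continuous (fun v : L * R => f v.2 : 'rV[R]_3)}.
  by move=> fc; apply: (@continuous_comp _ _ _ snd f); [exact: cvg_snd|exact: fc].
split.
- apply: (c2 (fun z => bump x r z *: d)) => z.
  exact/differentiable_continuous/derivable1_diffP/(dbd z).1.
- by near=> v; exact: (dbd _).1.
- rewrite (_ : (fun v => _) = (fun v : L * R => (2 * Num.max 0 (cos (angle x v.2) - cos (2 * pi * r)) * (- sin (angle x v.2) * (2 * pi))) *: d)); last first.
    by apply/funext => v; exact: (dbd _).2.
  apply: (c2 (fun z => (2 * Num.max 0 (cos (angle x z) - cos (2 * pi * r)) * (- sin (angle x z) * (2 * pi))) *: d)) => z.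
  have ca : {for z, continuous (angle x)}.
    by apply: cvgM; [exact: cvg_cst|apply: cvgB; [exact: cvg_id|exact: cvg_cst]].
  apply: cvgZ; last exact: cvg_cst.
  apply: cvgM.
    apply: cvgM; first exact: cvg_cst.
    apply: (@continuous_comp _ _ _ (fun z => cos (angle x z) - cos (2 * pi * r)) (fun t => Num.max 0 t)).
      by apply: cvgB; [exact: continuous_cos_angle|exact: cvg_cst].
    exact: cmax.
  apply: cvgM; last exact: cvg_cst.
  apply: cvgN; apply: (@continuous_comp _ _ _ (angle x) sin) => //.
  exact: continuous_sin.
Unshelve. all: by end_near. Qed.

End Bump.

(** * From families of curves to isotopies *)

Section Families.
Context {R : realType} {M : oriented_3manifold R}.
Implicit Types (phi psi : chart R M).

Lemma sknot_ext n (K K' : @sknot R M n) : loop K =1 loop K' -> vertex K =1 vertex K' -> K = K'.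
Proof.
case: K => g v gv; case: K' => g' v' gv' /= /funext gg' /funext vv'.
by move: gv; rewrite gg' vv' => gv; congr SKnot; exact: Prop_irrelevance.
Qed.

Lemma knot_ext (P : @structure R M) n (K K' : knot P n) :
  loop K =1 loop K' -> vertex K =1 vertex K' -> K = K'.
Proof.
case: K => K PK; case: K' => K' PK' /= gg' vv'.
have KK' := sknot_ext gg' vv'; move: PK; rewrite KK' => PK.
by congr Knot; exact: Prop_irrelevance.
Qed.

(** Retracts the line onto [0, 1]: [isotopic] wants a path indexed by all of R, whereas families are
    constructed over [0, 1]. *)
Definition clamp (t : R) : R := Num.max 0 (Num.min t 1).

Lemma clamp_itv t : 0 <= clamp t <= 1.
Proof. by rewrite /clamp le_max lexx ge_max ler01 ge_min lexx orbT. Qed.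

Lemma clamp0 : clamp 0 = 0.
Proof. by rewrite /clamp (min_idPl _)// maxxx. Qed.

Lemma clamp1 : clamp 1 = 1.
Proof. by rewrite /clamp minxx (max_idPr _). Qed.

Lemma continuous_clamp : continuous clamp.
Proof.
move=> t; apply: (@continuous_max R R^o (fun=> 0) (fun t => Num.min t 1)); first exact: cvg_cst.
by apply: (@continuous_min R R^o (fun t => t) (fun=> 1)); [exact: cvg_id|exact: cvg_cst].
Qed.

Lemma isotopic_family (P : @structure R M) n (G : R -> R -> M) (V : R -> 'I_n -> M)
    (K0 K1 : knot P n) :
  (forall t, 0 <= t <= 1 -> exists K : knot P n, loop K =1 G t /\ vertex K =1 V t) ->
  (forall t z, 0 <= t <= 1 -> C1at G (t, z)) ->
  (forall t i, 0 <= t <= 1 -> {for t, continuous (fun t => V t i)}) ->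
  loop K0 =1 G 0 -> vertex K0 =1 V 0 -> loop K1 =1 G 1 -> vertex K1 =1 V 1 ->
  isotopic K0 K1.
Proof.
move=> KP GC Vc g0 v0 g1 v1.
have /choice[K KE] t : exists K : knot P n, loop K =1 G (clamp t) /\ vertex K =1 V (clamp t).
  exact: KP (clamp_itv t).
exists K; split.
- have loopE : (fun t => loop (K t)) = (fun t => G (clamp t)).
    by apply/funext => t; apply/funext => z; exact: (KE t).1.
  have C t z : C1at (fun t => loop (K t)) (t, z).
    rewrite loopE; apply: C1at_pull; first exact: continuous_clamp.
    exact: GC (clamp_itv _).
  split.
  + by move=> [t z]; exact: (C t z).1.
  + by move=> phi [t z] aphi dz; have [] := (C t z).2 phi aphi dz.
  + move=> i t; have -> : (fun t => vertex (K t) i) = (fun t => V (clamp t) i).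
      by apply/funext => t'; exact: (KE t').2.
    apply: (@continuous_comp _ _ _ clamp (fun t => V t i)); first exact: continuous_clamp.
    exact: Vc (clamp_itv _).
- apply: knot_ext => z; first by rewrite (KE 0).1 clamp0 g0.
  by rewrite (KE 0).2 clamp0 v0.
- apply: knot_ext => z; first by rewrite (KE 1).1 clamp1 g1.
  by rewrite (KE 1).2 clamp1 v1.
Qed.

(* The structures inherited by K' from K when the i-th double point of K is    *)
(* resolved without moving the others.                                         *)
Definition hereditary (P : @structure R M) : Prop :=
  forall n (K : sknot n.+1) (i : 'I_n.+1) (K' : sknot n),
    P _ K -> vertex K' =1 vertex K \o fintype.lift i ->
    (forall j z, loop K z = vertex K' j -> loop K' z = vertex K' j) -> P _ K'.

(** The displacement is zero at [l0], so on C the displaced point stays in the open image of the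
    chart for l near [l0], uniformly in time by compactness. Off C nothing moves, so leaving the
    chart there does no harm. *)
Lemma near_pert_C1 (L : topologicalType) (l0 : L) (K : L -> R -> M) (e : L -> R)
    phi (eta : R -> 'rV[R]_3) (C : set R) :
  atlas phi -> (\forall l \near l0, forall z, C1at K (l, z)) ->
  (\forall l \near l0, forall x, K l (x + 1) = K l x) ->
  (\forall l \near l0, {for l, continuous e}) -> e l0 = 0 ->
  (forall w : L * R, C1v (fun _ => eta) w) ->
  (forall x, eta (x + 1) = eta x) -> (forall z, eta z != 0 -> C z) ->
  closed C -> (forall x k, k \is a Num.int -> C (x + k) -> C x) ->
  (forall z, C z -> cdom phi (K l0 z)) ->
  \forall l \near l0,
    (forall z, C1at (fun l => pert phi (fun z => e l *: eta z) (K l)) (l, z)) /\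
    (forall z, C z -> cdom phi (K l z) /\
       (cmap phi @` cdom phi) (cmap phi (K l z) + e l *: eta z)).
Proof.
move=> aphi KC Kper ec e0 etaC etaper etaS Ccl Cper Cdom.
have KC0 := nbhs_singleton KC.
have openC z : ~ C z -> \forall z' \near z, ~ C z'.
  by move=> Cz; apply: open_nbhs_nbhs; split=> //; exact: closed_openC.
have U : \forall l \near l0, forall z, C z -> cdom phi (K l z) /\
       (cmap phi @` cdom phi) (cmap phi (K l z) + e l *: eta z).
  apply: near_all_periodic.
    apply: filterS Kper => l Kl z k ki H /(Cper _ _ ki) /H.
    by rewrite (periodic_int Kl)// (periodic_int etaper).
  move=> z; have [Cz|nCz] := pselect (C z); last first.
    by have := @near_pullr _ _ _ l0 z (openC _ nCz); apply: filterS => w nC /nC.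
  have dz := Cdom z Cz.
  have n1 := near_C1_cdom (KC0 z).1 dz.
  have [Kc _ _] := (KC0 z).2 _ aphi dz.
  have [ecz _ _] := C1vZ (w := (l0, z)) (nbhs_singleton ec) (etaC (l0, z)).
  have sc : {for (l0, z), continuous (fun v : L * R => cmap phi (K v.1 v.2) + e v.1 *: eta v.2)}.
    exact: cvgD Kc ecz.
  have i0 : (cmap phi @` cdom phi) (cmap phi (K l0 z) + e l0 *: eta z).
    by rewrite e0 scale0r addr0; exact: cmap_image.
  have n2 : \forall v \near (l0, z), (cmap phi @` cdom phi) (cmap phi (K v.1 v.2) + e v.1 *: eta v.2).
    exact: sc _ (near_cimage i0).
  by apply: filterS2 n1 n2 => v.
near=> l; have Ul : forall z, C z -> cdom phi (K l z) /\
       (cmap phi @` cdom phi) (cmap phi (K l z) + e l *: eta z) by near: l.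
have KCl : forall z, C1at K (l, z) by near: l.
have ecl : {for l, continuous e} by near: l.
split; last exact: Ul.
move=> z; have [Cz|nCz] := pselect (C z).
  have [dz iz] := Ul z Cz.
  exact: (C1at_pert (eta := fun l z => e l *: eta z) aphi (KCl z) (C1vZ (w := (l, z)) ecl (etaC (l, z))) dz iz).
apply: (@C1at_pert0 _ _ L K (fun l z => e l *: eta z) phi (l, z)); last exact: KCl.
have := @near_pullr _ _ _ l z (openC _ nCz); apply: filterS => w nC.
have [->|/etaS//] := eqVneq (eta w.2) 0; first by rewrite scaler0.
Unshelve. all: by end_near. Qed.

End Families.

Lemma int_sub (R : realType) (c u v : R) :
  u - c \is a Num.int -> v - c \is a Num.int -> v - u \is a Num.int.
Proof.
by move=> uc vc; rewrite (_ : v - u = (v - c) - (u - c)); [rewrite rpredB|ring].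
Qed.

Section SeparatedTimes.
Context {R : realType} {M : oriented_3manifold R} {L : topologicalType}.

Lemma near_translate (P : L -> R -> R -> Prop) (l0 : L) (x y j k : R) :
  (\forall v \near (l0, (x, y)), P v.1 v.2.1 v.2.2) ->
  \forall v \near (l0, (x + j, y + k)), P v.1 (v.2.1 - j) (v.2.2 - k).
Proof.
move=> [[A B] [/= nA [[B1 B2] [/= nB1 nB2] B12]] AB].
have tr (a c : R) (D : set R) : nbhs a D -> nbhs (a + c) [set z | D (z - c)].
  move=> nD; have cc : {for a + c, continuous (fun z : R => z - c)}.
    by apply: cvgB; [exact: cvg_id|exact: cvg_cst].
  by have := cc D; rewrite addrK; apply.
exists (A, [set z | B1 (z - j)] `*` [set z | B2 (z - k)]).
  by split=> //=; exists ([set z | B1 (z - j)], [set z | B2 (z - k)]) => //; split; exact: tr.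
move=> [l [z z']] [/= Al [Bz Bz']]; apply: (AB (l, (z - j, z' - k))); split=> //=.
exact: (B12 (_, _)).
Qed.

(** A double point has two times modulo 1, so any of its pairs of distinct times is [(x0, y0)] up to
    integer shifts and exchange. Separation is invariant under both. *)
Lemma separated_times n (K : @sknot R M n) (G : L -> R -> M) (Q : L -> Prop) (l0 : L) k (x0 y0 : R) :
  (\forall l \near l0, forall x, G l (x + 1) = G l x) ->
  loop K x0 = vertex K k -> loop K y0 = vertex K k -> y0 - x0 \isn't a Num.int ->
  (\forall v \near (l0, (x0, y0)), Q v.1 -> G v.1 v.2.1 <> G v.1 v.2.2) ->
  forall x y : R, y - x \isn't a Num.int ->
  loop K x = vertex K k -> loop K y = vertex K k ->
  \forall v \near (l0, (x, y)), Q v.1 -> G v.1 v.2.1 <> G v.1 v.2.2.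
Proof.
move=> Gper Kx0 Ky0 xy0 sep.
have [a [b [ab Ka Kb Kz]]] := pk_dbl ((periodic_knotP _ _).1 (sknotP K)) k.
have H x y : loop K x = vertex K k -> loop K y = vertex K k -> y - x \isn't a Num.int ->
    forall z, loop K z = vertex K k -> z - x \is a Num.int \/ z - y \is a Num.int.
  move=> /Kz xab /Kz yab xy z /Kz zab.
  case: xab => [xa|xb]; case: yab => [ya|yb]; case: zab => [za|zb]; first
    [by left; exact: int_sub xa za|by left; exact: int_sub xb zb|by right; exact: int_sub ya za
    |by right; exact: int_sub yb zb|by case/negP: xy; exact: int_sub xa ya|by case/negP: xy; exact: int_sub xb yb].
have sepT j k' : j \is a Num.int -> k' \is a Num.int ->
    \forall v \near (l0, (x0 + j, y0 + k')), Q v.1 -> G v.1 v.2.1 <> G v.1 v.2.2.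
  move=> ji ki.
  have t := @near_translate (fun l x y => Q l -> G l x <> G l y) l0 x0 y0 j k' sep.
  have gp : \forall v \near (l0, (x0 + j, y0 + k')), forall x, G v.1 (x + 1) = G v.1 x.
    exact: (@near_pull0 _ _ (fun l => forall x, G l (x + 1) = G l x) l0 (x0 + j, y0 + k') Gper).
  by apply: filterS2 gp t => v Gv; rewrite !(periodic_int Gv) ?rpredN.
have near_swap2 (u w : R) : (\forall v \near (l0, (u, w)), Q v.1 -> G v.1 v.2.1 <> G v.1 v.2.2) ->
    \forall v \near (l0, (w, u)), Q v.1 -> G v.1 v.2.1 <> G v.1 v.2.2.
  move=> [[A B] [/= nA [[B1 B2] [/= nB1 nB2] B12]] AB].
  exists (A, B2 `*` B1); first by split=> //=; exists (B2, B1).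
  move=> [l [z z']] [/= Al [Bz Bz']] Ql e.
  by apply: (AB (l, (z', z))) => //; split=> //; exact: (B12 (_, _)).
move=> x y xy Kx Ky.
have shift (u v : R) : u = v + (u - v) by rewrite addrC subrK.
have [xx|xy0'] := H _ _ Kx0 Ky0 xy0 x Kx; have [yx|yy] := H _ _ Kx0 Ky0 xy0 y Ky.
- by case/negP: xy; exact: int_sub xx yx.
- by rewrite (shift x x0) (shift y y0); exact: sepT.
- by apply: near_swap2; rewrite (shift x y0) (shift y x0); exact: sepT.
- by case/negP: xy; exact: int_sub xy0' yy.
Qed.

End SeparatedTimes.

(** * Uniqueness of resolutions *)

Section Interpolation.
Context {R : realType} {M : oriented_3manifold R}.
Implicit Types (phi psi : chart R M).

Lemma sided_pull (L L' : topologicalType) (th : L' -> L) b phi (g : R -> M) (G : L -> R -> M)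
    (Q : L -> Prop) (l : L') x y : {for l, continuous th} ->
  sided b phi (fun=> g) G Q (th l) x y ->
  sided b phi (fun=> g) (fun l => G (th l)) (fun l => Q (th l)) l x y.
Proof.
move=> thc [[/= A1 A2] [[[/= A11 A12] [/= nA11 nA12] A112] nA2] A12'].
exists ((th @^-1` A11) `*` A12, A2); first split=> //=.
  by exists (th @^-1` A11, A12) => //=; split=> //; exact: thc _ nA11.
move=> [[l' z] u] [/= [Al Az] Au]; apply: (A12' ((th l', z), u)); split=> //=.
exact: (A112 (_, _)).
Qed.

(* Data for resolving K at i: its times x and y, and the set C of times where  *)
(* K may be moved inside the chart phi.                                        *)
Record site n (K : @sknot R M n.+1) (i : 'I_n.+1) phi (x y : R) (C : set R) : Prop := Site {
  site_atlas : atlas phi;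
  site_x : loop K x = vertex K i;
  site_y : loop K y = vertex K i;
  site_xy : y - x \isn't a Num.int;
  site_closed : closed C;
  site_per : forall z k, k \is a Num.int -> C (z + k) -> C z;
  site_dom : forall z, C z -> cdom phi (loop K z);
  site_vertex : cdom phi (vertex K i);
  site_retained : forall j z, loop K z = vertex K (fintype.lift i j) -> ~ C z
}.

(* A family of resolutions of K of sign b, for small e > 0. *)
Record germ n (K : @sknot R M n.+1) phi (x y : R) (C : set R) b (G : R -> R -> M) : Prop := Germ {
  germ0 : forall z, G 0 z = loop K z;
  germ_C1   : \forall e \near (0 : R), forall z, C1at G (e, z);
  germ_per   : \forall e \near (0 : R), forall x, G e (x + 1) = G e x;
  germ_off   : \forall e \near (0 : R), forall z, ~ C z -> G e z = loop K z;
  germ_sided : sided b phi (fun=> loop K) G (fun e => 0 < e) 0 x y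
}.

(** * Interpolation between two germs of resolutions *)

Section Combination.
Variables (n : nat) (K : @sknot R M n.+1) (i : 'I_n.+1) (phi : chart R M) (x y : R).
Variables (C : set R) (b : bool) (G G' : R -> R -> M).
Hypotheses (st : site K i phi x y C) (gG : germ K phi x y C b G) (gG' : germ K phi x y C b G').

(** A parameter l is a pair (s, e): s interpolates between the displacements of G and G' from K, and
    e is the height. The displacement is cut off outside C, where the chart may be meaningless. *)
Let comb (l : R * R) z := (1 - l.1) *: (cmap phi (G l.2 z) - cmap phi (loop K z)) +
  l.1 *: (cmap phi (G' l.2 z) - cmap phi (loop K z)).
Let eta (l : R * R) z := if `[< C z >] then comb l z else 0.
Let H (l : R * R) := pert phi (eta l) (loop K).
Let Q (l : R * R) := 0 <= l.1 <= 1 /\ 0 < l.2.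

Let Kper := pk_per ((periodic_knotP _ _).1 (sknotP K)).

Let openC z : ~ C z -> \forall z' \near z, ~ C z'.
Proof. by move=> Cz; apply: open_nbhs_nbhs; split=> //; exact: closed_openC (site_closed st). Qed.

Let csnd (l : R * R) : {for l, continuous (snd : R * R -> R)}.
Proof. exact: cvg_snd. Qed.

Let Good (l : R * R) : Prop :=
  [/\ forall z, C1at G (l.2, z), forall z, C1at G' (l.2, z),
      forall z, ~ C z -> G l.2 z = loop K z, forall z, ~ C z -> G' l.2 z = loop K z &
      forall z, C z -> [/\ cdom phi (G l.2 z), cdom phi (G' l.2 z) &
        (cmap phi @` cdom phi) (cmap phi (loop K z) + comb l z)]].

Let near_snd (P : R -> Prop) (s0 : R) : (\forall e \near (0 : R), P e) -> \forall l \near (s0, 0 : R), P l.2.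
Proof. by move=> nP; exact: (@near_pullr _ _ P s0 0 nP). Qed.

Let comb_C1 (l : R * R) z : C1at G (l.2, z) -> C1at G' (l.2, z) ->
  cdom phi (G l.2 z) -> cdom phi (G' l.2 z) -> cdom phi (loop K z) -> C1v comb (l, z).
Proof.
move=> CG CG' dG dG' dK.
have c1 : {for l, continuous (fun l : R * R => 1 - l.1)}.
  by apply: cvgB; [exact: cvg_cst|exact: cvg_fst].
have c2 : {for l, continuous (fun l : R * R => l.1)} by exact: cvg_fst.
have aphi := site_atlas st.
have cG := (C1at_pull (w := (l, z)) (@csnd l) CG).2 phi aphi dG.
have cG' := (C1at_pull (w := (l, z)) (@csnd l) CG').2 phi aphi dG'.
have cK := (C1at_knot K (l, z)).2 phi aphi dK.
exact: C1vD (C1vZ (w := (l, z)) c1 (C1vB cG cK)) (C1vZ (w := (l, z)) c2 (C1vB cG' cK)).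
Qed.

Let near_good (s0 : R) : \forall l \near (s0, 0 : R), Good l.
Proof.
have n1 := near_snd s0 (germ_C1 gG); have n2 := near_snd s0 (germ_C1 gG').
have n3 := near_snd s0 (germ_off gG); have n4 := near_snd s0 (germ_off gG').
have n5 : \forall l \near (s0, 0 : R), forall z, C z -> [/\ cdom phi (G l.2 z), cdom phi (G' l.2 z) &
        (cmap phi @` cdom phi) (cmap phi (loop K z) + comb l z)].
  apply: near_all_periodic.
    have m1 := near_snd s0 (germ_per gG); have m2 := near_snd s0 (germ_per gG').
    apply: filterS2 m1 m2 => l Gl Gl' z k ki P /(site_per st ki) /P.
    by rewrite /comb (periodic_int Gl)// (periodic_int Gl')// (periodic_int Kper).
  move=> z; have [Cz|nCz] := pselect (C z); last first.
    by have := @near_pullr _ _ _ (s0, 0 : R) z (openC nCz); apply: filterS => w nC /nC.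
  have dK := site_dom st Cz.
  have C1 := nbhs_singleton (germ_C1 gG) z; have C1' := nbhs_singleton (germ_C1 gG') z.
  have dG : cdom phi (G 0 z) by rewrite (germ0 gG).
  have dG' : cdom phi (G' 0 z) by rewrite (germ0 gG').
  have p1 := near_C1_cdom (C1at_pull (w := ((s0, 0 : R), z)) (@csnd (s0, 0)) C1).1 dG.
  have p2 := near_C1_cdom (C1at_pull (w := ((s0, 0 : R), z)) (@csnd (s0, 0)) C1').1 dG'.
  have [cc _ _] := @comb_C1 (s0, 0) z C1 C1' dG dG' dK.
  have [Kc _ _] := (C1at_knot K ((s0, 0 : R), z)).2 phi (site_atlas st) dK.
  have i0 : (cmap phi @` cdom phi) (cmap phi (loop K z) + comb (s0, 0) z).
    rewrite /comb/= (germ0 gG) (germ0 gG') subrr !scaler0 !addr0; exact: cmap_image.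
  have sc : {for ((s0, 0 : R), z), continuous (fun v : (R * R) * R => cmap phi (loop K v.2) + comb v.1 v.2)}.
    exact: cvgD Kc cc.
  have p3 : \forall v \near ((s0, 0 : R), z), (cmap phi @` cdom phi) (cmap phi (loop K v.2) + comb v.1 v.2).
    exact: sc _ (near_cimage i0).
  by near=> v => _; split; near: v.
by near=> l; split; near: l.
Unshelve. all: by end_near. Qed.

(** Outside C both germs equal K, so the cut-off changes no value; this is what makes [eta] regular
    at the boundary of C. *)
Let eta_comb l z : Good l -> eta l z = comb l z.
Proof.
move=> [_ _ off off' _]; rewrite /eta; case: asboolP => // nC.
by rewrite /comb off// off'// subrr !scaler0 addr0.
Qed.

Let good_image l z : Good l -> cdom phi (loop K z) ->
  (cmap phi @` cdom phi) (cmap phi (loop K z) + eta l z).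
Proof.
move=> gl dz; have [Cz|nC] := pselect (C z).
  by rewrite eta_comb//; have [_ _ _ _ /(_ _ Cz)[]] := gl.
by rewrite /eta; case: asboolP => // _; rewrite addr0; exact: cmap_image.
Qed.

Let near_H_C1 (s0 : R) : \forall l \near (s0, 0 : R), forall z, C1at H (l, z).
Proof.
have := near_join (near_good s0); apply: filterS => l gl z.
have [C1 C1' off off' gC] := nbhs_singleton gl.
have [Cz|nC] := pselect (C z).
  have [dG dG' iz] := gC z Cz.
  have dK := site_dom st Cz.
  apply: (C1at_pert (K := fun=> loop K)).
  - exact: site_atlas st.
  - exact: C1at_knot.
  - apply: C1v_near_eq (comb_C1 (C1 z) (C1' z) dG dG' dK).
    have := @near_pull0 _ _ Good l z gl; apply: filterS => v; exact: eta_comb.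
  - exact: dK.
  - by apply: good_image => //; exact: nbhs_singleton gl.
apply: (@C1at_pert0 _ _ _ (fun=> loop K)); last exact: C1at_knot.
have := @near_pullr _ _ _ l z (openC nC); apply: filterS => v nCv.
by rewrite /eta; case: asboolP.
Qed.

Let cmapH l z : Good l -> cdom phi (loop K z) ->
  cmap phi (H l z) = cmap phi (loop K z) + comb l z.
Proof. by move=> gl dz; rewrite -eta_comb//; have [] := pertP dz (good_image gl dz). Qed.

(** The gap of H is the convex combination of the two gaps, and the determinant is linear in the
    gap, so its sign is kept. *)
Let H_sided (s0 : R) : sided b phi (fun=> loop K) H Q (s0, 0) x y.
Proof.
have S := sided_pull (th := snd) (@csnd (s0, 0)) (germ_sided gG).
have S' := sided_pull (th := snd) (@csnd (s0, 0)) (germ_sided gG').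
have dx : cdom phi (loop K x) by rewrite (site_x st); exact: site_vertex st.
have dy : cdom phi (loop K y) by rewrite (site_y st); exact: site_vertex st.
have Kc := loop_continuous (sknotP K).
have nx : \forall z \near x, cdom phi (loop K z) := Kc x _ (near_cdom dx).
have ny : \forall z \near y, cdom phi (loop K z) := Kc y _ (near_cdom dy).
have n1 : \forall w \near ((s0, 0 : R), (x, y)), [/\ Good w.1, cdom phi (loop K w.2.1) & cdom phi (loop K w.2.2)].
  have a1 := @near_pull0 _ _ Good (s0, 0 : R) (x, y) (near_good s0).
  have a2 := @near_pullr _ _ (fun u : R * R => cdom phi (loop K u.1)) (s0, 0 : R) (x, y)
     (@near_pull0 _ _ (fun u : R => cdom phi (loop K u)) x y nx).
  have a3 := @near_pullr _ _ (fun u : R * R => cdom phi (loop K u.2)) (s0, 0 : R) (x, y)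
     (@near_pullr _ _ (fun u : R => cdom phi (loop K u)) x y ny).
  by near=> w; split; near: w.
have n2 := @near_pull0 _ _ (fun w : (R * R) * (R * R) => [/\ Good w.1, cdom phi (loop K w.2.1) & cdom phi (loop K w.2.2)])
  ((s0, 0 : R), (x, y)) (velocity phi (loop K) x, velocity phi (loop K) y) n1.
apply: filterS3 n2 S S' => -[[l [z z']] [u w]] /= [gl dz dz'] Sl Sl' [l01 l0].
have -> : gap phi (fun=> loop K) H l z z' =
    (1 - l.1) *: gap phi (fun=> loop K) (fun l => G l.2) l z z' +
    l.1 *: gap phi (fun=> loop K) (fun l => G' l.2) l z z'.
  rewrite /gap !cmapH// /comb; apply/rowP => k; rewrite !mxE; ring.
by rewrite det3D !det3Z; apply: signed_convex => //; [exact: Sl|exact: Sl'].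
Unshelve. all: by end_near. Qed.

Let near_H_knot (s0 : R) : \forall l \near (s0, 0 : R), Q l ->
  is_singular_knot (H l) (vertex K \o fintype.lift i).
Proof.
have etaper l : Good l -> (forall x, G l.2 (x + 1) = G l.2 x) -> (forall x, G' l.2 (x + 1) = G' l.2 x) ->
    forall x, H l (x + 1) = H l x.
  move=> gl Gl Gl' z; rewrite /H /pert !eta_comb//.
  by rewrite /comb Gl Gl' !Kper.
have Hper : \forall l \near (s0, 0 : R), forall x, H l (x + 1) = H l x.
  have m1 := near_snd s0 (germ_per gG); have m2 := near_snd s0 (germ_per gG').
  by apply: filterS3 (near_good s0) m1 m2 => l; exact: etaper.
apply: (@near_resolved_knot R M _ (s0, 0 : R) n.+1 n (fintype.lift i) (fun=> K) H C Q).
- exact: lift_inj.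
- by move=> z; exact: C1at_knot.
- by move=> j; exact: cvg_cst.
- exact: near_H_C1.
- exact: Hper.
- move=> z; rewrite /H pert0// /eta; case: asboolP => // _.
  by rewrite /comb /= (germ0 gG) (germ0 gG') subrr !scaler0 addr0.
- exact: site_closed st.
- exact: (site_per st).
- by apply: filterE => l z nC; rewrite /H pert0// /eta; case: asboolP.
- exact: (site_retained st).
- move=> k nk; have -> : k = i.
    by case: (unliftP i k) => // j kj; case: (nk j).
  apply: (separated_times Hper (site_x st) (site_y st) (site_xy st)).
  have dx : cdom phi (loop K x) by rewrite (site_x st); exact: site_vertex st.
  apply: (sided_separated (site_atlas st) (C1at_knot K _) (C1at_knot K _) dx _ _ (H_sided s0)).
    by rewrite (site_x st) (site_y st).
  move=> A B nA nB; apply: filterE => l; exists x, y; split; try exact: nbhs_singleton.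
  by rewrite (site_x st) (site_y st).
Qed.

Lemma near_interpolate : \forall e \near (0 : R), 0 < e ->
  [/\ forall s, 0 <= s <= 1 -> is_singular_knot (H (s, e)) (vertex K \o fintype.lift i),
      forall s z, 0 <= s <= 1 -> C1at (fun s => H (s, e)) (s, z),
      H (0, e) =1 G e & H (1, e) =1 G' e].
Proof.
pose P e s := Good (s, e) /\ (forall z, C1at H ((s, e), z)) /\
   (Q (s, e) -> is_singular_knot (H (s, e)) (vertex K \o fintype.lift i)).
have cpt : compact `[0 : R, 1]%classic by exact: segment_compact.
have U : \forall e \near (0 : R), `[0 : R, 1]%classic `<=` P e.
  apply: ((compact_near_coveringP _).1 cpt R (nbhs (0 : R)) P) => s _.
  by apply: filterS3 (near_good s) (near_H_C1 s) (near_H_knot s) => -[s' e'].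
apply: filterS U => e U e0.
have {}U s : 0 <= s <= 1 -> P e s by move=> s01; apply: U; rewrite /= in_itv/=.
split.
- by move=> s s01; have [_ [_ Hs]] := U s s01; apply: Hs.
- move=> s z s01; have [_ [Hs _]] := U s s01.
  have c : {for s, continuous (fun s : R => (s, e))}.
    by apply: (@cvg_pair _ _ _ _ (nbhs s) (nbhs e)); [exact: cvg_id|exact: cvg_cst].
  exact: (C1at_pull (w := (s, z)) c (Hs z)).
- move=> z; have z01 : 0 <= (0 : R) <= 1 by rewrite lexx ler01.
  have [g0 _] := U 0 z01; have [_ _ off _ gC] := g0.
  have [Cz|nC] := pselect (C z); last by rewrite /H pert0 ?off// /eta; case: asboolP.
  have [dG _ _] := gC _ Cz; have dK := site_dom st Cz.
  rewrite /H pert_cinv// eta_comb// /comb subr0 scale1r scale0r addr0.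
  by rewrite addrC subrK cmapK.
- move=> z; have z01 : 0 <= (1 : R) <= 1 by rewrite lexx ler01.
  have [g0 _] := U 1 z01; have [_ _ _ off gC] := g0.
  have [Cz|nC] := pselect (C z); last by rewrite /H pert0 ?off// /eta; case: asboolP.
  have [_ dG _] := gC _ Cz; have dK := site_dom st Cz.
  rewrite /H pert_cinv// eta_comb// /comb subrr scale1r scale0r add0r.
  by rewrite addrC subrK cmapK.
Qed.

Lemma H_off l z : ~ C z -> H l z = loop K z.
Proof. by move=> nC; rewrite /H pert0// /eta; case: asboolP. Qed.

End Combination.

Lemma interpolate (P : @structure R M) n (K : knot P n.+1) i phi x y C b G G' :
  hereditary P -> site K i phi x y C -> germ K phi x y C b G -> germ K phi x y C b G' ->
  \forall e \near (0 : R), 0 < e -> forall K0 K1 : knot P n,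
    loop K0 =1 G e -> vertex K0 =1 vertex K \o fintype.lift i ->
    loop K1 =1 G' e -> vertex K1 =1 vertex K \o fintype.lift i -> isotopic K0 K1.
Proof.
move=> hP st gG gG'; have := near_interpolate st gG gG'; apply: filterS => e He e0.
have [Hk HC H0 H1] := He e0.
move=> K0 K1 g0 v0 g1 v1.
set H := (fun s => pert _ _ _) in Hk HC H0 H1.
apply: (@isotopic_family R M P n H (fun=> vertex K \o fintype.lift i)) => //.
- move=> s s01; have PK : P n (SKnot (Hk s s01)).
    apply: (hP n (underlying K) i) => //; first exact: knotP.
    move=> j z /= Kz.
    have := @H_off _ K phi C G G' (s, e) z (site_retained st Kz).
    by rewrite -Kz.
  by exists (Knot PK).
- by move=> t j _; exact: cvg_cst.
- by move=> z; rewrite g0; exact/esym/H0.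
- by move=> z; rewrite g1; exact/esym/H1.
Qed.

End Interpolation.

Lemma bump_support_mem (R : realType) (x r z : R) : 0 < r < 2^-1 -> `|z - x| <= r ->
  bump_support x r z.
Proof.
move=> r0 zr; rewrite /bump_support/= /angle -[cos (2 * pi * (z - x))]cos_norm.
have pi0 := pi_gt0 R; have z0 := normr_ge0 (z - x).
rewrite !normrM !(ger0_norm (x := 2)) ?(ger0_norm (x := pi))//; try lra.
rewrite leNgt ltr_cos ?in_itv/=; [|nra|nra].
by rewrite -leNgt ler_pM2l// mulr_gt0.
Qed.

(** * Germs of small displacements *)

Section Germs.
Context {R : realType} {M : oriented_3manifold R}.
Implicit Types (phi psi : chart R M).

Section SmallRadius.
Variables (n : nat) (K : @sknot R M n.+1) (i : 'I_n.+1).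

Definition small_radius phi (x r : R) : Prop := 0 < r < 2^-1 /\
  forall z, bump_support x r z -> [/\ cdom phi (loop K z),
    forall j, loop K z <> vertex K (fintype.lift i j) &
    loop K z = vertex K i -> z - x \is a Num.int].

(** Other vertices are avoided near x by the Hausdorff property, and the vertex k is not met again
    near x by local injectivity. *)
Lemma near_other_times (m : nat) (N : @sknot R M m) (k : 'I_m) x : loop N x = vertex N k ->
  \forall z \near x, (forall j, j <> k -> loop N z <> vertex N j) /\
    (loop N z = vertex N k -> z = x).
Proof.
move=> Nx; have Nc := loop_continuous (sknotP N).
have n1 : \forall z \near x, forall j, j <> k -> loop N z <> vertex N j.
  apply: near_forall => j; have [jk|jk] := pselect (j = k); first by apply: filterE => z /(_ jk).
  have ne : loop N x <> vertex N j.
    by rewrite Nx => /(vertex_injective (sknotP N)) /esym.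
  have cc : {for x, continuous (fun=> vertex N j : M)} by exact: cvg_cst.
  by have := near_neq (mhausdorff (o := M)) (Nc x) cc ne; apply: filterS => z.
have imm : immersed (loop N) x.
  by move=> phi aphi dx; exact: pk_imm ((periodic_knotP _ _).1 (sknotP N)) _ _ aphi dx.
have [[A [B1 B2]] [/= nA [nB1 nB2]] H] : exists2 ABB : set R * (set R * set R),
   nbhs (0 : R) ABB.1 /\ (nbhs x ABB.2.1 /\ nbhs x ABB.2.2) &
   forall l z z', ABB.1 l -> ABB.2.1 z -> ABB.2.2 z' -> loop N z = loop N z' -> z = z'.
  have [[A B] [/= nA [[B1 B2] [/= nB1 nB2] B12]] AB] := near_injective (C1at_knot N (0 : R, x)) imm.
  exists (A, (B1, B2)) => //= l z z' Al Bz Bz'; apply: (AB (l, (z, z'))); split=> //=.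
  exact: (B12 (_, _)).
apply: filterS2 n1 nB1 => z Hz Bz; split=> // Nz.
by apply: (H 0) => //; [exact: nbhs_singleton|exact: nbhs_singleton|rewrite Nz Nx].
Qed.

Lemma exists_small_radius phi x : loop K x = vertex K i -> cdom phi (vertex K i) ->
  exists2 r0 : R, 0 < r0 & forall r, 0 < r <= r0 -> small_radius phi x r.
Proof.
move=> Kx dv; have Kc := loop_continuous (sknotP K).
have nd : \forall z \near x, cdom phi (loop K z).
  by apply: Kc; apply: near_cdom; rewrite Kx.
have : \forall z \near x, cdom phi (loop K z) /\
   ((forall j, j <> i -> loop K z <> vertex K j) /\ (loop K z = vertex K i -> z = x)).
  exact: filterI nd (near_other_times Kx).
move=> /nbhs_ballP[r1 r10 rP]; have {}r10 : 0 < r1 by [].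
exists (Num.min (r1 / 2) 4^-1); first by rewrite lt_min; apply/andP; split; lra.
move=> r /andP[r0]; rewrite le_min => /andP[rr1 r4].
have r2 : 0 < r < 2^-1 by lra.
split=> // z /(bump_supportP r2)[k ki zk].
have Kk : loop K (z - k) = loop K z.
  by rewrite (periodic_int (pk_per ((periodic_knotP _ _).1 (sknotP K))))// rpredN.
have [|dz [H1 H2]] := rP (z - k).
  rewrite -ball_normE/= -normrN opprB (_ : z - k - x = z - x - k); last by ring.
  by lra.
rewrite Kk in dz H1 H2; split=> //.
- by move=> j; apply: H1 => /eqP; rewrite eq_sym (negbTE (neq_lift _ _)).
- by move=> /H2 <-; rewrite opprB addrC subrK.
Qed.

End SmallRadius.

Lemma pert_germ n (K : @sknot R M n.+1) i phi psi x y C b (eta : R -> 'rV[R]_3) :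
  site K i phi x y C -> atlas psi -> (forall z, C z -> cdom psi (loop K z)) ->
  cdom psi (vertex K i) ->
  (forall w : R * R, C1v (fun _ => eta) w) -> (forall z, eta (z + 1) = eta z) ->
  (forall z, eta z != 0 -> C z) -> (\forall z \near y, eta z = 0) ->
  signed b (det3 (velocity psi (loop K) x) (velocity psi (loop K) y) (eta x)) ->
  germ K phi x y C b (fun e => pert psi (fun z => e *: eta z) (loop K)).
Proof.
move=> st apsi Cdom dv eC eper eS ey sg.
have Kper := pk_per ((periodic_knotP _ _).1 (sknotP K)).
have n1 : \forall e \near (0 : R), {for e, continuous (id : R -> R)}.
  by apply: filterE => e; exact: cvg_id.
have n2 : \forall e \near (0 : R), forall z, C1at (fun _ : R => loop K) (e, z).
  by apply: filterE => e z; exact: C1at_knot.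
have n3 : \forall e \near (0 : R), forall x, loop K (x + 1) = loop K x by exact: filterE.
split.
- by move=> z; rewrite pert0// scale0r.
- have := near_pert_C1 apsi n2 n3 n1 erefl eC eper eS (site_closed st) (site_per st) Cdom.
  by apply: filterS => e [].
- by apply: filterE => e z; rewrite /pert eper Kper.
- by apply: filterE => e z nC; rewrite pert0//; have [->|/eS//] := eqVneq (eta z) 0; rewrite scaler0.
- have ec : {for x, continuous eta}.
    have [c _ _] := eC (0, x).
    have xc : {for x, continuous (fun z : R => (0 : R, z))}.
      by apply: (@cvg_pair _ _ _ _ (nbhs (0 : R)) (nbhs x)); [exact: cvg_cst|exact: cvg_id].
    exact: (@continuous_comp _ _ _ _ (fun v : R * R => eta v.2) x xc c).
  apply: (sided_pert (site_atlas st) apsi (C1at_knot K _) (C1at_knot K _) _ _ _ _ _ ec ey sg).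
  + by rewrite (site_x st) (site_y st).
  + by rewrite (site_x st); exact: site_vertex st.
  + by rewrite (site_x st).
  + exact: cvg_id.
  + by [].
Qed.

Lemma site_sym n (K : @sknot R M n.+1) i phi x y C : site K i phi x y C -> site K i phi y x C.
Proof.
move=> [? Kx Ky xy ? ? ? ? ?]; split=> //.
by rewrite -opprB rpredN.
Qed.

Lemma germ_sym n (K : @sknot R M n.+1) phi x y C b G :
  germ K phi x y C b G -> germ K phi y x C b G.
Proof.
move=> [g0 gC gper goff s]; split; [exact: g0|exact: gC|exact: gper|exact: goff|].
exact: sided_sym s.
Qed.

(** Interpolating G with itself exhibits [G e] as a singular knot. *)
Lemma near_germ_knot (P : @structure R M) n (K : knot P n.+1) i phi x y C b G :
  hereditary P -> site K i phi x y C -> germ K phi x y C b G ->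
  \forall e \near (0 : R), 0 < e -> exists N : knot P n,
    loop N =1 G e /\ vertex N =1 vertex K \o fintype.lift i.
Proof.
move=> hP st gG.
apply: filterS2 (near_interpolate st gG gG) (germ_off gG) => e He off e0.
have [Hk _ H0 _] := He e0.
have Ks : is_singular_knot (G e) (vertex K \o fintype.lift i).
  have -> : G e = _ := esym (funext H0).
  by apply: Hk; rewrite lexx ler01.
have PK : P n (SKnot Ks).
  apply: (hP n (underlying K) i) => //; first exact: knotP.
  by move=> j z /= Kz; rewrite off//; exact: (site_retained st Kz).
by exists (Knot PK).
Qed.

End Germs.

(** * Arbitrary pushes as germs *)

Section Pushes.
Context {R : realType} {M : oriented_3manifold R}.
Variables (b : bool) (n : nat) (i : 'I_n.+1) (K : @sknot R M n.+1) (D : push b i K).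

Let phi := push_chart D.
Let a := push_a D.
Let c := push_c D.
Let x := push_x D.
Let y := push_y D.
Let Kper := pk_per ((periodic_knotP _ _).1 (sknotP K)).

(** The displacement at the end of the push. The test makes it 0 wherever the loop is unmoved,
    including times at which the loop lies outside the chart. *)
Definition push_displacement (z : R) : 'rV[R]_3 :=
  if pushed D 1 z == loop K z then 0
  else cmap (push_chart D) (pushed D 1 z) - cmap (push_chart D) (loop K z).

(** The arc from [push_a] to [push_c] modulo 1, described by its midpoint and half its length. *)
Definition push_support : set R :=
  bump_support ((push_a D + push_c D) / 2) ((push_c D - push_a D) / 2).

Let t01 : 0 < (1 : R) <= 1. Proof. by rewrite ltr01 lexx. Qed.

Let pushed_per t : 0 < t <= 1 -> forall z k, k \is a Num.int -> pushed D t (z + k) = pushed D t z.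
Proof. by move=> ht z k ki; rewrite (periodic_int (loop_periodic (pushed_knot D ht))). Qed.

Let radius : 0 < (c - a) / 2 < 2^-1.
Proof. by have := push_arc D; have := push_arc_short D; rewrite -/a -/c -/x; lra. Qed.

Lemma push_supportP z : push_support z -> exists2 k, k \is a Num.int & a <= z + k <= c.
Proof.
move=> /(bump_supportP radius)[k ki]; rewrite ler_norml => zk.
by exists (- k); [rewrite rpredN|move: zk; rewrite -/a -/c; lra].
Qed.

Lemma push_support_arc z k : k \is a Num.int -> a <= z + k <= c -> push_support z.
Proof.
move=> ki zk; apply: (bump_support_int ki).
by apply: bump_support_mem radius _; rewrite -/a -/c ler_norml; lra.
Qed.

Lemma arc_shift z : exists2 k, k \is a Num.int & a <= z + k < a + 1.
Proof.
have [k ki zk] := int_shift_unit (z - a); exists k => //.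
by lra.
Qed.

Lemma pushed_off t z : 0 < t <= 1 -> ~ push_support z -> pushed D t z = loop K z.
Proof.
move=> ht nz; have [k ki zk] := arc_shift z.
rewrite -(pushed_per ht z ki) -(periodic_int Kper z ki).
apply: pushed_off_arc => //; rewrite -/a -/c; have [zc|cz] := leP (z + k) c; last by lra.
by case: nz; apply: (push_support_arc ki); lra.
Qed.

Lemma pushed_on t z : 0 < t <= 1 -> push_support z ->
  [/\ cdom phi (loop K z), cdom phi (pushed D t z) &
   cmap phi (pushed D t z) = cmap phi (loop K z) + t *: push_displacement z].
Proof.
move=> t01' /push_supportP[k ki zk].
have dK := push_arc_dom (p := D) zk; rewrite (periodic_int Kper)// in dK.
have [d1 e1] := pushed_arc (p := D) t01 zk; have [dt et] := pushed_arc (p := D) t01' zk.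
rewrite !pushed_per// !(periodic_int Kper)// in d1 e1 dt et.
split=> //; rewrite et /push_displacement; case: eqP => [E|_]; last first.
  by rewrite e1 addrAC subrr add0r mul1r scalerA.
(* A point fixed at t = 1 has [push_height z *: push_dir = 0], hence is fixed for all t. *)
move: e1; rewrite E => /eqP; rewrite -subr_eq0 opprD addrA subrr sub0r oppr_eq0 mul1r => /eqP h0.
by rewrite -scalerA h0.
Qed.

Lemma push_displacement_neq0 z : push_displacement z != 0 -> push_support z.
Proof.
move=> nz; apply: contrapT => /(pushed_off t01) e.
by move: nz; rewrite /push_displacement e !eqxx.
Qed.

Lemma pushed_pert t z : 0 < t <= 1 ->
  pushed D t z = pert phi (fun z => t *: push_displacement z) (loop K) z.
Proof.
move=> t01'; have [Cz|nC] := pselect (push_support z).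
  have [dK dt e] := pushed_on t01' Cz.
  by rewrite pert_cinv// -e cmapK.
rewrite pushed_off// pert0//; have [->|/push_displacement_neq0//] := eqVneq (push_displacement z) 0.
by rewrite scaler0.
Qed.

Lemma push_displacement_per z : push_displacement (z + 1) = push_displacement z.
Proof. by rewrite /push_displacement !pushed_per ?rpred1// Kper. Qed.

(** On the support the displacement is the difference, in the chart, of the C^1 loops [pushed D 1]
    and K, so it is C^1; off the closed support it vanishes locally. *)
Lemma C1v_push_displacement (L : topologicalType) (w : L * R) :
  C1v (fun _ => push_displacement) w.
Proof.
pose N := SKnot (pushed_knot D t01).
have [Cz|nC] := pselect (push_support w.2).
  have [dK dN _] := pushed_on t01 Cz.
  have cK := (C1at_knot K w).2 phi (push_atlas D) dK.
  have cN := (C1at_knot N w).2 phi (push_atlas D) dN.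
  apply: C1v_near_eq (C1vB cN cK); apply: filterE => v /=.
  by rewrite /push_displacement; case: eqP => // ->; rewrite subrr.
have c0 : C1v (fun _ _ => 0 : 'rV[R]_3) w.
  split.
  - exact: cvg_cst.
  - by apply: filterE => v; exact: derivable_cst.
  - rewrite (_ : (fun v => _) = (fun=> 0)); first exact: cvg_cst.
    by apply/funext => v; rewrite derive1_cst.
have nC' : \forall z \near w.2, ~ push_support z.
  by apply: open_nbhs_nbhs; split=> //; exact/closed_openC/closed_bump_support.
apply: C1v_near_eq c0; case: w nC nC' => l z nC nC'.
have := @near_pullr _ _ _ l z nC'; apply: filterS => v nCv.
by rewrite /push_displacement pushed_off// eqxx.
Qed.

Lemma push_vertex_arc z : push_support z -> loop K z = vertex K i -> z - x \is a Num.int.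
Proof.
move=> /push_supportP[k ki zk] Kz.
have := push_arc_vertex (p := D) (z := z + k) (j := i) zk; rewrite (periodic_int Kper)//.
by move=> /(_ Kz); rewrite -/x => <-; rewrite opprD addrA subrr add0r rpredN.
Qed.

Lemma push_x_not_y : y - x \isn't a Num.int.
Proof.
apply/negP => /intrP[k yx]; apply: (push_xy (p := D) (k := k)).
by rewrite -/x -/y -yx addrC subrK.
Qed.

Lemma push_vertex_dom : cdom phi (vertex K i).
Proof.
rewrite -(push_xP D); apply: (push_arc_dom (p := D)).
by have := push_arc D; lra.
Qed.

Lemma push_site : site K i phi x y push_support.
Proof.
split.
- exact: push_atlas.
- exact: push_xP.
- exact: push_yP.
- exact: push_x_not_y.
- exact: closed_bump_support.
- by move=> z k; exact: bump_support_int.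
- by move=> z /(pushed_on t01)[].
- exact: push_vertex_dom.
- move=> j z Kz /push_supportP[k ki zk].
  have := push_arc_vertex (p := D) (z := z + k) (j := fintype.lift i j) zk.
  rewrite (periodic_int Kper)// => /(_ Kz) zx.
  have := push_xP D; rewrite -zx (periodic_int Kper)// Kz.
  by move/(vertex_injective (sknotP K))/eqP; rewrite eq_sym (negbTE (neq_lift _ _)).
Qed.

Lemma push_displacement_x : push_displacement x = push_height D x *: push_dir D.
Proof.
have xac : a <= x <= c by have := push_arc D; rewrite -/a -/c -/x; lra.
have Cx : push_support x by apply: (@push_support_arc x 0); rewrite ?rpred0 ?addr0.
have [dK d1 e1] := pushed_on t01 Cx; have [_ e2] := pushed_arc (p := D) t01 xac.
by move: e2; rewrite -/phi e1 scale1r mul1r => /addrI.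
Qed.

Lemma push_germ :
  germ K phi x y push_support b (fun e => pert phi (fun z => e *: push_displacement z) (loop K)).
Proof.
have st := push_site.
apply: (pert_germ st).
- exact: push_atlas.
- exact: site_dom st.
- exact: push_vertex_dom.
- exact: C1v_push_displacement.
- exact: push_displacement_per.
- exact: push_displacement_neq0.
- have nCy : ~ push_support y.
    by move=> Cy; case/negP: push_x_not_y; apply: push_vertex_arc => //; exact: push_yP.
  have nC' : \forall z \near y, ~ push_support z.
    by apply: open_nbhs_nbhs; split=> //; exact/closed_openC/closed_bump_support.
  by apply: filterS nC' => z nC; rewrite /push_displacement pushed_off// eqxx.
- by rewrite push_displacement_x det3Z; apply: signedZ; [exact: push_height_gt0|exact: push_sign].
Qed.

(** Undoing the push from t = 1 down to t = e is an isotopy: [s] runs from 1 to e inside (0, 1],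
    where [pushed_knot] provides singular knots. *)
Lemma push_shrink (P : @structure R M) (K0 Ke : knot P n) e : hereditary P -> P _ K ->
  0 < e <= 1 -> loop K0 =1 pushed D 1 -> vertex K0 =1 vertex K \o fintype.lift i ->
  loop Ke =1 pushed D e -> vertex Ke =1 vertex K \o fintype.lift i -> isotopic K0 Ke.
Proof.
move=> hP PK e01 l0 v0 l1 v1.
pose s (t : R) := 1 - t * (1 - e).
have s01 t : 0 <= t <= 1 -> 0 < s t <= 1.
  by rewrite /s => t01'; apply/andP; split; nra.
apply: (@isotopic_family R M P n (fun t => pert phi (fun z => s t *: push_displacement z) (loop K))
  (fun=> vertex K \o fintype.lift i)).
- move=> t /s01 st.
  pose N := SKnot (pushed_knot D st).
  have PN : P n N.
    apply: (hP n K i) => // j z /= Kz.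
    by rewrite pushed_off//; exact: (site_retained push_site Kz).
  exists (Knot PN); split=> // z /=; exact: pushed_pert.
- move=> t z /s01 st.
  have sc : {for t, continuous s}.
    apply: cvgB; first exact: cvg_cst.
    by apply: cvgM; [exact: cvg_id|exact: cvg_cst].
  have [Cz|nC] := pselect (push_support z).
    have [dK dt et] := pushed_on st Cz.
    apply: (C1at_pert (K := fun _ : R => loop K) (eta := fun t z => s t *: push_displacement z)).
    + exact: push_atlas.
    + exact: C1at_knot.
    + exact: (C1vZ (w := (t, z)) sc (C1v_push_displacement _)).
    + exact: dK.
    + by rewrite /= -et; exact: cmap_image.
  apply: (@C1at_pert0 _ _ R (fun=> loop K) (fun t z => s t *: push_displacement z)); last exact: C1at_knot.
  have nC' : \forall z \near z, ~ push_support z.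
    by apply: open_nbhs_nbhs; split=> //; exact/closed_openC/closed_bump_support.
  have := @near_pullr _ _ _ t z nC'; apply: filterS => v nCv.
  by rewrite /push_displacement pushed_off// eqxx scaler0.
- by move=> t j _; exact: cvg_cst.
- by move=> z; rewrite l0 pushed_pert// /s mul0r subr0.
- exact: v0.
- move=> z; rewrite l1 pushed_pert// /s.
  by have -> : 1 - 1 * (1 - e) = e by ring.
- exact: v1.
Qed.

End Pushes.

Lemma near0_pos (R : realType) (P : R -> Prop) : (\forall e \near (0 : R), P e) ->
  exists2 e, 0 < e <= 1 & P e.
Proof.
move=> /nbhs_ballP[r /= r0 rP]; exists (Num.min (r / 2) 1).
  by rewrite lt_min ge_min lexx orbT andbT ltr01 andbT divr_gt0.
apply: rP; rewrite -ball_normE/= sub0r normrN ger0_norm; last first.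
  by rewrite le_min ler01 andbT divr_ge0// ltW.
by rewrite gt_min; apply/orP; left; lra.
Qed.

Lemma bump_neq0_lt (R : realType) (x r z : R) : 0 < r < 2^-1 -> bump x r z != 0 ->
  exists2 k, k \is a Num.int & `|z - x - k| < r.
Proof.
move=> r0 bz; have [k ki zk] := bump_supportP r0 (bump_neq0 bz).
exists k => //; rewrite lt_neqAle zk andbT; apply: contra bz => /eqP zr.
rewrite /bump -(@cos_angle_int _ x z (- k)) ?rpredN// /angle.
have -> : 2 * pi * (z - k - x) = 2 * pi * (z - x - k) by ring.
have pi0 := pi_gt0 R.
have -> : cos (2 * pi * (z - x - k)) = cos (2 * pi * r).
  rewrite -[LHS]cos_norm !normrM zr !ger0_norm//; first by rewrite ltW.
by rewrite subrr /pos_sqr maxxx expr0n.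
Qed.

Lemma bump_gt0_near (R : realType) (m r x : R) : 0 < r < 2^-1 -> `|x - m| < r ->
  0 < bump m r x.
Proof.
move=> r0 xm; rewrite /bump /angle -[cos (2 * pi * (x - m))]cos_norm.
have pi0 := pi_gt0 R; have z0 := normr_ge0 (x - m).
have c : cos (2 * pi * r) < cos `|2 * pi * (x - m)|.
  rewrite !normrM !(ger0_norm (x := 2)) ?(ger0_norm (x := pi))//; try lra.
  by rewrite ltr_cos ?in_itv/= ?ltr_pM2l ?mulr_gt0//; nra.
by rewrite exprn_gt0// lt_max; apply/orP; right; lra.
Qed.

Lemma bump_off (R : realType) (x r z : R) : 0 < r < 2^-1 -> x + r <= z <= x - r + 1 ->
  bump x r z = 0.
Proof.
move=> r0 zr; apply/eqP; apply: contraT => /(bump_neq0_lt r0)[k /intrP[m ->]].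
rewrite ltr_norml => zk; have [m0|m1] : m <= 0 \/ 1 <= m by lia.
- have m0' : m%:~R <= (0 : R) by rewrite lerz0.
  lra.
- have m1' : 1 <= m%:~R :> R by rewrite ler1z.
  lra.
Qed.

(** * Comparison of two pushes through bumps *)

Section Uniqueness.
Context {R : realType} {M : oriented_3manifold R}.
Implicit Types (phi psi : chart R M).

Definition bump_push psi (x r : R) (d : 'rV[R]_3) (g : R -> M) (e : R) : R -> M :=
  pert psi (fun z => e *: (bump x r z *: d)) g.

Lemma germ_mono n (K : @sknot R M n.+1) phi x y (C C' : set R) b G :
  C `<=` C' -> germ K phi x y C b G -> germ K phi x y C' b G.
Proof.
move=> CC' [g0 gC gper goff s]; split; [exact: g0|exact: gC|exact: gper| |exact: s].
by apply: filterS goff => e He z nC; apply: He => /CC'.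
Qed.

Lemma site_bump n (K : @sknot R M n.+1) i phi x y r :
  atlas phi -> loop K x = vertex K i -> loop K y = vertex K i -> y - x \isn't a Num.int ->
  cdom phi (vertex K i) -> small_radius K i phi x r -> site K i phi x y (bump_support x r).
Proof.
move=> aphi Kx Ky xy dv [r0 sr]; split=> //.
- exact: closed_bump_support.
- by move=> z k; exact: bump_support_int.
- by move=> z /sr[].
- by move=> j z Kz /sr[_ /(_ j)].
Qed.

Lemma site_setU n (K : @sknot R M n.+1) i phi x y C C' :
  site K i phi x y C -> site K i phi x y C' -> site K i phi x y (C `|` C').
Proof.
move=> s s'; split; try by case: s.
- exact: closedU (site_closed s) (site_closed s').
- by move=> z k ki [/(site_per s ki)|/(site_per s' ki)]; [left|right].
- by move=> z [/(site_dom s)|/(site_dom s')].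
- by move=> j z Kz [/(site_retained s Kz)|/(site_retained s' Kz)].
Qed.

(** The centre [x'] only has to agree with x modulo 1, and C may exceed the support of the bump, so
    that two bumps can share one site. *)
Lemma bump_germ n (K : @sknot R M n.+1) i phi psi x y x' C b r d :
  site K i phi x y C -> atlas psi -> (forall z, C z -> cdom psi (loop K z)) ->
  cdom psi (vertex K i) -> x - x' \is a Num.int -> bump_support x' r `<=` C ->
  0 < r < 2^-1 -> ~ bump_support x' r y ->
  signed b (det3 (velocity psi (loop K) x) (velocity psi (loop K) y) d) ->
  germ K phi x y C b (bump_push psi x' r d (loop K)).
Proof.
move=> st apsi Cdom dv xx' CC r0 ny sg.
apply: (pert_germ (eta := fun z => bump x' r z *: d) st apsi Cdom dv).
- by move=> w; exact: C1v_bump.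
- by move=> z; rewrite bump_periodic// rpred1.
- move=> z; rewrite scaler_eq0 negb_or => /andP[bz _]; exact/CC/bump_neq0.
- have nC' : \forall z \near y, ~ bump_support x' r z.
    by apply: open_nbhs_nbhs; split=> //; exact/closed_openC/closed_bump_support.
  apply: filterS nC' => z nz; have [->|/bump_neq0//] := eqVneq (bump x' r z) 0.
  by rewrite scale0r.
- rewrite det3Z; apply: signedZ => //.
  have -> : x = x' + (x - x') by rewrite addrC subrK.
  by rewrite bump_periodic//; exact: bump_gt0.
Qed.

Lemma common_radius n (K : @sknot R M n.+1) i (phis : seq (chart R M)) (xs : seq R) :
  (forall phi, List.In phi phis -> cdom phi (vertex K i)) ->
  (forall x, List.In x xs -> loop K x = vertex K i) ->
  exists2 r0 : R, 0 < r0 & forall r, 0 < r <= r0 -> forall phi x,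
    List.In phi phis -> List.In x xs -> small_radius K i phi x r.
Proof.
move=> dv Kx.
suff [r0 r00 H] : exists2 r0 : R, 0 < r0 & forall r, 0 < r <= r0 -> forall p,
    List.In p (List.list_prod phis xs) -> small_radius K i p.1 p.2 r.
  by exists r0 => // r rr phi x iphi ix; apply: (H r rr (phi, x)); apply/List.in_prod_iff.
have : forall p, List.In p (List.list_prod phis xs) ->
    cdom p.1 (vertex K i) /\ loop K p.2 = vertex K i.
  by move=> [phi x] /List.in_prod_iff[/dv ? /Kx].
elim: (List.list_prod phis xs) => [|p ps IH] H; first by exists 1.
have [q qps|r1 r10 H1] := IH; first by apply: H; right.
have [dp Kp] := H p (or_introl erefl).
have [r2 r20 H2] := exists_small_radius Kp dp.
exists (Num.min r1 r2); first by rewrite lt_min r10.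
move=> r; rewrite le_min => /andP[r0 /andP[rr1 rr2]] q [<-|qps].
  by apply: H2; rewrite r0.
by apply: H1 => //; rewrite r0.
Qed.

Lemma times_dichotomy n (K : @sknot R M n) k (x y x' y' : R) :
  loop K x = vertex K k -> loop K y = vertex K k -> y - x \isn't a Num.int ->
  loop K x' = vertex K k -> loop K y' = vertex K k -> y' - x' \isn't a Num.int ->
  (x - x' \is a Num.int /\ y - y' \is a Num.int) \/
  (y - x' \is a Num.int /\ x - y' \is a Num.int).
Proof.
move=> Kx Ky xy Kx' Ky' xy'.
have [a [b [ab Ka Kb Kz]]] := pk_dbl ((periodic_knotP _ _).1 (sknotP K)) k.
case: (Kz _ Kx) => [xa|xa]; case: (Kz _ Ky) => [ya|ya]; case: (Kz _ Kx') => [xa'|xa'];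
 case: (Kz _ Ky') => [ya'|ya'];
 try (by case/negP: xy; exact: int_sub xa ya); try (by case/negP: xy'; exact: int_sub xa' ya');
 first [by left; split; [exact: int_sub xa' xa|exact: int_sub ya' ya]
       |by right; split; [exact: int_sub xa' ya|exact: int_sub ya' xa]].
Qed.

(** The isotopy runs from K0 to a low push along D, to a low bump at x, to a low bump at [x'], to a
    low push along D', and to K1. Chart, arc and possibly strand change in the middle step only. *)
Lemma resolves_unique (P : @structure R M) b n (i : 'I_n.+1) (K : knot P n.+1) (K0 K1 : knot P n) :
  hereditary P -> resolves b i K K0 -> resolves b i K K1 -> isotopic K0 K1.
Proof.
move=> hP [D [l0 v0]] [D' [l1 v1]].
pose phi := push_chart D; pose phi' := push_chart D'.
pose x := push_x D; pose y := push_y D; pose x' := push_x D'; pose y' := push_y D'.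
pose d := push_height D x *: push_dir D; pose d' := push_height D' x' *: push_dir D'.
have sg : signed b (det3 (velocity phi (loop K) x) (velocity phi (loop K) y) d).
  by rewrite det3Z; apply: signedZ; [exact: push_height_gt0|exact: push_sign].
have sg' : signed b (det3 (velocity phi' (loop K) x') (velocity phi' (loop K) y') d').
  by rewrite det3Z; apply: signedZ; [exact: push_height_gt0|exact: push_sign].
have Kper := pk_per ((periodic_knotP _ _).1 (sknotP K)).
have [r0 r00 rP] : exists2 r0 : R, 0 < r0 & forall r, 0 < r <= r0 -> forall f z,
    List.In f [:: phi; phi'] -> List.In z [:: x; x'] -> small_radius K i f z r.
  apply: common_radius.
    by move=> f [<-|[<-|//]]; exact: push_vertex_dom.
  by move=> f [<-|[<-|//]]; exact: push_xP.
have rr : 0 < r0 <= r0 by rewrite r00 lexx.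
have sr1 := rP r0 rr phi x (or_introl erefl) (or_introl erefl).
have sr2 := rP r0 rr phi x' (or_introl erefl) (or_intror (or_introl erefl)).
have sr3 := rP r0 rr phi' x (or_intror (or_introl erefl)) (or_introl erefl).
have sr4 := rP r0 rr phi' x' (or_intror (or_introl erefl)) (or_intror (or_introl erefl)).
have [r2 _] := sr1.
have not_y u v : small_radius K i phi u r0 -> loop K v = vertex K i -> v - u \isn't a Num.int ->
    ~ bump_support u r0 v.
  by move=> [_ sr] Kv uv /sr[_ _ /(_ Kv)]; rewrite (negbTE uv).
have st := push_site D; have st' := push_site D'.
have [aphi Kx Ky xy _ _ _ dv _] := st; have [aphi' Kx' Ky' xy' _ _ _ dv' _] := st'.
have stB := site_bump aphi Kx Ky xy dv sr1.
have stB' := site_bump aphi' Kx' Ky' xy' dv' sr4.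
have xx0 : x - x \is a Num.int by rewrite subrr rpred0.
have xx0' : x' - x' \is a Num.int by rewrite subrr rpred0.
have stU := site_setU st stB; have stU' := site_setU st' stB'.
have I1 := interpolate hP stU (germ_mono (@subsetUl _ _ _) (push_germ D))
  (bump_germ stU aphi (site_dom stU) dv xx0 (@subsetUr _ _ _) r2 (not_y _ _ sr1 Ky xy) sg).
have I2 := interpolate hP stU' (germ_mono (@subsetUl _ _ _) (push_germ D'))
  (bump_germ stU' aphi' (site_dom stU') dv' xx0' (@subsetUr _ _ _) r2 (not_y _ _ sr2 Ky' xy') sg').
pose G := bump_push phi x r0 d (loop K); pose G' := bump_push phi' x' r0 d' (loop K).
(* Both bumps live on C, whose image lies in both charts. The second one is displaced in [phi'] and
   measured in [phi]. *)
pose C := bump_support x r0 `|` bump_support x' r0.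
have stC : site K i phi x y C.
  split=> //.
  - by apply: closedU; exact: closed_bump_support.
  - by move=> z k ki [/(bump_support_int ki)|/(bump_support_int ki)]; [left|right].
  - by move=> z [/sr1.2[]|/sr2.2[]].
  - by move=> j z Kz [/sr1.2[_ /(_ j)]|/sr2.2[_ /(_ j)]].
have gG : germ K phi x y C b G.
  exact: (bump_germ stC aphi (site_dom stC) dv xx0 (@subsetUl _ _ _) r2 (not_y _ _ sr1 Ky xy) sg).
have Cdom' z : C z -> cdom phi' (loop K z) by move=> [/sr3.2[]|/sr4.2[]].
have gG' : germ K phi x y C b G'.
  have vel u v : u - v \is a Num.int -> velocity phi' (loop K) u = velocity phi' (loop K) v.
    by move=> uv; rewrite (_ : u = v + (u - v)) ?velocity_periodic//; rewrite addrC subrK.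
  (* D' moves either the strand moved by D or the other one; in the latter case x and y are
     exchanged by [germ_sym]. *)
  have [[xx yy]|[yx xy2]] := times_dichotomy Kx Ky xy Kx' Ky' xy'.
    apply: (bump_germ stC aphi' Cdom' dv' xx (@subsetUr _ _ _) r2).
      apply: (not_y _ _ sr2 Ky); apply: contra xy => yx'.
      exact: int_sub xx yx'.
    by rewrite (vel _ _ xx) (vel _ _ yy).
  apply: germ_sym; apply: (bump_germ (site_sym stC) aphi' Cdom' dv' yx (@subsetUr _ _ _) r2).
    by apply: (not_y _ _ sr2 Kx); apply: contra xy => xx'; exact: int_sub xx' yx.
  by rewrite (vel _ _ yx) (vel _ _ xy2).
have I3 := interpolate hP stC gG gG'.
have E1 := near_germ_knot hP stC gG; have E2 := near_germ_knot hP stC gG'.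
(* A single height e that is small enough for all comparisons. *)
have [e e01 [H1 H2 H3 H4 H5]] : exists2 e : R, 0 < e <= 1 & [/\ 
   (0 < e -> exists N : knot P n, loop N =1 G e /\ vertex N =1 vertex K \o fintype.lift i),
   (0 < e -> exists N : knot P n, loop N =1 G' e /\ vertex N =1 vertex K \o fintype.lift i),
   (0 < e -> forall K0 K1 : knot P n,
    loop K0 =1 pert phi (fun z => e *: push_displacement D z) (loop K) ->
    vertex K0 =1 vertex K \o fintype.lift i ->
    loop K1 =1 G e -> vertex K1 =1 vertex K \o fintype.lift i -> isotopic K0 K1),
   (0 < e -> forall K0 K1 : knot P n,
    loop K0 =1 pert phi' (fun z => e *: push_displacement D' z) (loop K) ->
    vertex K0 =1 vertex K \o fintype.lift i ->
    loop K1 =1 G' e -> vertex K1 =1 vertex K \o fintype.lift i -> isotopic K0 K1) &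
   (0 < e -> forall K0 K1 : knot P n,
    loop K0 =1 G e -> vertex K0 =1 vertex K \o fintype.lift i ->
    loop K1 =1 G' e -> vertex K1 =1 vertex K \o fintype.lift i -> isotopic K0 K1)].
  apply: near0_pos; near=> e; split; near: e; assumption.
have e0 : 0 < e by case/andP: e01.
have pushN (D0 : push b i K) : exists N : knot P n,
    loop N =1 pushed D0 e /\ vertex N =1 vertex K \o fintype.lift i.
  have PN : P n (SKnot (pushed_knot D0 e01)).
    apply: (hP n K i) => //; first exact: knotP.
    by move=> j z /= Kz; rewrite pushed_off//; exact: (site_retained (push_site D0) Kz).
  by exists (Knot PN).
have [N [lN vN]] := pushN D; have [N' [lN' vN']] := pushN D'.
have [B [lB vB]] := H1 e0; have [B' [lB' vB']] := H2 e0.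
have lN2 : loop N =1 pert phi (fun z => e *: push_displacement D z) (loop K).
  by move=> z; rewrite lN pushed_pert.
have lN2' : loop N' =1 pert phi' (fun z => e *: push_displacement D' z) (loop K).
  by move=> z; rewrite lN' pushed_pert.
have s1 := push_shrink (K0 := K0) (Ke := N) hP (knotP K) e01 l0 v0 lN vN.
have s2 := H3 e0 N B lN2 vN lB vB.
have s3 := H5 e0 B B' lB vB lB' vB'.
have s4 := isotopic_sym (H4 e0 N' B' lN2' vN' lB' vB').
have s5 := isotopic_sym (push_shrink (K0 := K1) (Ke := N') hP (knotP K) e01 l1 v1 lN' vN').
exact: isotopic_trans s1 (isotopic_trans s2 (isotopic_trans s3 (isotopic_trans s4 s5))).
Unshelve. all: by end_near. Qed.

(** The bump is centred at m, which may differ from the crossing time x: along an isotopy x moves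
    while the bump stays in place. Since x is interior to the arc, the height there is positive. *)
Lemma bump_push_resolves b n (i : 'I_n.+1) (K : @sknot R M n.+1) (K' : @sknot R M n) psi m x y r d e :
  atlas psi -> loop K x = vertex K i -> loop K y = vertex K i -> y - x \isn't a Num.int ->
  0 < r < 2^-1 -> `|x - m| < r ->
  (forall z, bump_support m r z -> [/\ cdom psi (loop K z),
    forall j, loop K z <> vertex K (fintype.lift i j) &
    loop K z = vertex K i -> z - x \is a Num.int]) ->
  signed b (det3 (velocity psi (loop K) x) (velocity psi (loop K) y) d) -> 0 < e ->
  (forall t, 0 < t <= 1 -> is_singular_knot (bump_push psi m r d (loop K) (t * e))
     (vertex K \o fintype.lift i)) ->
  (forall t z, 0 < t <= 1 -> bump_support m r z -> (cmap psi @` cdom psi)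
     (cmap psi (loop K z) + (t * e) *: (bump m r z *: d))) ->
  loop K' =1 bump_push psi m r d (loop K) e -> vertex K' =1 vertex K \o fintype.lift i ->
  resolves b i K K'.
Proof.
move=> apsi Kx Ky xy r0 xm sr sg e0 sk im lK' vK'.
have mem z : m - r <= z <= m + r -> bump_support m r z.
  by move=> zr; apply: bump_support_mem => //; rewrite ler_norml; lra.
have pxy k : y <> x + k%:~R.
  by move=> yx; case/negP: xy; rewrite yx addrC addKr intr_int.
have parc : m - r < x < m + r by move: xm; rewrite ltr_norml; lra.
have pshort : m + r < m - r + 1 by lra.
have pdom z : m - r <= z <= m + r -> cdom psi (loop K z) by move=> /mem/sr[].
have pvert z j : m - r <= z <= m + r -> loop K z = vertex K j -> z = x.
  move=> zr Kz; have [_ nr ri] := sr z (mem z zr).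
  case: (unliftP i j) Kz => [j' ->|->] Kz; first by case: (nr j').
  apply/eqP; rewrite -subr_eq0; apply/eqP; apply: int_lt1; first exact: ri.
  by rewrite ltr_norml; lra.
have phei : 0 < e * bump m r x by rewrite mulr_gt0// bump_gt0_near.
have parcE t z : 0 < t <= 1 -> m - r <= z <= m + r ->
    cdom psi (bump_push psi m r d (loop K) (t * e) z) /\
    cmap psi (bump_push psi m r d (loop K) (t * e) z) =
      cmap psi (loop K z) + (t * (e * bump m r z)) *: d.
  move=> t01 /mem zr; have [dz _ _] := sr z zr.
  have := pertP (eta := fun z => (t * e) *: (bump m r z *: d)) dz (im t z t01 zr).
  by rewrite scalerA -mulrA.
have poff t z : 0 < t <= 1 -> m + r <= z <= m - r + 1 ->
    bump_push psi m r d (loop K) (t * e) z = loop K z.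
  by move=> t01 zr; apply: pert0; rewrite (bump_off r0 zr) scale0r scaler0.
exists (@Push R M b n i K psi x y (m - r) (m + r) (fun z => e * bump m r z) d
  (fun t => bump_push psi m r d (loop K) (t * e)) apsi Kx Ky pxy parc pshort pdom pvert phei sg
  parcE poff sk).
by split=> // z; rewrite lK' /= mul1r.
Qed.

End Uniqueness.

(** The class of 0 is open and so is its complement; [0, 1] is connected. *)
Lemma locally_constant (R : realType) (E : R -> R -> Prop) :
  (forall s, E s s) -> (forall s t, E s t -> E t s) ->
  (forall r s t, E r s -> E s t -> E r t) ->
  (forall s, \forall t \near s, E s t) -> E 0 1.
Proof.
move=> Er Es Et En.
have H : [set t | t \in `[0 : R, 1] /\ E 0 t] = `[0 : R, 1]%classic.
  apply: segment_connected.
  - by exists 0; split=> //; rewrite in_itv/= lexx ler01.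
  - exists [set t | E 0 t]; last by apply/seteqP; split.
    by rewrite openE => t Et0; apply: filterS (En t) => s; exact: Et.
  - exists [set t | E 0 t]; last by apply/seteqP; split.
    rewrite -openC openE => t nEt; apply: filterS (En t) => s Ets Es0.
    by apply: nEt; apply: Et Es0 (Es _ _ Ets).
have : [set t | t \in `[0 : R, 1] /\ E 0 t] 1 by rewrite H/= in_itv/= lexx ler01.
by case.
Qed.

(** * Invariance under isotopy *)

Section Paths.
Context {R : realType} {M : oriented_3manifold R}.
Implicit Types (phi psi : chart R M).

(** By compactness, every time at the k-th vertex of a nearby knot is close to x or to y modulo 1.
    Local injectivity forbids both of its times from being close to the same one, so each of x and y
    has one nearby. *)
Lemma track_times n (p : R -> @sknot R M n) s0 k x y A B : knot_path p ->
  loop (p s0) x = vertex (p s0) k -> loop (p s0) y = vertex (p s0) k ->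
  y - x \isn't a Num.int -> nbhs x A -> nbhs y B ->
  \forall s \near s0, exists x' y', [/\ A x', B y', loop (p s) x' = vertex (p s) k,
    loop (p s) y' = vertex (p s) k &
    y' - x' \isn't a Num.int /\ forall z, loop (p s) z = vertex (p s) k ->
      z - x' \is a Num.int \/ z - y' \is a Num.int].
Proof.
move=> pp Kx Ky xy nA nB.
have pk s := (periodic_knotP _ _).1 (sknotP (p s)).
have imm z : immersed (loop (p s0)) z by move=> phi aphi dz; exact: pk_imm (pk s0) _ _ aphi dz.
have injn (z : R) : exists2 SD : set R * set R, nbhs s0 SD.1 /\ nbhs z SD.2 &
    forall s u v, SD.1 s -> SD.2 u -> SD.2 v -> loop (p s) u = loop (p s) v -> u = v.
  have [[S D] [/= nS [[D1 D2] [/= nD1 nD2] D12]] SD] := near_injective (C1at_path (s0, z) pp) (imm z).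
  exists (S, D1 `&` D2) => /=; first by split=> //; exact: filterI.
  move=> s u v Ss [D1u _] [_ D2v]; apply: (SD (s, (u, v))); split=> //=.
  exact: (D12 (_, _)).
have [[S1 A1] [/= nS1 nA1] inj1] := injn x; have [[S2 B1] [/= nS2 nB1] inj2] := injn y.
pose A2 := A `&` A1; pose B2 := B `&` B1.
have nA2 : nbhs x A2 by exact: filterI.
have nB2 : nbhs y B2 by exact: filterI.
have all_near : \forall s \near s0, forall z, loop (p s) z = vertex (p s) k ->
    exists2 j, j \is a Num.int & A2 (z + j) \/ B2 (z + j).
  apply: near_all_periodic.
    apply: filterE => s z j ji H; rewrite (periodic_int (pk_per (pk s)))// => /H[l li AB].
    exists (l - j); first by rewrite rpredB.
    by have -> : z + j + (l - j) = z + l by ring.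
  move=> z; have [Kz|nK] := pselect (loop (p s0) z = vertex (p s0) k); last first.
    have c2 : {for (s0, z), continuous (fun w : R * R => vertex (p w.1) k)}.
      have vk : {for s0, continuous (fun s => vertex (p s) k)} by exact: (path_vertex pp).
      exact: (continuous_pull0 (u := z) vk).
    have := near_neq (mhausdorff (o := M)) (C1at_path (s0, z) pp).1 c2 nK.
    by apply: filterS => w nw e; case: (nw e).
  have tr (j : R) (D : set R) : nbhs (z + j) D -> \forall u \near z, D (u + j).
    move=> nD; have cc : {for z, continuous (fun u : R => u + j)}.
      by apply: cvgD; [exact: cvg_id|exact: cvg_cst].
    exact: cc _ nD.
  have [zx|zy] : z - x \is a Num.int \/ z - y \is a Num.int.
    have [a [b [ab Ka Kb Kz']]] := pk_dbl (pk s0) k.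
    case: (Kz' _ Kx) => [xa|xa]; case: (Kz' _ Ky) => [ya|ya]; case: (Kz' _ Kz) => [za|za];
     try (by case/negP: xy; exact: int_sub xa ya);
     first [by left; exact: int_sub xa za|by right; exact: int_sub ya za].
  - have n1 : \forall u \near z, A2 (u + (x - z)) by apply: tr; rewrite addrC subrK.
    have := @near_pullr _ _ (fun u => A2 (u + (x - z))) s0 z n1; apply: filterS => w Aw _.
    by exists (x - z); [rewrite -opprB rpredN|left].
  - have n1 : \forall u \near z, B2 (u + (y - z)) by apply: tr; rewrite addrC subrK.
    have := @near_pullr _ _ (fun u => B2 (u + (y - z))) s0 z n1; apply: filterS => w Aw _.
    by exists (y - z); [rewrite -opprB rpredN|right].
apply: filterS3 nS1 nS2 all_near => s S1s S2s alls.
have [a [b [ab Ka Kb Kz]]] := pk_dbl (pk s) k.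
have [j ji ABa] := alls a Ka; have [l li ABb] := alls b Kb.
have Kaj : loop (p s) (a + j) = vertex (p s) k by rewrite (periodic_int (pk_per (pk s))).
have Kbl : loop (p s) (b + l) = vertex (p s) k by rewrite (periodic_int (pk_per (pk s))).
have ajbl : (b + l) - (a + j) \isn't a Num.int by rewrite int_of_shift.
have neq : a + j <> b + l by move=> e; move: ajbl; rewrite e subrr rpred0.
have Kz' z : loop (p s) z = vertex (p s) k -> z - (a + j) \is a Num.int \/ z - (b + l) \is a Num.int.
  have e u v w : w \is a Num.int -> (u - (v + w) \is a Num.int) = (u - v \is a @Num.int R).
    by move=> wi; have := @int_of_shift R v u w 0 wi (rpred0 _); rewrite addr0.
  by rewrite !e//; exact: Kz.
case: ABa => [[Aa A1a]|[Ba B1a]]; case: ABb => [[Ab A1b]|[Bb B1b]].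
- by case: neq; apply: (inj1 s) => //; rewrite Kaj Kbl.
- by exists (a + j), (b + l).
- exists (b + l), (a + j); split=> //; split; first by rewrite -opprB rpredN.
  by move=> z /Kz'[]; [right|left].
- by case: neq; apply: (inj2 s) => //; rewrite Kaj Kbl.
Qed.

Lemma row_free_signed b (u w : 'rV[R]_3) : row_free (col_mx u w) -> exists d, signed b (det3 u w d).
Proof.
move=> /row_free_det3[d d0]; case: b; [by exists d|exists (- d)].
by rewrite /signed det3N oppr_lt0.
Qed.

(** All knots [p s] near [s0] are displaced by the same bump, chosen for [p s0]. The parameters are
    pairs (s, e), and the family at a fixed height e > 0 is the isotopy between the resolutions. *)
Lemma local_resolutions (P : @structure R M) b n (i : 'I_n.+1) (p : R -> knot P n.+1) s0 :
  hereditary P -> knot_path (fun s => underlying (p s)) ->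
  \forall s \near s0, exists K K' : knot P n,
    [/\ resolves b i (p s0) K, resolves b i (p s) K' & isotopic K K'].
Proof.
move=> hP pp; pose q s := underlying (p s).
have pk s := (periodic_knotP _ _).1 (sknotP (q s)).
have [x [y [xy Kx Ky Kz]]] := pk_dbl (pk s0) i.
have [psi apsi dv] := atlas_cover (vertex (q s0) i).
have dx : cdom psi (loop (q s0) x) by rewrite Kx.
have dy : cdom psi (loop (q s0) y) by rewrite Ky.
have [d sg] := row_free_signed b (pk_trans (pk s0) apsi dx xy (etrans Kx (esym Ky))).
have [r1 r10 rP] := exists_small_radius Kx dv.
have sr := rP r1 (introT andP (conj r10 (lexx r1))).
move: sr; set r := r1 => sr {rP}.
have st := site_bump apsi Kx Ky xy dv sr.
have [r2 srP] := sr.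
pose C := bump_support x r.
have nCy : ~ C y by move=> /srP[_ _ /(_ Ky)]; rewrite (negbTE xy).
pose K (l : R * R) := q l.1.
pose eta z := bump x r z *: d.
pose G (l : R * R) := bump_push psi x r d (loop (K l)) l.2.
have KC1 l z : C1at (fun l => loop (K l)) (l, z).
  exact: (C1at_pull (w := (l, z)) (@cvg_fst _ _ _ _ _) (C1at_path (l.1, z) pp)).
have Kv l j : {for l, continuous (fun l => vertex (K l) j)}.
  apply: (@continuous_comp _ _ _ fst (fun s => vertex (q s) j)); first exact: cvg_fst.
  exact: (path_vertex pp).
have e2 : \forall l \near (s0, 0 : R), {for l, continuous (snd : R * R -> R)}.
  by apply: filterE => l; exact: cvg_snd.
have etaC (w : (R * R) * R) : C1v (fun _ => eta) w by exact: C1v_bump.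
have etaper z : eta (z + 1) = eta z by rewrite /eta bump_periodic// rpred1.
have etaS z : eta z != 0 -> C z.
  by rewrite /eta scaler_eq0 negb_or => /andP[bz _]; exact: bump_neq0.
have n2 : \forall l \near (s0, 0 : R), forall z, C1at (fun l => loop (K l)) (l, z).
  by apply: filterE => l z; exact: KC1.
have n3 : \forall l \near (s0, 0 : R), forall z, loop (K l) (z + 1) = loop (K l) z.
  by apply: filterE => l z; exact: pk_per (pk l.1) z.
have H1 := near_pert_C1 (l0 := (s0, 0 : R)) (K := fun l => loop (K l)) apsi
  n2 n3 e2 erefl
  etaC etaper etaS (site_closed st) (site_per st) (site_dom st).
have GC1 : \forall l \near (s0, 0 : R), forall z, C1at G (l, z).
  by apply: filterS H1 => l [].
have Gper : \forall l \near (s0, 0 : R), forall z, G l (z + 1) = G l z.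
  by apply: filterE => l z; rewrite /G /bump_push /pert bump_periodic ?rpred1// (pk_per (pk l.1)).
have ret j z : loop (K (s0, 0)) z = vertex (K (s0, 0)) (fintype.lift i j) -> ~ C z.
  by move=> Kjz /srP[_ /(_ j)].
(* The crossing of [p s] is followed by its tracked times, as [sided_separated] requires. *)
have cross A B : nbhs x A -> nbhs y B -> \forall l \near (s0, 0 : R),
     exists x' y', [/\ A x', B y' & loop (K l) x' = loop (K l) y'].
  move=> nA nB.
  have := @near_pull0 _ _ _ s0 (0 : R) (track_times pp Kx Ky xy nA nB).
  apply: filterS => l [x' [y' [Ax By Kx' Ky' _]]]; exists x', y'; split=> //.
  by rewrite /K /q Kx' Ky'.
have sided0 : sided b psi (fun l => loop (K l)) G (fun l => 0 < l.2) (s0, 0) x y.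
  apply: (@sided_pert R M _ b psi psi (fun l => loop (K l)) (fun l => l.2) eta (s0, 0) x y apsi apsi).
  - exact: KC1.
  - exact: KC1.
  - exact: etrans Kx (esym Ky).
  - exact: dx.
  - exact: dx.
  - exact: cvg_snd.
  - by [].
  - have [c _ _] := etaC ((s0, 0), x).
    have xc : {for x, continuous (fun z : R => ((s0, 0 : R), z))}.
      by apply: (@cvg_pair _ _ _ _ (nbhs (s0, 0 : R)) (nbhs x)); [exact: cvg_cst|exact: cvg_id].
    exact: (@continuous_comp _ _ _ _ (fun v : (R * R) * R => eta v.2) x xc c).
  - have nC' : \forall z \near y, ~ C z.
      by apply: open_nbhs_nbhs; split=> //; exact/closed_openC/closed_bump_support.
    by apply: filterS nC' => z nz; have [//|/etaS//] := eqVneq (eta z) 0.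
  - by rewrite /eta det3Z; apply: signedZ => //; exact: bump_gt0.
have sep := sided_separated apsi (KC1 (s0, 0) x) (KC1 (s0, 0) y) dx (etrans Kx (esym Ky)) cross sided0.
have H2 : \forall l \near (s0, 0 : R), 0 < l.2 -> is_singular_knot (G l) (vertex (K l) \o fintype.lift i).
  apply: (@near_resolved_knot R M _ (s0, 0 : R) n.+1 n (fintype.lift i) K G C (fun l => 0 < l.2)).
  - exact: lift_inj.
  - by move=> z; exact: KC1.
  - by move=> j; exact: Kv.
  - exact: GC1.
  - exact: Gper.
  - by move=> z; rewrite /G /bump_push pert0//= scale0r.
  - exact: site_closed st.
  - exact: (site_per st).
  - apply: filterE => l z nC; rewrite /G /bump_push pert0//.
    by have [e0|/etaS//] := eqVneq (eta z) 0; rewrite -/(eta z) e0 scaler0.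
  - exact: ret.
  - move=> k nk; have -> : k = i by case: (unliftP i k) => // j kj; case: (nk j).
    exact: (@separated_times R M _ n.+1 (q s0) G (fun l => 0 < l.2) (s0, 0) i x y Gper Kx Ky xy sep).
have H3 : \forall l \near (s0, 0 : R), forall z j,
    loop (K l) z = vertex (K l) (fintype.lift i j) -> ~ C z.
  apply: (@near_vertex_times R M _ (s0, 0 : R) n.+1 n (fintype.lift i) K C).
  - by move=> z; exact: KC1.
  - by move=> j; exact: Kv.
  - exact: site_closed st.
  - exact: (site_per st).
  - exact: ret.
have nCy' : \forall z \near y, ~ C z.
  by apply: open_nbhs_nbhs; split=> //; exact/closed_openC/closed_bump_support.
have sgc : {for (s0, (x, y)), continuous (fun v : R * (R * R) =>
    det3 (velocity psi (loop (q v.1)) v.2.1) (velocity psi (loop (q v.1)) v.2.2) d)}.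
  apply: cvg_det3; last exact: cvg_cst.
  - have vc : {for (s0, x), continuous (fun w : R * R => velocity psi (loop (q w.1)) w.2)}.
      exact: (path_C1 pp (z := (s0, x)) apsi dx).
    exact: (continuous_pull1 (f := fun s z => velocity psi (loop (q s)) z) vc).
  - have vc : {for (s0, y), continuous (fun w : R * R => velocity psi (loop (q w.1)) w.2)}.
      exact: (path_C1 pp (z := (s0, y)) apsi dy).
    exact: (continuous_pull2 (f := fun s z => velocity psi (loop (q s)) z) vc).
have [[S0 D0] [/= nS0 [[D1 D2] [/= nD1 nD2] D12]] SD] := near_signed sgc sg.
(* The time of the pushed strand remains inside the arc of the bump, and the other time remains off
   it. *)
have nA : nbhs x (D1 `&` ball x r) by apply: filterI => //; apply: nbhsx_ballx; case/andP: r2.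
have nB : nbhs y (D2 `&` [set z | ~ C z]) by exact: filterI.
have T := track_times pp Kx Ky xy nA nB.
have [[S E] [/= nS nE] SE] : \forall l \near (s0, 0 : R),
   [/\ (forall z, C1at G (l, z)),
       (forall z, C z -> cdom psi (loop (K l) z) /\
         (cmap psi @` cdom psi) (cmap psi (loop (K l) z) + l.2 *: eta z)),
       (0 < l.2 -> is_singular_knot (G l) (vertex (K l) \o fintype.lift i)) &
       (forall z j, loop (K l) z = vertex (K l) (fintype.lift i j) -> ~ C z)].
  by apply: filterS3 H1 H2 H3 => l [? ?] ? ?; split.
(* E has to contain [t * e] for every t in (0, 1]: a [push] asks for singular knots at all its
   stages. *)
have [e /andP[e0 _] Ee] : exists2 e : R, 0 < e <= 1 & forall t, 0 < t <= 1 -> E (t * e).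
  move: nE => /nbhs_ballP[ee /= ee0 eeE]; exists (Num.min (ee / 2) 1).
    by rewrite lt_min ge_min lexx orbT andbT ltr01 andbT divr_gt0.
  move=> t /andP[t0 t1]; apply: eeE; rewrite -ball_normE/= sub0r normrN.
  have m0 : 0 <= Num.min (ee / 2) 1 by rewrite le_min ler01 andbT divr_ge0// ltW.
  rewrite normrM (ger0_norm (x := t)) ?ltW// ger0_norm//.
  have m1 : Num.min (ee / 2) 1 <= ee / 2 by rewrite ge_min lexx.
  by nra.
have E1 : E e by rewrite -[e]mul1r; apply: Ee; rewrite ltr01 lexx.
have mk s : S s -> exists N : knot P n, loop N =1 G (s, e) /\ vertex N =1 vertex (q s) \o fintype.lift i.
  move=> Ss; have [_ _ sk ret'] := SE (s, e) (conj Ss E1).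
  have PN : P n (SKnot (sk e0)).
    apply: (hP n (p s) i) => //; first exact: knotP.
    move=> j z /= Kjz; rewrite -Kjz; apply: pert0.
    have [e0'|/etaS Cz] := eqVneq (eta z) 0; first by rewrite -/(eta z) e0' scaler0.
    by case: (ret' z j Kjz).
  by exists (Knot PN).
have res s N : S s -> S0 s -> (exists x' y', [/\ (D1 `&` ball x r) x', (D2 `&` [set z | ~ C z]) y',
     loop (q s) x' = vertex (q s) i, loop (q s) y' = vertex (q s) i &
    y' - x' \isn't a Num.int /\ forall z, loop (q s) z = vertex (q s) i ->
      z - x' \is a Num.int \/ z - y' \is a Num.int]) ->
    loop N =1 G (s, e) -> vertex N =1 vertex (q s) \o fintype.lift i -> resolves b i (q s) N.
  move=> Ss S0s [x' [y' [[D1x bx] [D2y ny] Kx' Ky' [xy' Kz']]]] lN vN.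
  have sg' : signed b (det3 (velocity psi (loop (q s)) x') (velocity psi (loop (q s)) y') d).
    by apply: (SD (s, (x', y'))); split=> //=; exact: (D12 (_, _)).
  apply: (bump_push_resolves apsi Kx' Ky' xy' r2 _ _ sg' e0 _ _ lN vN).
  - by rewrite -ball_normE/= in bx; rewrite distrC.
  - move=> z Cz; have [_ dz _ rt] := SE (s, e) (conj Ss E1); split.
    + exact: (dz z Cz).1.
    + by move=> j Kjz; exact: (rt z j Kjz Cz).
    + move=> /Kz'[//|zy]; case: ny; apply: (site_per st zy).
      by rewrite addrC subrK.
  - move=> t t01; have [_ _ sk _] := SE (s, t * e) (conj Ss (Ee t t01)).
    by apply: sk; rewrite /= mulr_gt0//; case/andP: t01.
  - by move=> t z t01 Cz; have [_ dz _ _] := SE (s, t * e) (conj Ss (Ee t t01)); exact: (dz z Cz).2.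
have [sig /= sig0 sigS] := (nbhs_ballP _ _).1 nS.
have T0 := nbhs_singleton T; have S00 := nbhs_singleton nS0.
have nb : \forall s \near s0, ball s0 sig s by exact: nbhsx_ballx.
apply: filterS3 nb nS0 T => s bs S0s Ts.
have Ss : S s by exact: sigS.
have Ss0 : S s0 by exact: nbhs_singleton.
have [N0 [lN0 vN0]] := mk s0 Ss0; have [N [lN vN]] := mk s Ss.
exists N0, N; split.
- exact: (res s0 N0 Ss0 S00 T0 lN0 vN0).
- exact: (res s N Ss S0s Ts lN vN).
pose th (t : R) := s0 + t * (s - s0).
have thS t : 0 <= t <= 1 -> S (th t).
  move=> t01; apply: sigS; move: bs; rewrite -!ball_normE/= /th.
  have -> : s0 - (s0 + t * (s - s0)) = t * (s0 - s) by ring.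
  move=> bs; rewrite normrM ger0_norm; last by case/andP: t01.
  have := normr_ge0 (s0 - s); nra.
have thc : continuous th.
  move=> t; apply: cvgD; first exact: cvg_cst.
  by apply: cvgM; [exact: cvg_id|exact: cvg_cst].
apply: (@isotopic_family R M P n (fun t => G (th t, e)) (fun t => vertex (q (th t)) \o fintype.lift i)).
- by move=> t /thS; exact: mk.
- move=> t z t01; have [GC _ _ _] := SE (th t, e) (conj (thS t t01) E1).
  have c : {for t, continuous (fun t : R => (th t, e))}.
    by apply: (@cvg_pair _ _ _ _ (nbhs (th t)) (nbhs e)); [exact: thc|exact: cvg_cst].
  exact: (C1at_pull (w := (t, z)) c (GC z)).
- move=> t j t01; apply: (@continuous_comp _ _ _ th (fun s => vertex (q s) (fintype.lift i j))).
    exact: thc.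
  exact: (path_vertex pp).
- by move=> z; rewrite lN0 /th mul0r addr0.
- by move=> z; rewrite vN0 /th mul0r addr0.
- by move=> z; rewrite lN /th mul1r addrC subrK.
- by move=> z; rewrite vN /th mul1r addrC subrK.
Unshelve. all: by end_near. Qed.

(** That resolutions of [p s] and [p t] are isotopic is an equivalence relation between s and t,
    because resolutions exist and are unique up to isotopy. By [local_resolutions] its classes are
    open. *)
Lemma resolution_well_definedP (P : @structure R M) : hereditary P -> resolution_well_defined P.
Proof.
move=> hP b n i K L [p [pp pK pL]].
have loc := local_resolutions b i (p := p) _ hP pp.
have ex s : exists N : knot P n, resolves b i (p s) N.
  by have [N [_ [? _ _]]] := nbhs_singleton (loc s); exists N.
split; first by rewrite -pK.
pose E s t := forall K' L' : knot P n, resolves b i (p s) K' -> resolves b i (p t) L' -> isotopic K' L'.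
suff : E 0 1 by rewrite /E pK pL.
apply: locally_constant.
- by move=> s K' L'; exact: resolves_unique.
- by move=> s t Est K' L' rK rL; apply: isotopic_sym; exact: Est.
- move=> r s t Ers Est K' L' rK rL; have [N rN] := ex s.
  exact: isotopic_trans (Ers _ _ rK rN) (Est _ _ rN rL).
- move=> s; apply: filterS (loc s) => t [N [N' [rN rN' NN']]] K' L' rK rL.
  apply: isotopic_trans (resolves_unique hP rK rN) _.
  exact: isotopic_trans NN' (resolves_unique hP rN' rL).
Qed.

End Paths.

(** * Structures inherited by resolutions *)

Section Hereditary.
Context {R : realType} {M : oriented_3manifold R}.

(** The two times of K at a kept vertex are also times of K' there, and K' has only two modulo 1. *)
Lemma same_times n (K : @sknot R M n.+1) (i : 'I_n.+1) (K' : @sknot R M n) :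
  vertex K' =1 vertex K \o fintype.lift i ->
  (forall j z, loop K z = vertex K' j -> loop K' z = vertex K' j) ->
  forall j z, loop K' z = vertex K' j -> loop K z = vertex K' j.
Proof.
move=> vK' KK' j z K'z.
have pK := (periodic_knotP _ _).1 (sknotP K); have pK' := (periodic_knotP _ _).1 (sknotP K').
have [a [b [ab Ka Kb _]]] := pk_dbl pK (fintype.lift i j).
have vE : vertex K (fintype.lift i j) = vertex K' j by rewrite vK'.
rewrite !vE in Ka Kb.
have [c [d [cd Kc Kd Kz]]] := pk_dbl pK' j.
have per u : u - a \is a Num.int -> loop K u = loop K a.
  by move=> ua; rewrite (_ : u = a + (u - a)) ?(periodic_int (pk_per pK))// addrC subrK.
have perb u : u - b \is a Num.int -> loop K u = loop K b.
  by move=> ua; rewrite (_ : u = b + (u - b)) ?(periodic_int (pk_per pK))// addrC subrK.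
case: (Kz _ (KK' _ _ Ka)) => xa; case: (Kz _ (KK' _ _ Kb)) => xb; case: (Kz _ K'z) => xz;
 first [by case/negP: ab; exact: int_sub xa xb
       |by rewrite (per _ (int_sub xa xz))
       |by rewrite (perb _ (int_sub xb xz))].
Qed.

Lemma plain_hereditary : hereditary (@plain R M).
Proof. by []. Qed.

Lemma based_hereditary : hereditary (@based R M).
Proof.
move=> n K i K' bK vK' KK' j K'0.
by apply: (bK (fintype.lift i j)); rewrite (same_times vK' KK' (esym K'0)) vK'.
Qed.

Lemma lt_lift n (h : 'I_n.+1) (i j : 'I_n) : (i < j)%N -> (fintype.lift h i < fintype.lift h j)%N.
Proof. by move=> ij; rewrite /= /fintype.bump; case: (leqP h i); case: (leqP h j); lia. Qed.

(** Renumbering by [lift] is increasing, and the times at the kept vertices are unchanged, so first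
    meetings stay in order. *)
Lemma naturally_based_hereditary : hereditary (@naturally_based R M).
Proof.
move=> n K i K' [bK oK] vK' KK'; split; first exact: based_hereditary bK vK' KK'.
move=> a b ab; have [x [x01 Kx] Hx] := oK _ _ (lt_lift i ab).
exists x; first by split=> //; apply: KK'; rewrite vK'.
by move=> y y01 /(same_times vK' KK') Ky; apply: Hx => //; rewrite Ky vK'.
Qed.

End Hereditary.

(** * Double resolutions *)

(** The cosimplicial identity: the labels that remain after removing two of them do not depend on
    the order of removal. *)
Lemma lift_lift n (i : 'I_n.+2) (j i' : 'I_n.+1) : fintype.lift (fintype.lift i j) i' = i ->
  forall k, fintype.lift i (fintype.lift j k) = fintype.lift (fintype.lift i j) (fintype.lift i' k).
Proof.
move=> /(congr1 val) /= e k; apply/val_inj; move: e; rewrite /= /fintype.bump.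
by do ![case: leqP => ? /=]; lia.
Qed.

Lemma exists_bump_radius (R : realType) (x : R) (A : set R) : nbhs x A ->
  exists2 r0 : R, 0 < r0 & forall r z, 0 < r <= r0 -> r < 2^-1 -> bump_support x r z ->
    exists2 k, k \is a Num.int & A (z - k).
Proof.
move=> /nbhs_ballP[e /= e0 eA]; exists (e / 2); first by rewrite divr_gt0.
move=> r z /andP[r0 re] r2 Cz; have r02 : 0 < r < 2^-1 by rewrite r0.
have [k ki zk] := bump_supportP r02 Cz; exists k => //; apply: eA.
rewrite -ball_normE/= -normrN opprB (_ : z - k - x = z - x - k); last by ring.
by lra.
Qed.

Lemma ball_half (R : realType) (c s : R) : 0 < s <= c / 2 -> ball (0 : R) c s.
Proof. by move=> sc; rewrite -ball_normE/= sub0r normrN ger0_norm; lra. Qed.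

Section DoubleResolutions.
Context {R : realType} {M : oriented_3manifold R}.
Implicit Types (phi psi : chart R M).

(** At each time at most one of the two displacements is non-zero, so each one acts on the original
    loop. *)
Lemma pert_comm phi psi (eta eta' : R -> 'rV[R]_3) (g : R -> M) (C : set R) :
  (forall z, eta z != 0 -> C z) -> (forall z, eta' z != 0 -> ~ C z) ->
  pert phi eta (pert psi eta' g) = pert psi eta' (pert phi eta g).
Proof.
move=> etaC etaC'; apply/funext => z; rewrite /pert.
have [//|/etaC Cz] := eqVneq (eta z) 0.
by have [//|/etaC'] := eqVneq (eta' z) 0.
Qed.

(** K1 agrees with K off C1. A bump whose arc avoids C1, as does the time y of the other strand,
    therefore sees the same vertices and velocities on K1 as on K. *)
Lemma second_push b n (K : @sknot R M n.+2) i (j : 'I_n.+1) (K1 : @sknot R M n.+1)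
    (N : @sknot R M n) psi x y r d e (C1 : set R) :
  closed C1 -> (forall z, ~ C1 z -> loop K1 z = loop K z) ->
  vertex K1 =1 vertex K \o fintype.lift i -> atlas psi ->
  loop K x = vertex K (fintype.lift i j) -> loop K y = vertex K (fintype.lift i j) ->
  y - x \isn't a Num.int -> small_radius K (fintype.lift i j) psi x r ->
  (forall z, bump_support x r z -> ~ C1 z) -> ~ C1 y ->
  signed b (det3 (velocity psi (loop K) x) (velocity psi (loop K) y) d) -> 0 < e ->
  (forall t, 0 < t <= 1 -> is_singular_knot (bump_push psi x r d (loop K1) (t * e))
     (vertex K1 \o fintype.lift j)) ->
  (forall t z, 0 < t <= 1 -> bump_support x r z -> (cmap psi @` cdom psi)
     (cmap psi (loop K z) + (t * e) *: (bump x r z *: d))) ->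
  loop N =1 bump_push psi x r d (loop K1) e -> vertex N =1 vertex K1 \o fintype.lift j ->
  resolves b j K1 N.
Proof.
move=> clC KK1 vK1 apsi Kx Ky xy [r0 sr] CC nCy sg e0 sk im lN vN.
have nCx : ~ C1 x by apply: CC; apply: bump_support_mem => //; rewrite subrr normr0 ltW//; case/andP: r0.
have velE z : ~ C1 z -> velocity psi (loop K1) z = velocity psi (loop K) z.
  move=> nC; apply: velocity_near_eq.
  have : \forall u \near z, ~ C1 u by apply: open_nbhs_nbhs; split=> //; exact: closed_openC.
  by apply: filterS => u; exact: KK1.
apply: (@bump_push_resolves _ _ b n j K1 N psi x x y r d e apsi).
- by rewrite KK1// vK1.
- by rewrite KK1// vK1.
- exact: xy.
- exact: r0.
- by rewrite subrr normr0; case/andP: r0.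
- move=> z Cz; have [dz nz tz] := sr z Cz; rewrite KK1; last exact: CC.
  split=> //; last by rewrite vK1.
  move=> k; rewrite vK1 /=.
  case: (unliftP (fintype.lift i j) (fintype.lift i (fintype.lift j k))) => [l ->|]; first exact: nz.
  by move=> /lift_inj /eqP; rewrite eq_sym (negbTE (neq_lift _ _)).
- by rewrite !velE.
- exact: e0.
- exact: sk.
- by move=> t z t01 Cz; rewrite KK1; [exact: im|exact: CC].
- exact: lN.
- exact: vN.
Qed.

(** Both orders end at one knot: K displaced by two bumps with disjoint supports, at the same height
    e. *)
Lemma double_resolution (P : @structure R M) b b' n (K : knot P n.+2) (i : 'I_n.+2) (j i' : 'I_n.+1) :
  hereditary P -> fintype.lift (fintype.lift i j) i' = i ->
  exists (K1 K2 : knot P n.+1) (N : knot P n),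
    [/\ resolves b i K K1, resolves b' j K1 N,
        resolves b' (fintype.lift i j) K K2 & resolves b i' K2 N].
Proof.
move=> hP ii'; set j0 := fintype.lift i j.
have pK := (periodic_knotP _ _).1 (sknotP K).
have ij : j0 <> i by move=> e; have := neq_lift i j; rewrite -/j0 e eqxx.
have data c k : exists psi x y d, [/\ atlas psi, cdom psi (vertex K k), loop K x = vertex K k,
    loop K y = vertex K k & y - x \isn't a Num.int /\
    signed c (det3 (velocity psi (loop K) x) (velocity psi (loop K) y) d)].
  have [x [y [xy Kx Ky _]]] := pk_dbl pK k.
  have [psi apsi dv] := atlas_cover (vertex K k).
  have dx : cdom psi (loop K x) by rewrite Kx.
  have [d sg] := row_free_signed c (pk_trans pK apsi dx xy (etrans Kx (esym Ky))).
  by exists psi, x, y, d.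
have [psi1 [x1 [y1 [d1 [apsi1 dv1 Kx1 Ky1 [xy1 sg1]]]]]] := data b i.
have [psi2 [x2 [y2 [d2 [apsi2 dv2 Kx2 Ky2 [xy2 sg2]]]]]] := data b' j0.
have [r1 r10 rP1] := exists_small_radius Kx1 dv1.
have sr1 := rP1 r1 (introT andP (conj r10 (lexx r1))).
pose C1 := bump_support x1 r1.
have C1t z k : C1 z -> loop K z = vertex K k -> k = i.
  move=> /sr1.2[_ nz _] Kz; case: (unliftP i k) Kz => [l ->|->//] Kz; by case: (nz l).
have nC1x2 : ~ C1 x2 by move=> /C1t/(_ Kx2).
have nC1y2 : ~ C1 y2 by move=> /C1t/(_ Ky2).
have clC1 : closed C1 by exact: closed_bump_support.
have nC1 z : ~ C1 z -> \forall u \near z, ~ C1 u.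
  by move=> nC; apply: open_nbhs_nbhs; split=> //; exact: closed_openC.
(* C1 is closed and does not contain x2, so a short enough second arc misses it. *)
have [r2 [r20 sr2 C12]] : exists r2 : R, [/\ 0 < r2, small_radius K j0 psi2 x2 r2 &
    forall z, bump_support x2 r2 z -> ~ C1 z].
  have [ra ra0 raP] := exists_small_radius Kx2 dv2.
  have [rb rb0 rbP] := exists_bump_radius (nC1 _ nC1x2).
  exists (Num.min ra rb); have m0 : 0 < Num.min ra rb by rewrite lt_min ra0.
  have s := raP (Num.min ra rb) _; split=> //.
    by apply: s; rewrite m0 ge_min lexx.
  have {}s : small_radius K j0 psi2 x2 (Num.min ra rb) by apply: s; rewrite m0 ge_min lexx.
  move=> z Cz C1z; have [||k ki] := rbP (Num.min ra rb) z _ _ Cz.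
  - by rewrite m0 ge_min lexx orbT.
  - by case: s => /andP[].
  - by apply; apply: (bump_support_int ki); rewrite subrK.
pose C2 := bump_support x2 r2.
have C2t z k : C2 z -> loop K z = vertex K k -> k = j0.
  move=> /sr2.2[_ nz _] Kz; case: (unliftP j0 k) Kz => [l ->|->//] Kz; by case: (nz l).
have nC2x1 : ~ C2 x1 by move=> /C2t/(_ Kx1)/esym.
have nC2y1 : ~ C2 y1 by move=> /C2t/(_ Ky1)/esym.
have nC1y1 : ~ C1 y1 by move=> /sr1.2[_ _ /(_ Ky1)]; rewrite (negbTE xy1).
have nC2y2 : ~ C2 y2 by move=> /sr2.2[_ _ /(_ Ky2)]; rewrite (negbTE xy2).
have clC2 : closed C2 by exact: closed_bump_support.
have nC2 z : ~ C2 z -> \forall u \near z, ~ C2 u.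
  by move=> nC; apply: open_nbhs_nbhs; split=> //; exact: closed_openC.
have st1 := site_bump apsi1 Kx1 Ky1 xy1 dv1 sr1.
have st2 := site_bump apsi2 Kx2 Ky2 xy2 dv2 sr2.
pose eta1 z := bump x1 r1 z *: d1; pose eta2 z := bump x2 r2 z *: d2.
have etaC1 (w : (R * R) * R) : C1v (fun _ => eta1) w by exact: C1v_bump.
have etaC2 (w : (R * R) * R) : C1v (fun _ => eta2) w by exact: C1v_bump.
have per1 z : eta1 (z + 1) = eta1 z by rewrite /eta1 bump_periodic// rpred1.
have per2 z : eta2 (z + 1) = eta2 z by rewrite /eta2 bump_periodic// rpred1.
have etaS1 z : eta1 z != 0 -> C1 z.
  by rewrite scaler_eq0 negb_or => /andP[bz _]; exact: bump_neq0.
have etaS2 z : eta2 z != 0 -> C2 z.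
  by rewrite scaler_eq0 negb_or => /andP[bz _]; exact: bump_neq0.
have eta01 z : ~ C1 z -> eta1 z = 0 by move=> nC; have [//|/etaS1] := eqVneq (eta1 z) 0.
have eta02 z : ~ C2 z -> eta2 z = 0 by move=> nC; have [//|/etaS2] := eqVneq (eta2 z) 0.
(* The two heights are independent parameters: the second push of either order varies one of them
   while the other is held at e. *)
pose G1 (l : R * R) := bump_push psi1 x1 r1 d1 (loop K) l.1.
pose G2 (l : R * R) := bump_push psi2 x2 r2 d2 (loop K) l.2.
pose G (l : R * R) := bump_push psi2 x2 r2 d2 (G1 l) l.2.
have GE l : G l = bump_push psi1 x1 r1 d1 (G2 l) l.1.
  rewrite /G /G1 /G2 /bump_push; apply: (@pert_comm _ _ _ _ _ C2).
    by move=> z; rewrite scaler_eq0 negb_or => /andP[_]; exact: etaS2.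
  by move=> z; rewrite scaler_eq0 negb_or => /andP[_ /etaS1 C1z] /C12; apply.
have G1off l z : ~ C1 z -> G1 l z = loop K z by move=> /eta01 e; apply: pert0; rewrite -/(eta1 z) e scaler0.
have G2off l z : ~ C2 z -> G2 l z = loop K z by move=> /eta02 e; apply: pert0; rewrite -/(eta2 z) e scaler0.
have GG1 l z : ~ C2 z -> G l z = G1 l z by move=> /eta02 e; apply: pert0; rewrite -/(eta2 z) e scaler0.
have GG2 l z : ~ C1 z -> G l z = G2 l z.
  by move=> /eta01 e; rewrite GE; apply: pert0; rewrite -/(eta1 z) e scaler0.
have G1K z : G1 (0, 0) z = loop K z by apply: pert0; rewrite scale0r.
pose l0 : R * R := (0, 0).
have cK : \forall l \near l0, forall z, C1at (fun _ : R * R => loop K) (l, z).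
  by apply: filterE => l z; exact: C1at_knot.
have pKn : \forall l \near l0, forall z, loop K (z + 1) = loop K z.
  by apply: filterE => l; exact: (pk_per pK).
have e1 : \forall l \near l0, {for l, continuous (fst : R * R -> R)}.
  by apply: filterE => l; exact: cvg_fst.
have e2 : \forall l \near l0, {for l, continuous (snd : R * R -> R)}.
  by apply: filterE => l; exact: cvg_snd.
have H1 := near_pert_C1 (l0 := l0) apsi1 cK pKn e1 erefl etaC1 per1 etaS1 clC1
  (site_per st1) (site_dom st1).
have H2 := near_pert_C1 (l0 := l0) apsi2 cK pKn e2 erefl etaC2 per2 etaS2 clC2
  (site_per st2) (site_dom st2).
have cG1 : \forall l \near l0, forall z, C1at G1 (l, z) by apply: filterS H1 => l [].
have pG1 : \forall l \near l0, forall z, G1 l (z + 1) = G1 l z.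
  by apply: filterE => l z; rewrite /G1 /bump_push /pert bump_periodic ?rpred1// (pk_per pK).
have H3 : \forall l \near l0, forall z, C1at G (l, z).
  have dG1 z : C2 z -> cdom psi2 (G1 l0 z) by move=> Cz; rewrite G1K; exact: (site_dom st2 Cz).
  have := near_pert_C1 (l0 := l0) apsi2 cG1 pG1 e2 erefl etaC2 per2 etaS2 clC2 (site_per st2) dG1.
  by apply: filterS => l [].
have pG : \forall l \near l0, forall z, G l (z + 1) = G l z.
  apply: filterS pG1 => l G1l z; rewrite /G /bump_push /pert bump_periodic ?rpred1//.
  by rewrite G1l.
pose C := C1 `|` C2.
pose io : 'I_n -> 'I_n.+2 := fintype.lift i \o fintype.lift j.
have cst_cross u v k : loop K u = vertex K k -> loop K v = vertex K k ->
    forall A B, nbhs u A -> nbhs v B -> \forall l \near l0, exists x' y', [/\ A x', B y' & loop K x' = loop K y'].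
  move=> Ku Kv A B nA nB; apply: filterE => l; exists u, v.
  by split; [exact: nbhs_singleton|exact: nbhs_singleton|rewrite Ku Kv].
have ctsb x r d : {for x, continuous (fun z : R => bump x r z *: d : 'rV[R]_3)}.
  have [c _ _] := C1v_bump x r d (0 : R, x).
  have xc : {for x, continuous (fun z : R => (0 : R, z))}.
    by apply: (@cvg_pair _ _ _ _ (nbhs (0 : R)) (nbhs x)); [exact: cvg_cst|exact: cvg_id].
  exact: (@continuous_comp _ _ _ _ (fun v : R * R => bump x r v.2 *: d) x xc c).
have dx1 : cdom psi1 (loop K x1) by rewrite Kx1.
have dx2 : cdom psi2 (loop K x2) by rewrite Kx2.
have sep1 : \forall v \near (l0, (x1, y1)), 0 < v.1.1 -> G1 v.1 v.2.1 <> G1 v.1 v.2.2.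
  have S : sided b psi1 (fun _ : R * R => loop K) G1 (fun l => 0 < l.1) l0 x1 y1.
    apply: (@sided_pert R M _ b psi1 psi1 (fun=> loop K) (fun l => l.1) eta1 l0 x1 y1 apsi1 apsi1).
    - exact: C1at_knot.
    - exact: C1at_knot.
    - exact: etrans Kx1 (esym Ky1).
    - exact: dx1.
    - exact: dx1.
    - exact: cvg_fst.
    - by [].
    - exact: ctsb.
    - by apply: filterS (nC1 _ nC1y1) => z; exact: eta01.
    - by rewrite /eta1 det3Z; apply: signedZ => //; apply: bump_gt0; case: sr1.
  exact: (sided_separated apsi1 (C1at_knot K (l0, x1)) (C1at_knot K (l0, y1)) dx1
    (etrans Kx1 (esym Ky1)) (cst_cross _ _ _ Kx1 Ky1) S).
have sep2 : \forall v \near (l0, (x2, y2)), 0 < v.1.2 -> G2 v.1 v.2.1 <> G2 v.1 v.2.2.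
  have S : sided b' psi2 (fun _ : R * R => loop K) G2 (fun l => 0 < l.2) l0 x2 y2.
    apply: (@sided_pert R M _ b' psi2 psi2 (fun=> loop K) (fun l => l.2) eta2 l0 x2 y2 apsi2 apsi2).
    - exact: C1at_knot.
    - exact: C1at_knot.
    - exact: etrans Kx2 (esym Ky2).
    - exact: dx2.
    - exact: dx2.
    - exact: cvg_snd.
    - by [].
    - exact: ctsb.
    - by apply: filterS (nC2 _ nC2y2) => z; exact: eta02.
    - by rewrite /eta2 det3Z; apply: signedZ => //; apply: bump_gt0; case: sr2.
  exact: (sided_separated apsi2 (C1at_knot K (l0, x2)) (C1at_knot K (l0, y2)) dx2
    (etrans Kx2 (esym Ky2)) (cst_cross _ _ _ Kx2 Ky2) S).
have pair_near (D : set R) (u v : R) : (\forall z \near u, D z) -> (\forall z \near v, D z) ->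
    \forall w \near (l0, (u, v)), D w.2.1 /\ D w.2.2.
  move=> nu nv; apply: (@near_pullr _ _ (fun w : R * R => D w.1 /\ D w.2) l0 (u, v)).
  by exists (D, D).
pose Q (l : R * R) := 0 < l.1 /\ 0 < l.2.
have sepi : \forall v \near (l0, (x1, y1)), Q v.1 -> G v.1 v.2.1 <> G v.1 v.2.2.
  have np := pair_near (fun z => ~ C2 z) _ _ (nC2 _ nC2x1) (nC2 _ nC2y1).
  by apply: filterS2 np sep1 => v [Ca Cb] s [v0 _]; rewrite !GG1//; exact: s.
have sepj : \forall v \near (l0, (x2, y2)), Q v.1 -> G v.1 v.2.1 <> G v.1 v.2.2.
  have np := pair_near (fun z => ~ C1 z) _ _ (nC1 _ nC1x2) (nC1 _ nC1y2).
  by apply: filterS2 np sep2 => v [Ca Cb] s [_ v0]; rewrite !GG2//; exact: s.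
have io_not k : io k <> i /\ io k <> j0.
  split; first by move/eqP; rewrite eq_sym (negbTE (neq_lift _ _)).
  by move=> /lift_inj/eqP; rewrite eq_sym (negbTE (neq_lift _ _)).
have H4 : \forall l \near l0, 0 < l.1 /\ 0 < l.2 -> is_singular_knot (G l) (vertex K \o io).
  apply: (@near_resolved_knot R M _ l0 n.+2 n io (fun=> underlying K) G C Q).
  - by move=> k k' /lift_inj/lift_inj.
  - by move=> z; exact: C1at_knot.
  - by move=> k; exact: cvg_cst.
  - exact: H3.
  - exact: pG.
  - by move=> z; rewrite /G /bump_push pert0 ?scale0r//; exact: G1K.
  - exact: closedU.
  - by move=> z k ki [/(bump_support_int ki)|/(bump_support_int ki)]; [left|right].
  - apply: filterE => l z nC; have na : ~ C1 z by move=> ?; apply: nC; left.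
    by rewrite GG2// G2off// => Cz; apply: nC; right.
  - move=> k z Kz [/C1t/(_ Kz)|/C2t/(_ Kz)]; [exact: (io_not k).1|exact: (io_not k).2].
  - move=> k nk; have [->|->] : k = i \/ k = j0.
      case: (unliftP i k) nk => [l ->|->]; last by left.
      case: (unliftP j l) => [m ->|->]; last by right.
      by move=> /(_ m).
    + move=> x y xy Kx Ky; have S := separated_times pG Kx1 Ky1 xy1 sepi xy Kx Ky; exact: S.
    + move=> x y xy Kx Ky; have S := separated_times pG Kx2 Ky2 xy2 sepj xy Kx Ky; exact: S.
have g1 : germ K psi1 x1 y1 C1 b (bump_push psi1 x1 r1 d1 (loop K)).
  apply: (bump_germ st1 apsi1 (site_dom st1) dv1 _ (@subset_refl _ _)) => //.
  - by rewrite subrr rpred0.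
  - by case: sr1.
have g2 : germ K psi2 x2 y2 C2 b' (bump_push psi2 x2 r2 d2 (loop K)).
  apply: (bump_germ st2 apsi2 (site_dom st2) dv2 _ (@subset_refl _ _)) => //.
  - by rewrite subrr rpred0.
  - by case: sr2.
have N1 := near_germ_knot hP st1 g1; have N2 := near_germ_knot hP st2 g2.
have S1 := near_interpolate st1 g1 g1; have S2 := near_interpolate st2 g2 g2.
have sk1 : \forall e \near (0 : R), 0 < e ->
    is_singular_knot (bump_push psi1 x1 r1 d1 (loop K) e) (vertex K \o fintype.lift i).
  apply: filterS S1 => e He e0; have [Hk _ Hf _] := He e0.
  have -> : bump_push psi1 x1 r1 d1 (loop K) e = _ := esym (funext Hf).
  by apply: Hk; rewrite lexx ler01.
have sk2 : \forall e \near (0 : R), 0 < e ->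
    is_singular_knot (bump_push psi2 x2 r2 d2 (loop K) e) (vertex K \o fintype.lift j0).
  apply: filterS S2 => e He e0; have [Hk _ Hf _] := He e0.
  have -> : bump_push psi2 x2 r2 d2 (loop K) e = _ := esym (funext Hf).
  by apply: Hk; rewrite lexx ler01.
(* All pairs of heights in the square (0, e] x (0, e] are admissible, which covers the stages of the
   pushes in both orders. *)
have [e e0 eP] : exists2 e : R, 0 < e & forall s t, 0 < s <= e -> 0 < t <= e ->
   [/\ is_singular_knot (G (s, t)) (vertex K \o io),
       is_singular_knot (bump_push psi1 x1 r1 d1 (loop K) s) (vertex K \o fintype.lift i),
       is_singular_knot (bump_push psi2 x2 r2 d2 (loop K) s) (vertex K \o fintype.lift j0),
       (forall z, C1 z -> (cmap psi1 @` cdom psi1) (cmap psi1 (loop K z) + s *: eta1 z)) &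
       (forall z, C2 z -> (cmap psi2 @` cdom psi2) (cmap psi2 (loop K z) + t *: eta2 z))].
  have [[A B] [/= nA nB] AB] := filterI H4 (filterI H1 H2).
  have nA' : \forall e \near (0 : R), A e by exact: nA.
  have nB' : \forall e \near (0 : R), B e by exact: nB.
  have nAB : \forall e \near (0 : R), (A e /\ B e) /\
      ((0 < e -> is_singular_knot (bump_push psi1 x1 r1 d1 (loop K) e) (vertex K \o fintype.lift i)) /\
       (0 < e -> is_singular_knot (bump_push psi2 x2 r2 d2 (loop K) e) (vertex K \o fintype.lift j0))).
    near=> e; split; split; near: e; assumption.
  move: nAB => /nbhs_ballP[c /= c0 cP].
  have sm s : 0 < s <= c / 2 -> ball (0 : R) c s.
    exact: ball_half.
  exists (c / 2); first by rewrite divr_gt0.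
  move=> s t sc tc; have [[As _] [k1 k2]] := cP _ (sm s sc); have [[_ Bt] _] := cP _ (sm t tc).
  have [h4 [[_ h1] [_ h2]]] := AB (s, t) (conj As Bt).
  have s0 : 0 < s by case/andP: sc.
  have t0 : 0 < t by case/andP: tc.
  split; [exact: h4|exact: k1|exact: k2| |].
  - by move=> z /h1[].
  - by move=> z /h2[].
have scale t : 0 < t <= 1 -> 0 < t * e <= e.
  by move=> /andP[t0 t1]; rewrite mulr_gt0//= ler_piMl// ltW.
have ee : 0 < e <= e by rewrite e0 lexx.
have [skG skK1 skK2 _ _] := eP e e ee ee.
have PK1 : P n.+1 (SKnot skK1).
  apply: (hP n.+1 K i) => //; first exact: knotP.
  move=> k z /= Kz; rewrite -Kz; apply: (G1off (e, 0)) => /C1t/(_ Kz)/eqP.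
  by rewrite eq_sym (negbTE (neq_lift _ _)).
have PK2 : P n.+1 (SKnot skK2).
  apply: (hP n.+1 K j0) => //; first exact: knotP.
  move=> k z /= Kz; rewrite -Kz; apply: (G2off (0, e)) => /C2t/(_ Kz)/eqP.
  by rewrite eq_sym (negbTE (neq_lift _ _)).
have PN : P n (SKnot skG).
  apply: (hP n (SKnot skK1) j) => //.
  move=> k z /= Kz; rewrite -Kz; apply: (GG1 (e, e)) => Cz.
  have Kz' : loop K z = vertex K (io k) by rewrite -(G1off (e, 0))//; exact: C12.
  by case: (io_not k) => _; apply; exact: C2t Cz Kz'.
exists (Knot PK1), (Knot PK2), (Knot PN).
have [r102 r202] := (sr1.1, sr2.1).
have rr1 : 0 < r1 by case/andP: r102.
have rr2 : 0 < r2 by case/andP: r202.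
split.
- apply: (@bump_push_resolves _ _ b n.+1 i K _ psi1 x1 x1 y1 r1 d1 e apsi1 Kx1 Ky1 xy1).
  + exact: r102.
  + by rewrite subrr normr0.
  + exact: sr1.2.
  + exact: sg1.
  + exact: e0.
  + by move=> t /scale st; have [_ ? _ _ _] := eP _ _ st st.
  + by move=> t z /scale st Cz; have [_ _ _ im _] := eP _ _ st st; exact: im.
  + by [].
  + by [].
- apply: (@second_push b' n K i j _ _ psi2 x2 y2 r2 d2 e C1 clC1).
  + by move=> z nC; exact: (G1off (e, 0)).
  + by [].
  + exact: apsi2.
  + exact: Kx2.
  + exact: Ky2.
  + exact: xy2.
  + exact: sr2.
  + exact: C12.
  + exact: nC1y2.
  + exact: sg2.
  + exact: e0.
  + by move=> t /scale st; have [? _ _ _ _] := eP _ _ ee st.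
  + by move=> t z /scale st Cz; have [_ _ _ _ im] := eP _ _ st st; exact: im.
  + by [].
  + by [].
- apply: (@bump_push_resolves _ _ b' n.+1 j0 K _ psi2 x2 x2 y2 r2 d2 e apsi2 Kx2 Ky2 xy2).
  + exact: r202.
  + by rewrite subrr normr0.
  + exact: sr2.2.
  + exact: sg2.
  + exact: e0.
  + by move=> t /scale st; have [_ _ ? _ _] := eP _ _ st st.
  + by move=> t z /scale st Cz; have [_ _ _ _ im] := eP _ _ st st; exact: im.
  + by [].
  + by [].
- have voE : vertex K \o io = (vertex K \o fintype.lift j0) \o fintype.lift i'.
    by apply/funext => k; rewrite /io /= (lift_lift ii').
  apply: (@second_push b n K j0 i' _ _ psi1 x1 y1 r1 d1 e C2 clC2); rewrite ?ii'.
  + by move=> z nC; exact: (G2off (0, e)).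
  + by [].
  + exact: apsi1.
  + exact: Kx1.
  + exact: Ky1.
  + exact: xy1.
  + exact: sr1.
  + by move=> z C1z /C12; apply.
  + exact: nC2y1.
  + exact: sg1.
  + exact: e0.
  + move=> t /scale st; have [sG _ _ _ _] := eP _ _ st ee.
    by move: sG; rewrite GE voE.
  + by move=> t z /scale st Cz; have [_ _ _ im _] := eP _ _ st st; exact: im.
  + by move=> z; rewrite -(congr1 (fun f => f z) (GE (e, e))).
  + by move=> k; rewrite /= /io /= (lift_lift ii').
Unshelve. all: by end_near.
Qed.

End DoubleResolutions.

(** * Natural orderings *)

Section Sorting.
Context {R : realType} {n : nat} (f : 'I_n -> R).

(** For injective f, the position of i in increasing order of values; its inverse is the sorting
    permutation. *)
Definition rank (i : 'I_n) : nat := #|[set j | f j < f i]%SET|.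

Lemma rank_lt i j : f i < f j -> (rank i < rank j)%N.
Proof.
move=> ij; apply: proper_card; rewrite properE; apply/andP; split.
  by apply/fintype.subsetP => k; rewrite !inE => /lt_trans; apply.
by apply/subsetPn; exists i; rewrite !inE ?ltxx.
Qed.

Lemma rank_bound i : (rank i < n)%N.
Proof.
rewrite -[X in (_ < X)%N]card_ord -cardsT; apply: proper_card.
by rewrite properE finset.subsetT/=; apply/subsetPn; exists i; rewrite ?inE ?ltxx.
Qed.

Lemma rank_sorted (s : 'S_n) : (forall i j : 'I_n, (i < j)%N -> f (s i) < f (s j)) ->
  forall i, rank (s i) = i.
Proof.
move=> fs i; rewrite /rank -(card_preimset _ (@perm_inj _ s)) -sum1_card.
rewrite (eq_bigl (fun j : 'I_n => (j < i)%N)).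
  by rewrite -(big_ord_widen n (fun=> 1%N) (ltnW (ltn_ord i))) sum1_card card_ord.
move=> j; rewrite !inE; case: (ltngtP j i) => [/fs //|/fs ij|/val_inj ->]; last by rewrite ltxx.
by apply/negbTE; rewrite -leNgt ltW.
Qed.

Lemma sorting_exists : injective f ->
  exists s : 'S_n, forall i j : 'I_n, (i < j)%N -> f (s i) < f (s j).
Proof.
move=> finj; pose r i := Ordinal (rank_bound i).
have rinj : injective r.
  move=> i j /(congr1 val) /= e; apply: finj.
  by case: (ltgtP (f i) (f j)) => // /rank_lt; rewrite e ltnn.
exists (perm rinj)^-1%g => i j ij; rewrite ltNge le_eqVlt; apply/negP => /orP[/eqP/finj/perm_inj e|/rank_lt].
  by rewrite e ltnn in ij.
have E k : rank ((perm rinj)^-1%g k) = k.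
  by have := congr1 val (permKV (perm rinj) k); rewrite permE.
by rewrite !E ltnNge ltnW.
Qed.

Lemma sorting_unique (s t : 'S_n) : injective f ->
  (forall i j : 'I_n, (i < j)%N -> f (s i) < f (s j)) ->
  (forall i j : 'I_n, (i < j)%N -> f (t i) < f (t j)) -> s = t.
Proof.
move=> finj fs ft; apply/permP => i; apply: finj.
by case: (ltgtP (f (s i)) (f (t i))) => // /rank_lt; rewrite !rank_sorted// ltnn.
Qed.

End Sorting.

(** * First meeting times of based knots *)

Section NaturalOrder.
Context {R : realType} {M : oriented_3manifold R}.

Definition first_times n (K : @sknot R M n) (f : 'I_n -> R) : Prop := forall i,
  [/\ 0 <= f i < 1, loop K (f i) = vertex K i &
      forall z, 0 <= z < 1 -> loop K z = vertex K i -> f i <= z].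

Lemma first_times_exist n (K : @sknot R M n) : exists f, first_times K f.
Proof.
suff /choice[f fP] : forall i, exists x, [/\ 0 <= x < 1, loop K x = vertex K i &
    forall z, 0 <= z < 1 -> loop K z = vertex K i -> x <= z] by exists f.
move=> i; have [x [y [/andP[x0 xy] y1 Kx _ Kz]]] := vertex_double (sknotP K) i.
exists x; split=> //; first by rewrite x0 (lt_trans xy).
by move=> z z01 /(Kz _ z01)[->|->] //; exact: ltW.
Qed.

Lemma first_times_inj n (K : @sknot R M n) f : first_times K f -> injective f.
Proof.
move=> fK i j e; have [_ Ki _] := fK i; have [_ Kj _] := fK j.
by apply: (vertex_injective (sknotP K)); rewrite -Ki -Kj e.
Qed.

Definition met_before n (K : @sknot R M n) (i j : 'I_n) : Prop :=
  exists2 x, 0 <= x < 1 /\ loop K x = vertex K i &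
    forall y, 0 <= y < 1 -> loop K y = vertex K j -> x < y.

Lemma met_beforeP n (K : @sknot R M n) f i j : first_times K f ->
  met_before K i j <-> f i < f j.
Proof.
move=> fK; have [fi Ki Hi] := fK i; have [fj Kj Hj] := fK j; split.
  by move=> [x [x01 Kx] Hx]; apply: le_lt_trans (Hi _ x01 Kx) (Hx _ fj Kj).
by move=> ij; exists (f i) => // y y01 Ky; apply: lt_le_trans ij (Hj _ y01 Ky).
Qed.

Lemma naturally_based_reorder n (K : @sknot R M n) f (s : 'S_n) : first_times K f -> based K ->
  naturally_based (reorder s K) <-> forall i j : 'I_n, (i < j)%N -> f (s i) < f (s j).
Proof.
move=> fK bK; split=> [[_ nK] i j /nK|H]; first by move/(met_beforeP _ _ fK).
by split=> [i|i j /H /(met_beforeP _ _ fK)//]; exact: bK.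
Qed.

Lemma natural_order_exists n (K : @sknot R M n) : based K -> exists s, naturally_based (reorder s K).
Proof.
move=> bK; have [f fK] := first_times_exist K.
by have [s sP] := sorting_exists (first_times_inj fK); exists s; apply/(naturally_based_reorder _ fK bK).
Qed.

Lemma natural_order_unique n (K : @sknot R M n) s t : based K ->
  naturally_based (reorder s K) -> naturally_based (reorder t K) -> s = t.
Proof.
move=> bK; have [f fK] := first_times_exist K.
move=> /(naturally_based_reorder _ fK bK) fs /(naturally_based_reorder _ fK bK) ft.
exact: sorting_unique (first_times_inj fK) fs ft.
Qed.

(** No double point lies at the base point, so all times involved are inside (0, 1) and nearby times
    do not jump across 0. The midpoint m separates the first time of i from both times of j, and
    this persists for the tracked times. *)
Lemma near_met_before n (p : R -> @sknot R M n) s0 i j : knot_path p -> based (p s0) ->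
  met_before (p s0) i j -> \forall s \near s0, met_before (p s) i j.
Proof.
move=> pp b0; have [f fK] := first_times_exist (p s0) => /(met_beforeP _ _ fK) fij.
pose m := (f i + f j) / 2.
have times k : exists x y, [/\ 0 < x < 1, 0 < y < 1, f k = x, x < y &
    [/\ loop (p s0) x = vertex (p s0) k, loop (p s0) y = vertex (p s0) k & y - x \isn't a Num.int]].
  have [x [y [/andP[x0 xy] y1 Kx Ky Kz]]] := vertex_double (sknotP (p s0)) k.
  have [f01 Kf Hf] := fK k.
  have xn0 : x != 0 by apply/eqP => e; case: (b0 k); rewrite -Kx e.
  have x01 : 0 < x < 1 by rewrite lt_neqAle eq_sym xn0 x0/= (lt_trans xy).
  exists x, y; split=> //.
  - by rewrite y1 (le_lt_trans x0 xy).
  - apply/eqP; rewrite eq_le Hf ?x0 ?(lt_trans xy y1)//=.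
    by case: (Kz _ f01 Kf) => ->//; exact: ltW.
  - by split=> //; apply: not_int_unit y1; rewrite x0.
have [xi [yi [xi1 yi1 fi xyi [Kxi Kyi ni]]]] := times i.
have [xj [yj [xj1 yj1 fj xyj [Kxj Kyj nj]]]] := times j.
have nI (x : R) : 0 < x < 1 -> \forall z \near x, 0 < z < 1.
  by move=> x1; have := @near_in_itvoo R 0 1 x; rewrite in_itv/= => /(_ x1); apply: filterS => z; rewrite in_itv.
have ni' : nbhs xi [set z | 0 < z < 1 /\ z < m].
  by apply: filterI; [exact: nI|apply: lt_nbhsl; rewrite /m -fi; lra].
have nj' x : 0 < x < 1 -> xj <= x -> nbhs x [set z | 0 < z < 1 /\ m < z].
  by move=> x1 xx; apply: filterI; [exact: nI|apply: lt_nbhsr; rewrite /m; lra].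
have Ti := track_times pp Kxi Kyi ni ni' (nI _ yi1).
have Tj := track_times pp Kxj Kyj nj (nj' _ xj1 (lexx _)) (nj' _ yj1 (ltW xyj)).
apply: filterS2 Ti Tj => s [x [_ [[x01 xm] _ Kx _ _]]] [x' [y' [[x'01 mx'] [y'01 my'] _ _ [_ H]]]].
exists x; first by split=> //; case/andP: x01 => x0 ->; rewrite ltW.
have co (a y : R) : 0 < a < 1 -> 0 <= y < 1 -> y - a \is a Num.int -> a = y.
  by move=> /andP[a0 a1] y01; apply: unit_int_eq => //; rewrite ltW.
by move=> y y01 /H[/(co _ _ x'01 y01) <-|/(co _ _ y'01 y01) <-]; [exact: lt_trans xm mx'|exact: lt_trans xm my'].
Qed.

Lemma knot_path_reorder n (p : R -> @sknot R M n) (s : 'S_n) :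
  knot_path p -> knot_path (fun t => reorder s (p t)).
Proof. by move=> [pc pC1 pv]; split=> // i; exact: pv. Qed.

Lemma locally_constant_line (E : R -> R -> Prop) :
  (forall s, E s s) -> (forall s t, E s t -> E t s) ->
  (forall r s t, E r s -> E s t -> E r t) ->
  (forall s, \forall t \near s, E s t) -> forall t, E 0 t.
Proof.
move=> Er Es Et En t.
have := @locally_constant R (fun a b => E (a * t) (b * t)); rewrite mul0r mul1r; apply.
- by move=> s; exact: Er.
- by move=> s u; exact: Es.
- by move=> r s u; exact: Et.
- move=> s; have ct : (fun a => a * t) @ s --> s * t by apply: cvgM; [exact: cvg_id|exact: cvg_cst].
  exact: ct _ (En (s * t)).
Qed.

Lemma natural_order_path n (p : R -> @sknot R M n) s : knot_path p -> (forall t, based (p t)) ->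
  naturally_based (reorder s (p 0)) -> forall t, naturally_based (reorder s (p t)).
Proof.
move=> pp bp n0 t; pose E a b :=
  exists u, naturally_based (reorder u (p a)) /\ naturally_based (reorder u (p b)).
suff [u [/(natural_order_unique (bp 0) n0) -> //]] : E 0 t.
apply: locally_constant_line => [a|a b [u [? ?]]|a b c [u [ua ub]] [v [vb vc]]|a].
- by have [u nu] := natural_order_exists (bp a); exists u.
- by exists u.
- by exists u; split=> //; rewrite (natural_order_unique (bp b) ub vb).
- have [u nu] := natural_order_exists (bp a).
  have H : \forall b \near a, forall i j : 'I_n, (i < j)%N -> met_before (reorder u (p b)) i j.
    apply: near_forall => i; apply: near_forall => j; case: (ltnP i j) => ij; last first.
      by apply: filterE.
    have [_ /(_ _ _ ij) nij] := nu.
    have := near_met_before (knot_path_reorder u pp) _ nij; move=> /(_ nu.1).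
    by apply: filterS.
  by apply: filterS H => b Hb; exists u; split=> //; split=> // i; exact: bp.
Qed.

Lemma reorderK n (s : 'S_n) (K : @sknot R M n) : reorder s^-1%g (reorder s K) = K.
Proof. by apply: sknot_ext => i //=; rewrite permKV. Qed.

(** The sorting permutation is constant along a based isotopy, by [natural_order_path]; reordering
    the whole isotopy by it gives one of naturally based knots. *)
Lemma natural_isotopic n (K L : knot (@based R M) n) (s t : 'S_n) (N N' : knot (@naturally_based R M) n) :
  isotopic K L -> underlying K = reorder s N -> underlying L = reorder t N' -> s = t /\ isotopic N N'.
Proof.
move=> [p [pp p0 p1]] KN LN'.
have NK : underlying N = reorder s^-1%g K by rewrite KN reorderK.
have NL : underlying N' = reorder t^-1%g L by rewrite LN' reorderK.
have n0 : naturally_based (reorder s^-1%g (underlying (p 0))) by rewrite p0 -NK; exact: knotP.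
have nt := natural_order_path pp (fun u => knotP (p u)) n0.
have st : s = t.
  apply: invg_inj; apply: (natural_order_unique (knotP L)); first by rewrite -p1.
  by rewrite -NL; exact: knotP.
split=> //; exists (fun u => Knot (nt u)); split.
- exact: knot_path_reorder.
- by apply: knot_ext => z /=; rewrite p0 NK.
- by apply: knot_ext => z /=; rewrite p1 NL -st.
Qed.

Lemma natural_decomposition n (K : knot (@based R M) n) :
  exists (s : 'S_n) (N : knot (@naturally_based R M) n), underlying K = reorder s N.
Proof.
have [s sK] := natural_order_exists (knotP K).
by exists s^-1%g, (Knot sK); rewrite /= reorderK.
Qed.

Lemma isotopic_forget (P : @structure R M) n (K L : knot P n) :
  isotopic K L -> isotopic (forget K) (forget L).
Proof. by move=> [p [pp <- <-]]; exists (fun t => forget (p t)). Qed.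

(** A permutation carries the complement of i to that of [s i]; renumbering both gives [s']. *)
Lemma perm_lift n (s : 'S_n.+1) i : exists s' : 'S_n, s = lift_perm i (s i) s'.
Proof.
have H k : exists l, s (fintype.lift i k) = fintype.lift (s i) l.
  case: (unliftP (s i) (s (fintype.lift i k))) => [l ->|/perm_inj/eqP]; first by exists l.
  by rewrite eq_sym (negbTE (neq_lift _ _)).
have [g gP] := choice H.
have ginj : injective g.
  by move=> k l e; apply: (@lift_inj _ i); apply: (@perm_inj _ s); rewrite !gP e.
exists (perm ginj); apply/permP => k; case: (unliftP i k) => [l ->|->].
  by rewrite lift_perm_lift permE gP.
by rewrite lift_perm_id.
Qed.

(** The same push serves for both orderings; only the labels of the kept vertices are translated, by
    [s']. *)
Lemma resolves_reorder b n (s : 'S_n.+1) (s' : 'S_n) (i : 'I_n.+1) (K : @sknot R M n.+1) (K' : @sknot R M n) :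
  s = lift_perm i (s i) s' -> resolves b (s i) K K' -> resolves b i (reorder s K) (reorder s' K').
Proof.
move=> sE [D [lK' vK']].
have vE : (vertex K \o fintype.lift (s i)) \o s' = (vertex K \o s) \o fintype.lift i.
  by apply/funext => k /=; rewrite [in RHS]sE lift_perm_lift.
have sk t : 0 < t <= 1 -> is_singular_knot (pushed D t) (vertex (reorder s K) \o fintype.lift i).
  by move=> t01; have := reorder_subproof s' (SKnot (pushed_knot D t01)); rewrite /= vE.
have av z j : push_a D <= z <= push_c D -> loop K z = vertex (reorder s K) j -> z = push_x D.
  exact: push_arc_vertex.
exists (@Push R M b n i (reorder s K) (push_chart D) (push_x D) (push_y D) (push_a D) (push_c D)
  (push_height D) (push_dir D) (pushed D) (push_atlas D) (push_xP D) (push_yP D) (@push_xy _ _ _ _ _ _ D)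
  (push_arc D) (push_arc_short D) (@push_arc_dom _ _ _ _ _ _ D) av (push_height_gt0 D) (push_sign D)
  (@pushed_arc _ _ _ _ _ _ D) (@pushed_off_arc _ _ _ _ _ _ D) sk).
by split=> // k; rewrite /= vK' /= -[LHS]/(((vertex K \o fintype.lift (s i)) \o s') k) vE.
Qed.

End NaturalOrder.

(** * Chain complexes *)

Section LinearMaps.
Context {V W : lmodType rat} (f : V -> W) (lf : linear f).

Lemma linear0f : f 0 = 0.
Proof. by have := lf (-1) 0 0; rewrite scaler0 add0r scaleN1r addNr. Qed.

Lemma linearDf u v : f (u + v) = f u + f v.
Proof. by have := lf 1 u v; rewrite !scale1r. Qed.

Lemma linearZf a u : f (a *: u) = a *: f u.
Proof. by have := lf a u 0; rewrite linear0f !addr0. Qed.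

Lemma linearBf u v : f (u - v) = f u - f v.
Proof. by rewrite linearDf -scaleN1r linearZf scaleN1r. Qed.

Lemma linear_sumf (I : Type) (r : seq I) (P : pred I) (F : I -> V) :
  f (\sum_(i <- r | P i) F i) = \sum_(i <- r | P i) f (F i).
Proof. exact: (big_morph f linearDf linear0f). Qed.

Lemma linear_mspan (S : set V) (T : set W) : (forall x, S x -> mspan T (f x)) ->
  forall x, mspan S x -> mspan T (f x).
Proof.
move=> ST x Sx; apply: (Sx [set y | mspan T (f y)]); split=> //; split.
  by rewrite /= linear0f; exact: mspan0.
by move=> a u v /= Tu Tv; rewrite lf; apply: mspanD => //; exact: mspanZ.
Qed.

End LinearMaps.

Lemma mspan_gen (V : lmodType rat) (S : set V) x : S x -> mspan S x.
Proof. by move=> Sx U [_]; apply. Qed.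

Lemma mspan_sum (V : lmodType rat) (S : set V) (I : finType) (F : I -> V) :
  (forall i, mspan S (F i)) -> mspan S (\sum_i F i).
Proof. by move=> SF; elim/big_ind: _ => //; [exact: mspan0|move=> x y; exact: mspanD]. Qed.

Lemma linear_comp (U V W : lmodType rat) (g : V -> W) (f : U -> V) :
  linear g -> linear f -> linear (g \o f).
Proof. by move=> lg lf a u v /=; rewrite lf lg. Qed.

Section FreeModule.
Context {K : choiceType} {V : lmodType rat}.

Lemma freegZ (c : rat) (x : K) : << c *g x >> = c *: << x >> :> {freeg K / rat}.
Proof. by apply/eqP/freeg_eqP => y; rewrite coeffZ !coeffU mul1r. Qed.

Lemma freeg_ind (U : set {freeg K / rat}) : submodule_pred U -> (forall x, U << x >>) -> forall c, U c.
Proof.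
move=> [U0 UD] Ux c; rewrite -(freeg_sumE c); elim/big_ind: _ => [//|u v Uu Uv|x _].
  by rewrite -[u]scale1r; exact: UD.
by rewrite freegZ -[_ *: _]addr0; exact: UD.
Qed.

Lemma fglift_linear (f : K -> V) : linear (fglift f : {freeg K / rat} -> V).
Proof.
have fD : {morph fglift f : u v / u + v}.
  move=> u v; have fB := @lift_is_additive _ K V f; have f0 : fglift f 0 = 0.
    by have := fB 0 0; rewrite !subrr.
  have fN w : fglift f (- w) = - fglift f w by have := fB 0 w; rewrite !sub0r f0 sub0r.
  by have := fB u (- v); rewrite fN !opprK.
have f0 : fglift f 0 = 0 by apply: (@addrI _ (fglift f 0)); rewrite -fD !addr0.
move=> a u v; rewrite fD; congr (_ + _); rewrite -(freeg_sumE u) scaler_sumr.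
rewrite !(big_morph (fglift f) fD f0) scaler_sumr; apply: eq_bigr => x _.
have -> : a *: << coeff x u *g x >> = << (a * coeff x u) *g x >> :> {freeg K / rat}.
  by rewrite freegZ scalerA -freegZ.
by rewrite !liftU scalerA.
Qed.

Lemma fgliftU1 (f : K -> V) x : fglift f << x >> = f x.
Proof. by rewrite liftU scale1r. Qed.

Lemma eq_linear_freeg (f g : {freeg K / rat} -> V) : linear f -> linear g ->
  (forall x, f << x >> = g << x >>) -> forall c, f c = g c.
Proof.
move=> lf lg fg; apply: (@freeg_ind [set c | f c = g c]) => //.
split=> [|a u v /= e1 e2]; first by rewrite /= (linear0f lf) (linear0f lg).
by rewrite lf lg e1 e2.
Qed.

End FreeModule.

Section Quotients.
Context {V W : lmodType rat} (S : set V) (T : set W) (f : V -> W).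
Hypotheses (lf : linear f) (ST : forall x, S x -> mspan T (f x)).

Lemma mquot_mapE x : mquot_map T f (mproj S x) = mproj T (f x).
Proof.
apply/mprojP; rewrite -(linearBf lf); apply: (linear_mspan lf ST).
exact: mrepr_proj.
Qed.

Lemma mquot_map_linear : linear (mquot_map T f : mquot S -> mquot T).
Proof.
move=> a x y; rewrite -(mreprK x) -(mreprK y) -mproj_linear !mquot_mapE.
by rewrite lf mproj_linear.
Qed.

End Quotients.

Lemma relative_chain_complexP (C : nat -> lmodType rat) (d : forall n, C n.+1 -> C n)
    (D : forall n, set (C n)) : chain_complex d ->
  (forall n c, D n.+1 c -> mspan (D n) (d n c)) -> relative_chain_complex d D.
Proof.
move=> [ld dd0] dD.
have E n c : @induced_boundary C d D n (mproj (D n.+1) c) = mproj (D n) (d n c).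
  exact: (mquot_mapE (ld n) (dD n)).
split=> //; split=> [n|n c]; first exact: (mquot_map_linear (ld n) (dD n)).
by rewrite -(mreprK c) !E dd0.
Qed.

(** * Signs and indices in the squared boundary *)

Section BoundarySigns.

(* The pair (i, j) stands for the i-th double point followed by the j-th of    *)
(* the remaining ones; the swap lists the same two double points in the other  *)
(* order, so that the terms of d d cancel in pairs.                            *)
Definition face_swap n (p : 'I_n.+2 * 'I_n.+1) : 'I_n.+2 * 'I_n.+1 :=
  (fintype.lift p.1 p.2, odflt ord0 (unlift (fintype.lift p.1 p.2) p.1)).

Lemma face_swapP n (p : 'I_n.+2 * 'I_n.+1) :
  fintype.lift (face_swap p).1 (face_swap p).2 = p.1.
Proof.
rewrite /face_swap /=; case: unliftP => [k <-//|/esym /eqP].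
by rewrite eq_sym (negbTE (neq_lift _ _)).
Qed.

Lemma face_swapK n : involutive (@face_swap n).
Proof.
move=> p; have := face_swapP p; set q := face_swap p => e.
have e1 : (face_swap q).1 = p.1 by rewrite -e.
have := face_swapP q; rewrite e1 => /lift_inj e2.
by rewrite [LHS]surjective_pairing e1 e2 -surjective_pairing.
Qed.

Lemma face_swap_sign n (p : 'I_n.+2 * 'I_n.+1) :
  (-1) ^+ (face_swap p).1 * (-1) ^+ (face_swap p).2 = - ((-1) ^+ p.1 * (-1) ^+ p.2) :> rat.
Proof.
rewrite -!exprD -[RHS]mulN1r -exprS -signr_odd -[RHS]signr_odd; congr (_ ^+ (nat_of_bool _)).
have := congr1 val (face_swapP p); rewrite /face_swap /=; case: p => i j /=.
case: (odflt _ _) => k /= _; rewrite /fintype.bump; do ![case: leqP => ? /=]; lia.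
Qed.

End BoundarySigns.

(** * The four complexes and their maps *)

Section Complexes.
Context {R : realType} {M : oriented_3manifold R}.

Lemma pi_isotopic (P : @structure R M) n (K L : knot P n) : \pi_(X P n) K = \pi_(X P n) L <-> isotopic K L.
Proof. by split=> [/eqmodP/asboolP|h]//; apply/eqmodP/asboolP. Qed.

Lemma gen_isotopic (P : @structure R M) n (K L : knot P n) : isotopic K L -> gen K = gen L.
Proof. by move=> /pi_isotopic; rewrite /gen => ->. Qed.

Lemma repr_isotopic (P : @structure R M) n (K : knot P n) : isotopic (repr (\pi_(X P n) K)) K.
Proof. by apply/pi_isotopic; rewrite reprK. Qed.

Lemma eq_chain_maps (P : @structure R M) n (V : lmodType rat) (f g : chains P n -> V) :
  linear f -> linear g -> (forall K : knot P n, f (gen K) = g (gen K)) -> forall c, f c = g c.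
Proof. by move=> lf lg fg; apply: eq_linear_freeg => // x; rewrite -(reprK x); exact: fg. Qed.

Section Hereditary.
Context (P : @structure R M) (hP : hereditary P).

Lemma resolves_ex b n (i : 'I_n.+1) (K : knot P n.+1) : exists K' : knot P n, resolves b i K K'.
Proof. exact: (resolution_well_definedP hP b i (isotopic_refl K)).1. Qed.

Lemma resolves_isotopic b n (i : 'I_n.+1) (K L : knot P n.+1) (K' L' : knot P n) :
  isotopic K L -> resolves b i K K' -> resolves b i L L' -> isotopic K' L'.
Proof. move=> KL; exact: (resolution_well_definedP hP b i KL).2. Qed.

(** [resolution] is a chain with a default value, while this is a genuine map on isotopy classes;
    they agree by [resolution_res]. *)
Definition res b n (i : 'I_n.+1) (A : X P n.+1) : X P n :=
  \pi_(X P n) (projT1 (cid (resolves_ex b i (repr A)))).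

Lemma res_pi b n (i : 'I_n.+1) (K : knot P n.+1) (K' : knot P n) :
  resolves b i K K' -> res b i (\pi_(X P n.+1) K) = \pi_(X P n) K'.
Proof.
move=> rK; apply/pi_isotopic; case: cid => L /= rL.
exact: resolves_isotopic (repr_isotopic K) rL rK.
Qed.

Lemma resolution_res b n (i : 'I_n.+1) (A : X P n.+1) : resolution b i A = << res b i A >>.
Proof.
rewrite /resolution; case: xgetP => [c _ [K' rK' ->]|nex].
  by rewrite /gen -(res_pi rK') reprK.
by have [K' rK'] := resolves_ex b i (repr A); case: (nex (gen K')); exists K'.
Qed.

(** The precubical identity, read off the common knot of [double_resolution]. *)
Lemma res_res b b' n (i : 'I_n.+2) (j i' : 'I_n.+1) (A : X P n.+2) :
  fintype.lift (fintype.lift i j) i' = i ->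
  res b' j (res b i A) = res b i' (res b' (fintype.lift i j) A).
Proof.
move=> ii'; rewrite -(reprK A).
have [K1 [K2 [N [r1 r1N r2 r2N]]]] := double_resolution b b' (repr A) hP ii'.
by rewrite (res_pi r1) (res_pi r1N) (res_pi r2) (res_pi r2N).
Qed.

Lemma boundaryU n (A : X P n.+1) :
  boundary << A >> = \sum_(i < n.+1) (-1) ^+ i *: (<< res true i A >> - << res false i A >>) :> chains P n.
Proof. by rewrite /boundary fgliftU1; apply: eq_bigr => i _; rewrite /dd !resolution_res. Qed.

Lemma boundary_gen n (K : knot P n.+1) (K' : bool -> 'I_n.+1 -> knot P n) :
  (forall b i, resolves b i K (K' b i)) ->
  boundary (gen K) = \sum_(i < n.+1) (-1) ^+ i *: (gen (K' true i) - gen (K' false i)).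
Proof.
move=> rK; rewrite /gen boundaryU; apply: eq_bigr => i _.
by rewrite (res_pi (rK true i)) (res_pi (rK false i)).
Qed.

Lemma boundary_well_definedP : boundary_well_defined P.
Proof.
split; first exact: resolution_well_definedP.
move=> n K Kp Km rp rm; rewrite (@boundary_gen n K (fun b => if b then Kp else Km))//.
by case.
Qed.

Lemma resolutions_exist n (K : knot P n.+1) : exists K' : bool -> 'I_n.+1 -> knot P n,
  forall b i, resolves b i K (K' b i).
Proof.
have [f fP] := choice (fun bi : bool * 'I_n.+1 => resolves_ex bi.1 bi.2 K).
by exists (fun b i => f (b, i)) => b i; exact: (fP (b, i)).
Qed.

Lemma boundary_linear n : linear (@boundary R M P n).
Proof. exact: fglift_linear. Qed.

Definition face n (i : 'I_n.+1) (c : chains P n.+1) : chains P n :=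
  fglift (fun A : X P n.+1 => << res true i A >> - << res false i A >>) c.

Lemma boundary_face n (c : chains P n.+1) : boundary c = \sum_(i < n.+1) (-1) ^+ i *: face i c.
Proof.
apply: (eq_linear_freeg (f := @boundary R M P n)
  (g := fun c => \sum_(i < n.+1) (-1) ^+ i *: face i c) _ _ _ c); first exact: boundary_linear.
  move=> a u v; rewrite scaler_sumr -big_split; apply: eq_bigr => i _ /=.
  by rewrite /face fglift_linear scalerDr !scalerA mulrC.
by move=> A; rewrite boundaryU; apply: eq_bigr => i _; rewrite /face fgliftU1.
Qed.

Lemma faceU n (i : 'I_n.+1) A : face i << A >> = << res true i A >> - << res false i A >>.
Proof. exact: fgliftU1. Qed.

Lemma face_face n (i : 'I_n.+2) (j i' : 'I_n.+1) (c : chains P n.+2) :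
  fintype.lift (fintype.lift i j) i' = i -> face j (face i c) = face i' (face (fintype.lift i j) c).
Proof.
move=> ii'; apply: (eq_linear_freeg (f := face j \o face i)
  (g := face i' \o face (fintype.lift i j)) _ _ _ c).
- by apply: linear_comp; exact: fglift_linear.
- by apply: (@linear_comp _ _ _ (face i') (face (fintype.lift i j))); exact: fglift_linear.
- move=> A /=; have lB m (k : 'I_m.+1) : {morph face k : u v / u - v}.
    by move=> u v; apply: linearBf; exact: fglift_linear.
  rewrite !faceU !lB !faceU !(res_res _ _ _ ii').
  (* Of the four double resolutions, the two of mixed signs change places. *)
  by rewrite opprD addrACA -opprD.
Qed.

(** Reindexing the double sum by [face_swap] turns it into its opposite, and 2 is invertible in the
    rationals. *)
Lemma boundary_boundary n (c : chains P n.+2) : boundary (boundary c) = 0.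
Proof.
pose F (p : 'I_n.+2 * 'I_n.+1) := ((-1) ^+ p.1 * (-1) ^+ p.2) *: face p.2 (face p.1 c).
have -> : boundary (boundary c) = \sum_p F p.
  rewrite [in LHS](boundary_face c) (linear_sumf (@boundary_linear n)).
  rewrite -(pair_bigA _ (fun (i : 'I_n.+2) (j : 'I_n.+1) => ((-1) ^+ i * (-1) ^+ j) *: face j (face i c))).
  apply: eq_bigr => i _; rewrite (linearZf (@boundary_linear n)) boundary_face scaler_sumr.
  by apply: eq_bigr => j _; rewrite scalerA.
have : \sum_p F p = - \sum_p F p.
  rewrite {1}(reindex_inj (inv_inj (@face_swapK n))) /= -sumrN; apply: eq_bigr => p _.
  rewrite /F face_swap_sign scaleNr; congr (- (_ *: _)).
  by rewrite -(face_face c (face_swapP p)).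
move/eqP; rewrite -addr_eq0 -mulr2n -scaler_nat scaler_eq0 pnatr_eq0 /=.
by move/eqP.
Qed.

Lemma boundary_complex : chain_complex (@boundary R M P).
Proof. by split; [exact: boundary_linear|exact: boundary_boundary]. Qed.

(** Write [i0 = lift i j], so that j is the place of [i0] once i is removed. Resolving at [i0] first
    gives the same class for both signs, so by [res_res] the operator at j kills [res b i A]. After
    an ordering s the witness is [s^-1 j]. *)
Lemma res_degenerate b n (i i0 : 'I_n.+2) (A : X P n.+2) : i != i0 -> dd i0 A = 0 ->
  degenerate (res b i A).
Proof.
move=> ii0; rewrite /dd !resolution_res => /eqP; rewrite subr_eq0 => /eqP eA.
(* Equal generators of the free module come from equal classes, as comparing a coefficient shows. *)
have e0 : res true i0 A = res false i0 A.
  by have := congr1 (coeff (res true i0 A)) eA; rewrite !coeffU eqxx mul1r; case: eqP.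
case/unlift_some: ii0 => j ji _.
have [i' ii'] : exists i', fintype.lift (fintype.lift i j) i' = i.
  by exists (face_swap (i, j)).2; exact: (face_swapP (i, j)).
move=> s; exists (s^-1 j)%g; rewrite permKV /dd !resolution_res !(res_res _ _ _ ii') -ji e0.
exact: subrr.
Qed.

Lemma boundary_degenerate n c : @degenerate_gens R M P n.+1 c ->
  mspan (@degenerate_gens R M P n) (boundary c).
Proof.
move=> [A dA ->]; have [i0] := dA 1%g; rewrite perm1 => d0.
rewrite /boundary fgliftU1; apply: mspan_sum => i; apply: mspanZ.
have [->|ii0] := eqVneq i i0; first by rewrite d0; exact: mspan0.
(* With a single double point there is only the vanishing term, in accordance with [C_0(D) = 0]. *)
case: n c A dA i0 d0 i ii0 => [|n] c A dA i0 d0 i ii0; first by move: ii0; rewrite !ord1.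
rewrite /dd !resolution_res; apply: mspanD; last apply: mspanN; apply: mspan_gen.
- by exists (res true i A) => //; apply: (res_degenerate true ii0).
- by exists (res false i A) => //; apply: (res_degenerate false ii0).
Qed.

Lemma relative_boundary_complex : relative_chain_complex (@boundary R M P) (@degenerate_gens R M P).
Proof. by apply: relative_chain_complexP; [exact: boundary_complex|exact: boundary_degenerate]. Qed.

Lemma forget_chainsP : forget_chains_well_defined P.
Proof.
move=> n K; rewrite /forget_chains /gen fgliftU1; apply: gen_isotopic.
exact: isotopic_forget (repr_isotopic K).
Qed.

Lemma forget_chains_linear n : linear (@forget_chains R M P n).
Proof. exact: fglift_linear. Qed.

End Hereditary.

Lemma forget_chain_map (P : @structure R M) : hereditary P ->
  chain_map (@boundary R M P) (@boundary R M plain) (@forget_chains R M P).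
Proof.
move=> hP; split=> [n|n c]; first exact: forget_chains_linear.
have lF m := @forget_chains_linear P m.
apply: (eq_chain_maps (f := @forget_chains R M P n \o @boundary R M P n)
  (g := @boundary R M plain n \o @forget_chains R M P n.+1)) c.
- by apply: linear_comp; [exact: lF|exact: boundary_linear].
- by apply: linear_comp; [exact: boundary_linear|exact: lF].
- move=> K /=; have [K' rK] := resolutions_exist hP K.
  rewrite (boundary_gen hP rK) forget_chainsP.
  rewrite (@boundary_gen _ plain_hereditary _ (forget K) (fun b i => forget (K' b i)))//.
  rewrite (linear_sumf (lF n)); apply: eq_bigr => i _.
  by rewrite (linearZf (lF n)) (linearBf (lF n)) !forget_chainsP.
Qed.

(** The signs of s and [s'] differ by the parities of i and [s i]. This form serves the omega
    relations, and the variant [perm_lift_signV] serves [p_b]. *)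
Lemma perm_lift_sign n (s : 'S_n.+1) i (s' : 'S_n) : s = lift_perm i (s i) s' ->
  (-1) ^+ s * (-1) ^+ i = (-1) ^+ s i * (-1) ^+ s' :> rat.
Proof.
move=> ->; rewrite lift_perm_id odd_lift_perm -[in (-1) ^+ i]signr_odd -[in (-1) ^+ s i]signr_odd.
rewrite -!signr_addb; congr (_ ^+ (nat_of_bool _)).
by move: (odd i) (odd (s i)) (odd_perm s') => [] [] [].
Qed.

Lemma perm_lift_signV n (s : 'S_n.+1) i (s' : 'S_n) : s = lift_perm i (s i) s' ->
  (-1) ^+ i * (-1) ^+ s' = (-1) ^+ s * (-1) ^+ s i :> rat.
Proof.
have sq (t : bool) : (-1) ^+ t * (-1) ^+ t = 1 :> rat by rewrite -expr2 sqrr_sign.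
have alg (a b c d : rat) : a * a = 1 -> d * d = 1 -> a * b = c * d -> b * d = a * c.
  move=> aa dd e; rewrite -[LHS]mul1r -aa mulrA -(mulrA a a b) e.
  by rewrite -!mulrA dd mulr1.
by move/perm_lift_sign; apply: alg; exact: sq.
Qed.

(** The chosen representative is isotopic to K, so by [natural_isotopic] it has the same permutation
    and an isotopic naturally ordered knot. *)
Lemma p_b_gen n (K : knot (@based R M) n) (s : 'S_n) (N : knot (@naturally_based R M) n) :
  underlying K = reorder s N -> p_b (gen K) = (-1) ^+ s *: gen N.
Proof.
move=> KN; rewrite /p_b /gen fgliftU1; case: xgetP => [c _ [t [N' [e ->]]]|nex].
  have [<- NN'] := natural_isotopic (isotopic_sym (repr_isotopic K)) KN e.
  by rewrite -[RHS]/(_ *: gen N) (gen_isotopic NN').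
have [t [N' e]] := natural_decomposition (repr (\pi_(X based n) K)).
by case: (nex ((-1) ^+ t *: gen N')); exists t, N'.
Qed.

Lemma p_b_well_definedP : p_b_well_defined (M := M).
Proof. by move=> n K; split; [exact: natural_decomposition|exact: p_b_gen]. Qed.

Lemma p_b_linear n : linear (@p_b R M n).
Proof. exact: fglift_linear. Qed.

Lemma based_reorder n (s : 'S_n) (K : @sknot R M n) : based K -> based (reorder s K).
Proof. by move=> bK i; exact: bK. Qed.

Lemma p_b_chain_map : chain_map (@boundary R M based) (@boundary R M naturally_based) (@p_b R M).
Proof.
split=> [|n c]; first exact: p_b_linear.
apply: (eq_chain_maps (f := @p_b R M n \o @boundary R M based n)
  (g := @boundary R M naturally_based n \o @p_b R M n.+1)) c.
- by apply: linear_comp; [exact: p_b_linear|exact: boundary_linear].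
- by apply: linear_comp; [exact: boundary_linear|exact: p_b_linear].
move=> K /=; have [s [N KN]] := natural_decomposition K.
rewrite (p_b_gen KN) (linearZf (@boundary_linear _ _)).
have [N' rN] := resolutions_exist naturally_based_hereditary N.
have [s' s'P] := choice (perm_lift s).
(* The i-th resolution of [K = reorder s N] is taken to be a reordering of the [s i]-th resolution
   of N; the two boundaries then match after reindexing by s. *)
pose K' b i : knot based n :=
  @Knot R M based n (reorder (s' i) (N' b (s i))) (based_reorder (knotP (N' b (s i))).1).
have rK b i : resolves b i K (K' b i) by rewrite KN; exact: resolves_reorder (s'P i) (rN b (s i)).
rewrite (boundary_gen based_hereditary rK) (boundary_gen naturally_based_hereditary rN).
rewrite (linear_sumf (@p_b_linear n)) scaler_sumr [RHS](reindex_inj (@perm_inj _ s)).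
apply: eq_bigr => i _; rewrite (linearZf (@p_b_linear n)) (linearBf (@p_b_linear n)).
rewrite (@p_b_gen n (K' true i) (s' i) (N' true (s i)))// (@p_b_gen n (K' false i) (s' i) (N' false (s i)))//.
by rewrite -scalerBr !scalerA (perm_lift_signV (s'P i)).
Qed.

(** After reindexing by s, the boundary of a relation is a signed sum of relations between the
    resolutions of K at [s i] and their reorderings by [s' i]. *)
Lemma boundary_omega_relations n c : @omega_relations R M n.+1 c ->
  mspan (@omega_relations R M n) (boundary c).
Proof.
move=> [K [s ->]]; rewrite (linearBf (@boundary_linear _ _)) (linearZf (@boundary_linear _ _)).
have [K' rK] := resolutions_exist plain_hereditary K.
have [s' s'P] := choice (perm_lift s).
have rL b i : resolves b i (reorder_plain s K) (reorder_plain (s' i) (K' b (s i))).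
  exact: resolves_reorder (s'P i) (rK b (s i)).
rewrite (boundary_gen plain_hereditary rK).
rewrite (@boundary_gen _ plain_hereditary _ _ (fun b i => reorder_plain (s' i) (K' b (s i))))//.
rewrite [X in X - _](reindex_inj (@perm_inj _ s)) scaler_sumr -sumrB; apply: mspan_sum => i.
rewrite scalerA (perm_lift_sign (s'P i)) -scalerA -scalerBr; apply: mspanZ.
rewrite scalerBr opprD addrACA -opprD; apply: mspanD; last apply: mspanN; apply: mspan_gen.
- by exists (K' true (s i)), (s' i).
- by exists (K' false (s i)), (s' i).
Qed.

(** The omega complex is the quotient of the unbased one by the span of the sign relations, hence
    itself of relative form. *)
Lemma omega_complex : relative_chain_complex (@boundary R M plain) (@omega_relations R M).
Proof.
by apply: relative_chain_complexP; [exact: boundary_complex plain_hereditary|exact: boundary_omega_relations].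
Qed.

Lemma p_omega_linear n : linear (@p_omega R M n).
Proof. exact: mproj_linear. Qed.

Lemma boundary_omega_complex : chain_complex (@boundary_omega R M).
Proof. exact: omega_complex.2. Qed.

Lemma boundary_omegaE : boundary_omega_well_defined (M := M).
Proof. exact: omega_complex.1. Qed.

Lemma boundary_omega_degenerate n c : @degenerate_gens_omega R M n.+1 c ->
  mspan (@degenerate_gens_omega R M n) (boundary_omega c).
Proof.
move=> [x dx <-]; rewrite boundary_omegaE.
apply: (linear_mspan (@p_omega_linear n)) (boundary_degenerate plain_hereditary dx).
by move=> y dy; apply: mspan_gen; exists y.
Qed.

(** For [K = reorder s N], the two composites give [sign(s) N] and [reorder s N], which differ by
    [sign(s)] times a defining relation. *)
Lemma p_omega_square n (c : @chains R M based n) : p_omega (i_b (p_b c)) = p_omega (p_0 c).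
Proof.
have lb := @p_b_linear n; have li : linear (@i_b R M n) := @forget_chains_linear naturally_based n.
have l0 : linear (@p_0 R M n) := @forget_chains_linear based n; have lo := @p_omega_linear n.
apply: (eq_chain_maps (f := @p_omega R M n \o (@i_b R M n \o @p_b R M n))
  (g := @p_omega R M n \o @p_0 R M n)) c.
- by apply: linear_comp => //; exact: linear_comp.
- exact: linear_comp.
move=> K /=; have [s [N KN]] := natural_decomposition K.
rewrite (p_b_gen KN) (linearZf li) /i_b /p_0 !forget_chainsP; apply/mprojP.
have -> : forget K = reorder_plain s (forget N) by apply: knot_ext => z /=; rewrite KN.
have -> : (-1) ^+ s *: gen (forget N) - gen (reorder_plain s (forget N))
    = (-1) ^+ s *: (gen (forget N) - (-1) ^+ s *: gen (reorder_plain s (forget N))).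
  by rewrite scalerBr scalerA -expr2 sqrr_sign scale1r.
by apply: mspanZ; apply: mspan_gen; exists (forget N), s.
Qed.

End Complexes.

Theorem theorem2p8 (R : realType) (M : oriented_3manifold R) :
  [/\ boundary_well_defined (@based R M),
      boundary_well_defined (@naturally_based R M),
      boundary_well_defined (@plain R M)
    & boundary_omega_well_defined (M := M)] /\
  [/\ p_b_well_defined (M := M),
      forget_chains_well_defined (@based R M)
    & forget_chains_well_defined (@naturally_based R M)] /\
  [/\ chain_complex (@boundary R M based),
      chain_complex (@boundary R M naturally_based),
      chain_complex (@boundary R M plain)
    & chain_complex (@boundary_omega R M)] /\
  [/\ chain_map (@boundary R M based) (@boundary R M naturally_based)
        (@p_b R M),
      chain_map (@boundary R M based) (@boundary R M plain) (@p_0 R M),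
      chain_map (@boundary R M naturally_based) (@boundary_omega R M)
        (fun n c => p_omega (i_b c))
    & chain_map (@boundary R M plain) (@boundary_omega R M) (@p_omega R M)] /\
  (forall n (c : @chains R M based n),
     p_omega (i_b (p_b c)) = p_omega (p_0 c)) /\
  [/\ relative_chain_complex (@boundary R M based)
        (@degenerate_gens R M based),
      relative_chain_complex (@boundary R M naturally_based)
        (@degenerate_gens R M naturally_based),
      relative_chain_complex (@boundary R M plain)
        (@degenerate_gens R M plain)
    & relative_chain_complex (@boundary_omega R M)
        (@degenerate_gens_omega R M)].
Proof.
have bw := @based_hereditary R M; have nw := @naturally_based_hereditary R M.
have pw := @plain_hereditary R M.
split; first by split; do ?exact: boundary_well_definedP; exact: boundary_omegaE.
split; first by split; [exact: p_b_well_definedP|exact: forget_chainsP|exact: forget_chainsP].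
split; first by split; do ?exact: boundary_complex; exact: boundary_omega_complex.
have [li ci] := forget_chain_map nw.
split; first split.
- exact: p_b_chain_map.
- exact: forget_chain_map.
- split=> [n|n c].
    exact: linear_comp (@p_omega_linear R M n) (li n).
  by rewrite boundary_omegaE -ci.
- by split=> [n|n c]; [exact: p_omega_linear|rewrite boundary_omegaE].
split; first exact: p_omega_square.
split; try exact: relative_boundary_complex.
apply: relative_chain_complexP; first exact: boundary_omega_complex.
exact: boundary_omega_degenerate.
Qed.
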